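(* Let $\chi$ be a character of $F^*$, $\psi$ a non-trivial character of $F$, and $\phi\in S(F)$. For every integer $k$ with $0\le k<n$ one has, as meromorphic functions of $s$, $$\zeta_{n,k}(s,\chi,\widehat\phi)=\sum_{m=0}^{n-1}\theta_m(s,\chi,\psi)\,\zeta_{n,\,m+e(\psi,\chi)-k}(1-s,\chi^{-1},\phi),$$ where, if $\chi$ is unramified, $$\theta_m(s,\chi,\psi)=\epsilon^{-1}(s,\chi,\psi)\,L(ns,\chi^n)\,\bigl(\chi(\varpi)q^{-s}\bigr)^m\times\begin{cases}1-q^{-1} & 0\le m\le n-2,\\ L^{-1}(1-ns,\chi^{-n}) & m=n-1,\end{cases}$$ and, if $\chi$ is ramified, $$\theta_m(s,\chi,\psi)=\begin{cases}\chi(-1)\,\epsilon^{-1}(s,\chi,\psi) & m=0,\\ 0 & m\ne0.\end{cases}$$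
   Context: $n\ge 1$ is an integer, $F$ is a $p$-adic field of residual characteristic $p$ with $\gcd(p,n)=1$, and $F^*$ contains the full group of $n$-th roots of unity. $\mathbb O_F$ is the ring of integers, $\mathbb P_F$ its maximal ideal, $\varpi$ a fixed generator of $\mathbb P_F$, $q$ the cardinality of the residue field, $\|\varpi\|=q^{-1}$. $e(\psi)$ is the conductor of $\psi$ (smallest integer $m$ with $\psi$ trivial on $\mathbb P_F^m$); $e(\chi)$ is the conductor of $\chi$ ($0$ if $\chi$ is unramified, otherwise the least $m\ge 1$ with $\chi$ trivial on $1+\mathbb P_F^m$); $e(\psi,\chi)=e(\psi)-e(\chi)$. Characters of $F^*$ need not be unitary. $S(F)$ is the space of Schwartz (locally constant, compactly supported) functions on $F$. $d_\psi x$ is the Haar measure on $F$ self dual with respect to $\psi$, $d_\psi^*x=\|x\|^{-1}d_\psi x$, and $\widehat\phi(x)=\int_F\phi(y)\psi(xy)\,d_\psi y$. For a function $\phi$ on $F^*$, $\zeta(s,\chi,\phi)$ denotes the meromorphic continuation of $\int_{F^*}\phi(x)\|x\|^s\chi(x)\,d_\psi^*x$. For an integer $k$, $F^*_{n,k}$ is the set of elements of $F^*$ whose valuation lies in $k+n\mathbb Z$, $\beta_{n,k}$ is its characteristic function, and $\zeta_{n,k}(s,\chi,\phi)=\zeta(s,\chi,\phi\cdot\beta_{n,k})$. $L(s,\chi)=(1-\chi(\varpi)q^{-s})^{-1}$ if $\chi$ is unramified and $L(s,\chi)=1$ otherwise. $\epsilon(s,\chi,\psi)$ is the Tate epsilon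 factor, defined by $\gamma(s,\chi,\psi)=\epsilon(s,\chi,\psi)\dfrac{L(1-s,\chi^{-1})}{L(s,\chi)}$, where $\gamma(s,\chi,\psi)$ is the Tate gamma factor: $\zeta(1-s,\chi^{-1},\widehat\phi)=\gamma(s,\chi,\psi)\,\zeta(s,\chi,\phi)$ for all $\phi\in S(F)$. *)

(* Defs.v *)
From HB Require Import structures.
From mathcomp Require Import all_boot all_order all_algebra.
From mathcomp Require Import finmap complex.
From mathcomp Require Import all_classical all_reals all_analysis.

Set Implicit Arguments.
Unset Strict Implicit.
Unset Printing Implicit Defensive.

Import Order.TTheory GRing.Theory Num.Theory.
Import numFieldNormedType.Exports.

Local Open Scope classical_set_scope.
Local Open Scope ring_scope.
Local Open Scope complex_scope.

(** * p-adic fields *)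

(* For a valuation [v], whose value at [0] is irrelevant, [frac_ideal v m] is
   the fractional ideal P^m: [m = 0] gives the ring of integers and [m = 1]
   its maximal ideal. *)
Definition frac_ideal (F : fieldType) (v : F -> int) (m : int) : set F :=
  [set x | x != 0 -> m <= v x].

Definition residue_classes (F : fieldType) (v : F -> int) : set (set F) :=
  [set [set y | frac_ideal v 1 (y - x)] | x in frac_ideal v 0].

(* Fields of characteristic 0, complete for a normalized discrete valuation
   with finite residue field, that is, finite extensions of some Q_p. *)
HB.mixin Record TopologicalField_isPadic F of GRing.Field F & Topological F := {
  vl : F -> int;
  vlM : forall x y : F, x != 0 -> y != 0 -> vl (x * y) = vl x + vl y;
  vlD : forall x y : F, x != 0 -> y != 0 -> x + y != 0 ->
    Num.min (vl x) (vl y) <= vl (x + y);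
  vl_surj : exists2 x : F, x != 0 & vl x = 1;
  nbhs_vl : forall (x : F) (A : set F),
    nbhs x A <-> exists m : int, forall y, frac_ideal vl m (y - x) -> A y;
  vl_complete : forall u : nat -> F,
    (forall m : int, exists N : nat, forall i j : nat,
        (N <= i)%N -> (N <= j)%N -> frac_ideal vl m (u i - u j)) ->
    exists l : F, u @ \oo --> l;
  residue_finite : finite_set (residue_classes vl);
  padic_pchar0 : [pchar F] =i pred0
}.

#[short(type="padicFieldType")]
HB.structure Definition PadicField :=
  {F of GRing.Field F & Topological F & TopologicalField_isPadic F}.

Section PadicField.
Variable F : padicFieldType.

Definition idealP (m : int) : set F := frac_ideal vl m.

Definition residue_card : nat := #|` fset_set (residue_classes (@vl F))|.

(* [1] is never in the maximal ideal, so the second condition says exactly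
   that the residue field has characteristic [p]. *)
Definition residue_char (p : nat) : Prop := prime p /\ idealP 1 (p%:R).

Definition uniformizer (x : F) : Prop := x != 0 /\ vl x = 1.

Definition borelF : Type := F.
HB.instance Definition _ := Choice.on borelF.
HB.instance Definition _ := isPointed.Build borelF (0 : F).
HB.instance Definition _ :=
  Measurable.copy borelF (g_sigma_algebraType (@open F : set (set borelF))).

End PadicField.

(** * Complex functions *)

(* The detour through [numClosedFieldType] gives access to the topology that
   MathComp-Analysis puts on numeric fields; it has no instance on [R[i]]. *)
Definition C (R : realType) : numClosedFieldType := R[i].

Section ComplexFunctions.
Variable R : realType.
Implicit Types (f g h : C R -> C R) (s t : C R).

Definition cexp s : C R :=
  (expR (complex.Re s) * cos (complex.Im s)) +i*
  (expR (complex.Re s) * sin (complex.Im s)).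

(* [a ^ s] for a positive real [a]. *)
Definition cpow (a : R) s : C R := cexp (s * (ln a)%:C).

Definition analytic_at f s : Prop :=
  exists a : nat -> C R,
    \forall t \near s, series (fun k => a k * (t - s) ^+ k) @ \oo --> f t.

Definition meromorphic f : Prop := forall s, exists g h,
  [/\ analytic_at g s, analytic_at h s &
      \forall t \near s^', h t != 0 /\ f t = g t / h t].

(* Equality of meromorphic functions: the total functions representing them
   agree off a closed discrete set, values at poles being irrelevant. *)
Definition mero_eq f g : Prop :=
  [/\ meromorphic f, meromorphic g &
      forall s, \forall t \near s^', f t = g t].

End ComplexFunctions.

Section ComplexIntegral.
Context d (T : measurableType d) (R : realType).
Variables (mu : {measure set T -> \bar R}) (D : set T).
Implicit Type f : T -> C R.

Definition cintegrable f : Prop :=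
  mu.-integrable D (fun x => (complex.Re (f x))%:E) /\
  mu.-integrable D (fun x => (complex.Im (f x))%:E).

Definition cintegral f : C R :=
  Rintegral mu D (fun x => complex.Re (f x)) +i*
  Rintegral mu D (fun x => complex.Im (f x)).

End ComplexIntegral.

(** * Characters, Fourier transform and zeta integrals *)

Section Tate.
Variables (R : realType) (F : padicFieldType).
Local Notation q := ((residue_card F)%:R : R).
Implicit Types (psi chi phi : F -> C R) (mu : {measure set (borelF F) -> \bar R}).

Definition normF (x : F) : R := if x == 0 then 0 else q ^ (- vl x).

Definition add_character psi : Prop :=
  [/\ forall x y, psi (x + y) = psi x * psi y,
      forall x, psi x != 0 & continuous psi].

(* A function on F^* is represented by a function on [F] whose value at [0] is
   never used; this applies to [chi] here and to [phi] in [zeta]. *)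
Definition mul_character chi : Prop :=
  [/\ forall x y, x != 0 -> y != 0 -> chi (x * y) = chi x * chi y,
      forall x, x != 0 -> chi x != 0 &
      forall x, x != 0 -> {for x, continuous chi}].

Definition char_inv chi : F -> C R := fun x => (chi x)^-1.
Definition char_exp chi (n : nat) : F -> C R := fun x => chi x ^+ n.

Definition unramified chi : Prop := forall x, x != 0 -> vl x = 0 -> chi x = 1.

Definition trivial_on_ideal psi (m : int) : Prop :=
  forall x, idealP m x -> psi x = 1.

Definition trivial_on_units chi (m : nat) : Prop :=
  forall x, idealP m%:Z (x - 1) -> chi x = 1.

Definition add_conductor psi : int :=
  xget 0 [set m | trivial_on_ideal psi m /\
                  forall m', trivial_on_ideal psi m' -> m <= m'].

Definition mul_conductor chi : nat :=
  if `[< unramified chi >] then 0%N else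
  xget 0%N [set m | [/\ (1 <= m)%N, trivial_on_units chi m &
                  forall m', (1 <= m')%N -> trivial_on_units chi m' ->
                             (m <= m')%N]].

Definition cond psi chi : int := add_conductor psi - (mul_conductor chi)%:Z.

Definition schwartz phi : Prop :=
  (forall x, \forall y \near x, phi y = phi x) /\
  compact (closure [set x | phi x != 0]).

Definition fourier mu psi phi : F -> C R :=
  fun x => cintegral mu setT (fun y => phi y * psi (x * y)).

Definition haar_measure mu : Prop :=
  [/\ forall (a : F) (A : set (borelF F)), measurable A ->
        mu [set a + x | x in A] = mu A,
      forall K : set F, compact K -> (mu K < +oo)%E &
      forall U : set F, open U -> U !=set0 -> (0 < mu U)%E].

Definition self_dual_measure mu psi : Prop :=
  haar_measure mu /\
  forall phi, schwartz phi ->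
    forall x, fourier mu psi (fourier mu psi phi) x = phi (- x).

(* [mu] is the additive measure dx: the factor [(normF x)^-1] turns it into
   the multiplicative measure d^*x. *)
Definition zeta_integrand chi phi (s : C R) : F -> C R :=
  fun x => phi x * cpow (normF x) s * chi x * ((normF x)^-1)%:C.

Definition zeta_continuation mu chi phi : set (C R -> C R) :=
  [set Z | meromorphic Z /\
     exists sigma : R, forall s : C R, sigma < complex.Re s ->
       cintegrable mu [set x : F | x != 0] (zeta_integrand chi phi s) /\
       Z s = cintegral mu [set x : F | x != 0] (zeta_integrand chi phi s)].

(* By analytic continuation any two elements of [zeta_continuation] agree as
   meromorphic functions, so that the choice made by [xget] is harmless. *)
Definition zeta mu chi phi : C R -> C R :=
  xget (fun=> 0) (zeta_continuation mu chi phi).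

Definition beta (n : nat) (k : int) : F -> C R :=
  fun x => if (x != 0) && (vl x == k %[mod n%:Z])%Z then 1 else 0.

Definition zeta_n mu (n : nat) (k : int) chi phi : C R -> C R :=
  zeta mu chi (fun x => phi x * beta n k x).

(** * Local factors *)

Definition Lfactor (varpi : F) chi (s : C R) : C R :=
  if `[< unramified chi >] then (1 - chi varpi * cpow q (- s))^-1 else 1.

Definition tate_gamma mu psi chi (gamma : C R -> C R) : Prop :=
  meromorphic gamma /\
  forall phi, schwartz phi ->
    mero_eq (fun s => zeta mu (char_inv chi) (fourier mu psi phi) (1 - s))
            (fun s => gamma s * zeta mu chi phi s).

(* [gamma s = epsilon s * L(1 - s, chi^-1) / L(s, chi)] solved for epsilon. *)
Definition tate_epsilon (varpi : F) chi (gamma : C R -> C R) (s : C R) : C R :=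
  gamma s * Lfactor varpi chi s / Lfactor varpi (char_inv chi) (1 - s).

Definition theta (n : nat) (varpi : F) chi (epsilon : C R -> C R) (m : nat)
    (s : C R) : C R :=
  if `[< unramified chi >] then
    (epsilon s)^-1 * Lfactor varpi (char_exp chi n) (n%:R * s) *
    (chi varpi * cpow q (- s)) ^+ m *
    (if m == n.-1
     then (Lfactor varpi (char_inv (char_exp chi n)) (1 - n%:R * s))^-1
     else 1 - (q^-1)%:C)
  else
    if m == 0%N then chi (- 1) * (epsilon s)^-1 else 0.

End Tate.

(* Main.v *)
(* Let X = q^-s and let zeta_l be the part of the zeta integral supported on the
   valuations congruent to l modulo n. For a Schwartz function, zeta_l is a
   Laurent polynomial in X plus a geometric tail, hence a rational function of X
   lying in X^l C(X^n): multiplying X by an n-th root of unity omega multiplies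
   zeta_l by omega^l. The substitution X -> omega X is the translation
   s -> s + c with q^-c = omega, so Tate's functional equation for the full zeta
   integral, read at the n points s + j c, is a system that a finite Fourier
   transform splits into the n graded parts. The coefficients theta_m are the
   graded parts of chi(-1) / gamma(s), where gamma is made explicit by one test
   function: the indicator of the integers when chi is unramified, of
   1 + P^e(chi) when it is ramified. That zeta, chosen among meromorphic
   continuations, agrees with the explicit formula is the identity theorem,
   which rests on the isolation of the zeros of power series. *)

Require Import Defs.
From HB Require Import structures.
From mathcomp Require Import all_boot all_order all_algebra.
From mathcomp Require Import finmap complex.
From mathcomp Require Import all_classical all_reals all_analysis.
From mathcomp Require Import measurable_realfun.
From mathcomp Require Import zify ring lra.

Set Implicit Arguments.
Unset Strict Implicit.
Unset Printing Implicit Defensive.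

Import Order.TTheory GRing.Theory Num.Theory.
Import numFieldNormedType.Exports.

Local Open Scope classical_set_scope.
Local Open Scope ring_scope.

(** * Complex exponential and power series *)

(** Identities between functions of s are all kept in the form [ae]: true on a punctured
    neighbourhood of every point. This form survives finite conjunctions and affine substitutions,
    so facts at the points s + jc and 1 - s - jc can be collected at one generic s, where the
    conclusion is field algebra. Complex analysis is thus reduced to the field operations on local
    quotients of power series and to the identity theorem; for this [cexp], defined by real and
    imaginary parts, has to be recognised as the sum of its series.

    The definition of gamma has the transform of phi on the side of 1 - s, the theorem on the side
    of s. Hence gamma is applied to the transform itself: self-duality turns the double transform
    into phi(-x), and this is the origin of chi(-1) / gamma(s).

    Dividing by gamma requires gamma != 0 at the n shifted points. For ramified chi this is the
    nonvanishing of a Gauss sum, obtained by playing two functional equations against each other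
    instead of computing an absolute value. *)

Section ComplexNumbers.
Variable R : realType.
Implicit Types (x y : R) (z w : C R).
Local Open Scope complex_scope.

Definition rc x : C R := x%:C.

Lemma rcD x y : rc (x + y) = rc x + rc y.
Proof. exact: (rmorphD (real_complex R)). Qed.
Lemma rcN x : rc (- x) = - rc x.
Proof. exact: (rmorphN (real_complex R)). Qed.
Lemma rcB x y : rc (x - y) = rc x - rc y.
Proof. exact: (rmorphB (real_complex R)). Qed.
Lemma rcM x y : rc (x * y) = rc x * rc y.
Proof. exact: (rmorphM (real_complex R)). Qed.
Lemma rcX x n : rc (x ^+ n) = rc x ^+ n.
Proof. exact: (rmorphXn (real_complex R)). Qed.
Lemma rcV x : rc x^-1 = (rc x)^-1.
Proof. exact: (fmorphV (real_complex R)). Qed.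
Lemma rc0 : rc 0 = 0. Proof. by []. Qed.
Lemma rc1 : rc 1 = 1. Proof. by []. Qed.
Lemma rcn n : rc n%:R = n%:R.
Proof. exact: (rmorph_nat (real_complex R)). Qed.
Lemma rc_sum I (r : seq I) (P : pred I) (F : I -> R) :
  rc (\sum_(i <- r | P i) F i) = \sum_(i <- r | P i) rc (F i).
Proof. exact: (rmorph_sum (real_complex R)). Qed.
Lemma rc_inj : injective rc. Proof. by move=> x y []. Qed.
Lemma rc_eq0 x : (rc x == 0) = (x == 0).
Proof. by rewrite -rc0 (inj_eq rc_inj). Qed.
Lemma rc_le x y : (rc x <= rc y) = (x <= y).
Proof. exact: lecR. Qed.
Lemma rc_lt x y : (rc x < rc y) = (x < y).
Proof. exact: ltcR. Qed.

(** The norm of [C R] takes its values in [C R]; [nrm] is the same number seen in [R], so that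
    estimates can be made over the reals. *)
Definition nrm z : R := complex.Re `|z|.

Lemma nrmE z : `|z| = rc (nrm z).
Proof. by rewrite /nrm /rc normc_def. Qed.
Lemma nrm_ge0 z : 0 <= nrm z.
Proof. by rewrite -rc_le rc0 -nrmE. Qed.
Lemma nrmM z w : nrm (z * w) = nrm z * nrm w.
Proof. by apply: rc_inj; rewrite rcM -!nrmE normrM. Qed.
Lemma nrmX z n : nrm (z ^+ n) = nrm z ^+ n.
Proof. by apply: rc_inj; rewrite rcX -!nrmE normrX. Qed.
Lemma nrmD z w : nrm (z + w) <= nrm z + nrm w.
Proof. by rewrite -rc_le rcD -!nrmE ler_normD. Qed.
Lemma nrm_eq0 z : (nrm z == 0) = (z == 0).
Proof. by rewrite -rc_eq0 -nrmE normr_eq0. Qed.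
Lemma nrm_rc x : nrm (rc x) = `|x|.
Proof. by rewrite /nrm normc_def /= expr0n addr0 sqrtr_sqr. Qed.
Lemma nrm_Re z : `|complex.Re z| <= nrm z.
Proof. by rewrite -rc_le -nrmE; exact: normc_ge_Re. Qed.
Lemma cReD z w : complex.Re (z + w) = complex.Re z + complex.Re w.
Proof. by case: z w => [a b] [c d]. Qed.
Lemma cReN z : complex.Re (- z) = - complex.Re z.
Proof. by case: z. Qed.
Lemma nrm_Im z : `|complex.Im z| <= nrm z.
Proof.
rewrite /nrm normc_def /= -sqrtr_sqr ler_wsqrtr // lerDr sqr_ge0 //.
Qed.

Lemma cvg_rc (u : nat -> R) x :
  u @ \oo --> x -> (fun n => rc (u n)) @ \oo --> rc x.
Proof.
move=> ux; apply/cvgrPdist_lt => e e0.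
(* Positivity in [C R] includes being real, so a complex radius is the image of a real one. *)
have eR : e = rc (complex.Re e).
  by move: e0; case: e => a b; rewrite ltcE /= => /andP[/eqP -> _].
move: e0; rewrite eR -rc0 rc_lt => e0.
move/cvgrPdist_lt: ux => /(_ _ e0); apply: filterS => n.
by rewrite -rcB nrmE nrm_rc rc_lt.
Qed.

Lemma cvg_nrm0 (u : nat -> C R) (v : nat -> R) :
  (forall n, nrm (u n) <= v n) -> v @ \oo --> (0 : R) -> u @ \oo --> (0 : C R).
Proof.
move=> uv /cvg_rc v0; apply/norm_cvg0P/cvgrPdist_lt => e e0.
move/cvgrPdist_lt : v0 => /(_ _ e0); apply: filterS => n.
rewrite rc0 !sub0r !normrN normr_id; apply: le_lt_trans.
rewrite !nrmE nrm_rc rc_le (le_trans (uv n))// ler_norm //.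
Qed.

End ComplexNumbers.

(** * Cauchy products of partial sums *)

Section CauchyProduct.

(** Both sides run over the triangle i + j < n; the induction adds the antidiagonal i + j = n. *)
Lemma cauchy_partial (K : pzRingType) (u v : nat -> K) n :
  \sum_(m < n) \sum_(i < m.+1) u i * v (m - i)%N =
  \sum_(i < n) \sum_(j < n | (i + j < n)%N) u i * v j.
Proof.
elim: n => [|n IH]; first by rewrite !big_ord0.
rewrite big_ord_recr /= IH [RHS]big_ord_recr /=.
have -> : \sum_(j < n.+1 | (n + j < n.+1)%N) u n * v j = u n * v 0%N.
  rewrite (bigD1 ord0) /=; last by rewrite addn0.
  rewrite big1 ?addr0 // => j /andP[]; rewrite -[X in (_ < X)%N]addn1 ltn_add2l.
  by case: j => -[].
rewrite big_ord_recr /= subnn addrA; congr (_ + _).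
rewrite -big_split /=; apply: eq_bigr => i _.
rewrite (bigD1 (rev_ord (widen_ord (leqnSn n) i))) /=; last first.
  by rewrite subSS subnKC // ltnW.
rewrite ?subSS addrC; congr (_ + _).
rewrite [RHS]big_mkcond big_ord_recr /=.
have -> : (ord_max == rev_ord (widen_ord (leqnSn n) i) :> 'I_n.+1) = (i == 0%N :> nat).
  apply/eqP/eqP => [/(congr1 val) /=|i0].
    by rewrite ?subSS => h; move: (ltn_ord i); lia.
  by apply/val_inj; rewrite /= i0 ?subSS subn0.
have -> : (if (i + n < n.+1)%N && ~~ (i == 0%N :> nat) then u i * v n else 0) = 0.
  by case: ifP => //; case: (nat_of_ord i) => [|k]; rewrite ?andbF //; lia.
rewrite addr0 big_mkcond; apply: eq_bigr => j _; congr (if _ then _ else _).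
have -> : (widen_ord (leqnSn n) j == rev_ord (widen_ord (leqnSn n) i)) = (i + j == n)%N.
  apply/eqP/eqP => [/(congr1 val) /=|h].
    by rewrite ?subSS => h; move: (ltn_ord i); lia.
  by apply/val_inj; rewrite /= ?subSS; lia.
by rewrite /= ltnS ltn_neqAle andbC.
Qed.

(** The square of indices without its triangle is the corner n <= i + j. Convergence of a product of
    series is reduced to showing that this corner tends to 0, for the exponential as well as for
    local expansions. *)
Lemma cauchy_defect (K : pzRingType) (u v : nat -> K) n :
  (\sum_(i < n) u i) * (\sum_(j < n) v j)
    - \sum_(m < n) \sum_(i < m.+1) u i * v (m - i)%N =
  \sum_(i < n) \sum_(j < n | (n <= i + j)%N) u i * v j.
Proof.
rewrite cauchy_partial mulr_suml -sumrB; apply: eq_bigr => i _.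
rewrite mulr_sumr (bigID (fun j : 'I_n => (i + j < n)%N)) /= addrC addrK.
by apply: eq_bigl => j; rewrite -leqNgt.
Qed.

End CauchyProduct.

Lemma seq_cvg_unique (K : numFieldType) (u : nat -> K) (a b : K) :
  u @ \oo --> a -> u @ \oo --> b -> a = b.
Proof. by apply: cvg_unique; exact: norm_hausdorff. Qed.

Lemma cvg_ext (K : numFieldType) (u v : nat -> K) (a : K) :
  u =1 v -> u @ \oo --> a -> v @ \oo --> a.
Proof. by move=> /funext ->. Qed.

Lemma cvg_prod_defect (K : numFieldType) (u v d t : nat -> K) (a b : K) :
  u @ \oo --> a -> v @ \oo --> b -> d @ \oo --> (0 : K) ->
  (forall n, t n = u n * v n - d n) -> t @ \oo --> a * b.
Proof.
move=> ua vb d0 /funext ->; rewrite -[Y in _ --> Y]subr0.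
by apply: cvgB => //; exact: cvgM.
Qed.

Lemma cvg_lin_comb (K : numFieldType) (u v : nat -> K) (a b c : K) :
  u @ \oo --> a -> v @ \oo --> b -> (fun n => u n + c * v n) @ \oo --> a + c * b.
Proof. by move=> ua vb; apply: cvgD => //; exact: cvgMr. Qed.

Lemma cvg_scale (K : numFieldType) (u : nat -> K) (a c : K) :
  u @ \oo --> a -> (fun n => c * u n) @ \oo --> c * a.
Proof. exact: cvgMr. Qed.

Section Exponential.
Variable R : realType.
Implicit Types (x y : R) (z w : C R).
Local Open Scope complex_scope.

Definition exp_term (K : unitRingType) (z : K) n : K := z ^+ n / n`!%:R.

Lemma exp_termX (K : fieldType) (z w : K) n : exp_term (z * w) n = exp_term z n * w ^+ n.
Proof. by rewrite /exp_term exprMn mulrAC. Qed.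

Lemma exp_termD (K : numFieldType) (z w : K) m :
  \sum_(i < m.+1) exp_term z i * exp_term w (m - i)%N = exp_term (z + w) m.
Proof.
rewrite /exp_term addrC exprDn mulr_suml; apply: eq_bigr => i _.
have im : (i <= m)%N by rewrite -ltnS.
have f0 k : (k`!%:R : K) != 0 by rewrite pnatr_eq0 -lt0n fact_gt0.
apply: (mulIf (f0 m)); rewrite mulfVK // -mulr_natr -(bin_fact im) !natrM.
by field; rewrite !f0.
Qed.

(** Over the reals the law exp(x + y) = exp(x) exp(y) is at hand, so the corner is a difference of
    two sequences with the same limit. By the triangle inequality it dominates the corner of the
    complex series. *)
Lemma cvg_exp_defect x y :
  (fun n => \sum_(i < n) \sum_(j < n | (n <= i + j)%N)
     exp_term x i * exp_term y j) @ \oo --> (0 : R).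
Proof.
have ex (t : R) : (fun n => \sum_(i < n) exp_term t i) @ \oo --> expR t.
  have := is_cvg_series_exp_coeff t; rewrite /expR => h.
  apply: cvg_trans h; apply: near_eq_cvg; near=> n.
  by rewrite /series /= big_mkord.
have -> : (fun n => \sum_(i < n) \sum_(j < n | (n <= i + j)%N) exp_term x i * exp_term y j) =
  (fun n => (\sum_(i < n) exp_term x i) * (\sum_(i < n) exp_term y i) -
     \sum_(i < n) exp_term (x + y) i).
  apply/funext => n; rewrite -cauchy_defect; congr (_ - _).
  by apply: eq_bigr => i _; rewrite exp_termD.
have -> : nbhs (0 : R) = nbhs (expR x * expR y - expR (x + y)) by rewrite expRD subrr.
by apply: cvgB; [apply: cvgM|]; exact: ex.
Unshelve. all: by end_near. Qed.

Lemma cvg_exp_prod z w (a b : C R) :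
  (fun n => \sum_(i < n) exp_term z i) @ \oo --> a ->
  (fun n => \sum_(i < n) exp_term w i) @ \oo --> b ->
  (fun n => \sum_(i < n) exp_term (z + w) i) @ \oo --> a * b.
Proof.
move=> za wb.
have h : (fun n => \sum_(i < n) \sum_(j < n | (n <= i + j)%N)
     exp_term z i * exp_term w j) @ \oo --> (0 : C R).
  apply: cvg_nrm0 (cvg_exp_defect (nrm z) (nrm w)) => n.
  rewrite -rc_le -nrmE; apply: (le_trans (ler_norm_sum _ _ _)).
  rewrite rc_sum; apply: ler_sum => i _.
  apply: (le_trans (ler_norm_sum _ _ _)).
  rewrite rc_sum; apply: ler_sum => j _.
  by rewrite /exp_term !rcM !rcV !rcX !rcn -!nrmE !(normrM, normfV, normrX, normr_nat).
apply: cvg_prod_defect za wb h _ => n; rewrite -cauchy_defect opprB addrCA subrr addr0.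
by apply: eq_bigr => i _; rewrite exp_termD.
Qed.

Lemma cvg_exp_rc x : (fun n => \sum_(i < n) exp_term (rc x) i) @ \oo --> rc (expR x).
Proof.
have -> : (fun n => \sum_(i < n) exp_term (rc x) i) =
          (fun n => rc (series (exp_coeff x) n)).
  apply/funext => n; rewrite /series /= big_mkord rc_sum.
  by apply: eq_bigr => i _; rewrite /exp_coeff /= rcM rcX rcV rcn.
by apply: cvg_rc; exact: is_cvg_series_exp_coeff.
Qed.

Definition ic : C R := 'i.

Lemma cvg_exp_ic y : (fun n => \sum_(i < n) exp_term (ic * rc y) i) @ \oo -->
  rc (cos y) + ic * rc (sin y).
Proof.
have -> : (fun n => \sum_(i < n) exp_term (ic * rc y) i) =
   (fun n => rc (series (cos_coeff y) n) + ic * rc (series (sin_coeff y) n)).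
  apply/funext => n; rewrite /series /= !big_mkord !rc_sum mulr_sumr -big_split.
  apply: eq_bigr => i _; rewrite /cos_coeff /sin_coeff /exp_term /=.
  have ic2 : ic ^+ 2 = -1 by exact: sqr_i.
  rewrite exprMn.
  (* Even powers of i feed the cosine series and odd powers the sine series. *)
  have -> : ic ^+ i = rc ((~~ odd i)%:R * (-1) ^+ i./2) + ic * rc ((odd i)%:R * (-1) ^+ i.-1./2).
    rewrite -{1}(odd_double_half i) exprD -mul2n exprM ic2 !rcM !rcX !rcN !rc1 !rcn.
    case oi: (odd i) => /=; last by rewrite expr0 !mul1r mul0r mulr0 addr0.
    rewrite expr1 mul0r add0r mul1r; congr (_ * (_ ^+ _)).
    by move: (odd_double_half i); rewrite oi; case: (nat_of_ord i) => // k /= ?; lia.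
  rewrite -exprnP !rcM !rcX !rcV !rcn; ring.
apply: cvg_lin_comb; apply: cvg_rc.
- by rewrite cos.unlock; exact: is_cvg_series_cos_coeff.
- by rewrite sin.unlock; exact: is_cvg_series_sin_coeff.
Qed.

(** Both the addition formula and the analyticity of [cexp] are deduced from its series rather than
    from its definition by [expR], [cos] and [sin]. *)
Lemma cvg_exp z : (fun n => \sum_(i < n) exp_term z i) @ \oo --> cexp z.
Proof.
have -> : cexp z = rc (expR (complex.Re z)) *
    (rc (cos (complex.Im z)) + ic * rc (sin (complex.Im z))).
  rewrite /cexp /rc /ic; simpc; congr (_ +i* _).
have {1}-> : z = rc (complex.Re z) + ic * rc (complex.Im z) by exact: complexE.
by apply: cvg_exp_prod; [exact: cvg_exp_rc | exact: cvg_exp_ic].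
Qed.

Lemma cexpD z w : cexp (z + w) = cexp z * cexp w.
Proof.
exact: seq_cvg_unique (@cvg_exp (z + w)) (cvg_exp_prod (@cvg_exp z) (@cvg_exp w)).
Qed.

Lemma cexp0 : cexp 0 = 1 :> C R.
Proof. by rewrite /cexp /= expR0 cos0 sin0 mulr1 mulr0. Qed.

Lemma cexp_neq0 z : cexp z != 0.
Proof.
apply/eqP => z0; have := cexpD z (- z).
by rewrite subrr cexp0 z0 mul0r => /eqP; rewrite oner_eq0.
Qed.

Lemma cexpN z : cexp (- z) = (cexp z)^-1.
Proof.
by apply: (mulIf (cexp_neq0 z)); rewrite -cexpD addrC subrr cexp0 mulVf // cexp_neq0.
Qed.

Lemma cexp_natM n z : cexp (n%:R * z) = cexp z ^+ n.
Proof.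
elim: n => [|n IH]; first by rewrite mul0r cexp0 expr0.
by rewrite -natr1 mulrDl mul1r cexpD IH exprSr.
Qed.

Lemma cexp_intM (n : int) z : cexp (n%:~R * z) = cexp z ^ n.
Proof.
case: n => n; first exact: cexp_natM.
have -> : (Negz n)%:~R = - n.+1%:R :> C R by [].
by rewrite mulNr cexpN cexp_natM.
Qed.

Lemma nrm_cexp z : nrm (cexp z) = expR (complex.Re z).
Proof.
rewrite /nrm normc_def /= !exprMn -mulrDr cos2Dsin2 mulr1 sqrtr_sqr ger0_norm //.
Qed.

End Exponential.

(** * Properties that hold off a closed discrete set *)

Section Neighborhoods.
Variable R : realType.
Implicit Types (s t : C R) (P : C R -> Prop).

Lemma near_nrmP s P :
  (\forall t \near s, P t) <-> exists2 r : R, 0 < r & forall t, nrm (t - s) < r -> P t.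
Proof.
split=> [/nbhs_ballP[e /= e0 eP]|[r r0 rP]].
  have eR : e = rc (complex.Re e).
    by move: e0; case: (e) => a b; rewrite ltcE /= => /andP[/eqP -> _].
  exists (complex.Re e); first by rewrite -rc_lt -eR.
  by move=> t ts; apply: eP; rewrite -ball_normE /= distrC nrmE eR rc_lt.
apply/nbhs_ballP; exists (rc r); first by rewrite /= -rc0 rc_lt.
by move=> t; rewrite -ball_normE /= distrC nrmE rc_lt; exact: rP.
Qed.

Lemma dnear_nrmP s P :
  (\forall t \near s^', P t) <->
  exists2 r : R, 0 < r & forall t, t != s -> nrm (t - s) < r -> P t.
Proof.
split=> [/near_nrmP[r r0 rP]|[r r0 rP]]; first by exists r => // t ts /rP; exact.
by apply/near_nrmP; exists r => // t tr ts; exact: rP.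
Qed.

(** The exceptional set has no accumulation point. For an equality of two functions this is the last
    clause of [mero_eq]. *)
Definition ae P := forall s, \forall t \near s^', P t.

Lemma ae_true P : (forall s, P s) -> ae P.
Proof. by move=> h s; apply: nearW. Qed.

Lemma aeS P Q : (forall s, P s -> Q s) -> ae P -> ae Q.
Proof. by move=> PQ h s; apply: filterS (h s). Qed.

Lemma aeS2 P Q U : (forall s, P s -> Q s -> U s) -> ae P -> ae Q -> ae U.
Proof. by move=> PQ h k s; apply: filterS2 (h s) (k s). Qed.

Lemma ae_and P Q : ae P -> ae Q -> ae (fun s => P s /\ Q s).
Proof. by apply: aeS2. Qed.

(** Serves the two substitutions of the proof, the reflection s -> 1 - s and the translations s -> s
    + jc. *)
Lemma ae_affine P (c d : C R) : d != 0 -> ae P -> ae (fun s => P (c + d * s)).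
Proof.
move=> d0 h s; have /dnear_nrmP[r r0 rP] := h (c + d * s).
have nd0 : 0 < nrm d by rewrite lt_neqAle nrm_ge0 andbT eq_sym nrm_eq0.
apply/dnear_nrmP; exists (r / nrm d); first exact: divr_gt0.
move=> t ts tr; apply: rP; first by rewrite (inj_eq (addrI _)) (inj_eq (mulfI d0)).
by rewrite opprD addrACA subrr add0r -mulrBr nrmM mulrC -ltr_pdivlMr.
Qed.

Lemma ae_all_ord n (P : 'I_n -> C R -> Prop) :
  (forall i, ae (P i)) -> ae (fun s => forall i, P i s).
Proof. by move=> h s; apply: filter_forall => i; exact: h. Qed.

End Neighborhoods.

(** * Local power series and the isolation of their zeros *)

Section Analytic.
Variable R : realType.
Implicit Types (s t : C R) (f g h : C R -> C R).

(** The bound on |a_k| r^k is recorded next to the convergence because it makes the terms geometric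
    inside the disc, as products and tails require. *)
Definition expands f s (a : nat -> C R) (r M : R) :=
  [/\ 0 < r, 0 <= M, forall k, nrm (a k) * r ^+ k <= M &
   forall t, nrm (t - s) < r ->
     (fun n => \sum_(k < n) a k * (t - s) ^+ k) @ \oo --> f t].

Lemma series_terms_bounded (K : numFieldType) (u : nat -> K) :
  cvgn (series u) -> exists2 M : K, 0 <= M & forall k, `|u k| <= M.
Proof.
move=> /cvg_series_cvg_0 /cvgP /cvg_seq_bounded [M [Mr hM]].
exists (`|M| + 1); first by rewrite addr_ge0.
move=> k; apply: hM => //; rewrite ltr_pwDr // real_ler_norm //.
Qed.

Lemma analytic_expands f s : analytic_at f s -> exists a r M, expands f s a r M.
Proof.
case=> a /near_nrmP[r r0 hr].
(* The series converges at s + r/2, so its terms there are bounded: this is the wanted bound, with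
   radius r/2. *)
pose w := rc (r / 2) : C R.
have r20 : 0 < r / 2 by rewrite divr_gt0.
have nw : nrm w = r / 2 by rewrite nrm_rc ger0_norm // ltW.
have r2r : r / 2 < r by rewrite ltr_pdivrMr // ltr_pMr // ltr1n.
have : cvgn (series (fun k => a k * w ^+ k)).
  have hw : nrm (s + w - s) < r by rewrite addrC addKr nw.
  by have := hr _ hw; rewrite [s + w]addrC addrK => /cvgP.
move/series_terms_bounded => [M M0 hM].
exists a, (r / 2), (complex.Re M); split => //.
- by move: M0; case: (M) => x y; rewrite lecE /= => /andP[].
- move=> k; rewrite -nw -nrmX -nrmM.
  have := hM k; rewrite nrmE; case: (M) => x y; rewrite lecE /=.
  by move=> /andP[].
- move=> t tr; have := hr _ (lt_trans tr r2r).
  rewrite (_ : series _ = (fun n => \sum_(k < n) a k * (t - s) ^+ k)) //.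
  by apply/funext => n; rewrite /series /= big_mkord.
Qed.

Lemma expands_analytic f s (a : nat -> C R) (r : R) : 0 < r ->
  (forall t, nrm (t - s) < r ->
     (fun n => \sum_(k < n) a k * (t - s) ^+ k) @ \oo --> f t) -> analytic_at f s.
Proof.
move=> r0 h; exists a; apply/near_nrmP; exists r => // t /h.
rewrite (_ : series _ = (fun n => \sum_(k < n) a k * (t - s) ^+ k)) //.
by apply/funext => n; rewrite /series /= big_mkord.
Qed.

Lemma expands_shrink f s a r M r' : 0 < r' -> r' <= r ->
  expands f s a r M -> expands f s a r' M.
Proof.
move=> r'0 r'r [r0 M0 b c]; split => // [k|t tr]; last exact/c/(lt_le_trans tr).
apply: le_trans (b k); rewrite ler_wpM2l ?nrm_ge0 // lerXn2r // nnegrE ltW //.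
Qed.

Lemma sum_half (n : nat) : \sum_(i < n) (2^-1 : R) ^+ i <= 2.
Proof.
suff -> : \sum_(i < n) (2^-1 : R) ^+ i = 2 - 2 * 2^-1 ^+ n.
  by rewrite lerBlDr lerDl mulr_ge0 // exprn_ge0 // invr_ge0.
elim: n => [|n IH]; first by rewrite big_ord0 expr0 mulr1 subrr.
by rewrite big_ord_recr /= IH exprS; field.
Qed.

Lemma expands_term f s a r M k t : expands f s a r M ->
  nrm (a k * (t - s) ^+ k) <= M * (nrm (t - s) / r) ^+ k.
Proof.
move=> [r0 M0 b _]; rewrite nrmM nrmX expr_div_n [M * _]mulrCA [nrm (a k) * _]mulrC.
rewrite ler_wpM2l ?exprn_ge0 ?nrm_ge0 // ler_pdivlMr ?exprn_gt0 //.
Qed.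

Lemma analytic_mul f g s : analytic_at f s -> analytic_at g s ->
  analytic_at (fun t => f t * g t) s.
Proof.
move=> /analytic_expands[a [r1 [M1 h1]]] /analytic_expands[b [r2 [M2 h2]]].
pose r := Num.min r1 r2.
have r10 : 0 < r1 by case: h1.
have r20 : 0 < r2 by case: h2.
have r0 : 0 < r by rewrite lt_min r10 r20.
have {}h1 : expands f s a r M1 by apply: expands_shrink h1; rewrite ?ge_min ?lexx.
have {}h2 : expands g s b r M2 by apply: expands_shrink h2; rewrite ?ge_min ?lexx ?orbT.
(* Radius r/4 makes the ratio |w| / r at most 1/2 * 1/2. On the corner n <= i + j one factor 1/2
   gives the decay 2^-n, the other leaves two geometric sums, each at most 2. *)
apply: (@expands_analytic _ s (fun m => \sum_(i < m.+1) a i * b (m - i)%N) (r / 4)).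
  by rewrite divr_gt0.
move=> t tr.
have M10 : 0 <= M1 by case: h1.
have M20 : 0 <= M2 by case: h2.
set w := t - s in tr *.
have tr' : nrm w < r.
  by apply: (lt_le_trans tr); move: r0; lra.
have [_ _ _ /(_ _ tr') c1] := h1.
have [_ _ _ /(_ _ tr') c2] := h2.
pose u k := a k * w ^+ k; pose v k := b k * w ^+ k.
have geo : (fun n : nat => M1 * M2 * 4 * 2^-1 ^+ n) @ \oo --> (0 : R).
  by apply: cvg_geometric; rewrite ger0_norm ?invr_ge0 // invf_lt1 // ltr1n.
have D : (fun n => \sum_(i < n) \sum_(j < n | (n <= i + j)%N) u i * v j) @ \oo --> (0 : C R).
  apply: cvg_nrm0 geo => n; rewrite -rc_le -nrmE.
  apply: (le_trans (ler_norm_sum _ _ _)).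
  pose q : R := 2^-1.
  have q0 : 0 <= q by rewrite invr_ge0.
  apply: (@le_trans _ _ (rc (\sum_(i < n) \sum_(j < n) M1 * M2 * q ^+ n * (q ^+ i * q ^+ j)))).
    rewrite rc_sum; apply: ler_sum => i _.
    apply: (le_trans (ler_norm_sum _ _ _)).
    rewrite rc_sum [X in X <= _]big_mkcond; apply: ler_sum => j _.
    case: ifPn => nij; last by rewrite -(rc0 R) rc_le !(mulr_ge0, exprn_ge0).
    rewrite nrmE rc_le nrmM.
    apply: (@le_trans _ _ ((M1 * (nrm w / r) ^+ i) * (M2 * (nrm w / r) ^+ j))).
      by apply: ler_pM; rewrite ?nrm_ge0 //; [exact: (expands_term _ _ h1)|exact: (expands_term _ _ h2)].
    rewrite mulrACA -!mulrA; do 2 (apply: ler_wpM2l => //).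
    rewrite -!exprD.
    apply: (@le_trans _ _ ((q * q) ^+ (i + j))).
      rewrite lerXn2r ?nnegrE ?divr_ge0 ?nrm_ge0 ?mulr_ge0 // ?(ltW r0) //.
      rewrite ler_pdivrMr // (le_trans (ltW tr)) // mulrC /q.
      by rewrite ler_wpM2r ?(ltW r0)//; lra.
    by rewrite exprMn -exprD ler_wiXn2l ?leq_add2r //; rewrite /q; lra.
  rewrite rc_le.
  have -> : \sum_(i < n) \sum_(j < n) M1 * M2 * q ^+ n * (q ^+ i * q ^+ j) =
     M1 * M2 * q ^+ n * ((\sum_(i < n) q ^+ i) * (\sum_(j < n) q ^+ j)).
    rewrite mulr_suml mulr_sumr; apply: eq_bigr => i _.
    by rewrite mulr_sumr mulr_sumr.
  rewrite -!mulrA; do 2 (apply: ler_wpM2l => //).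
  rewrite mulrC; apply: ler_wpM2r; first exact: exprn_ge0.
  have -> : 4 = 2 * 2 :> R by lra.
  by apply: ler_pM; rewrite ?sum_half // sumr_ge0 // => i _; exact: exprn_ge0.
apply: (cvg_prod_defect c1 c2 D) => n; rewrite -cauchy_defect opprB addrCA subrr addr0.
apply: eq_bigr => m _; rewrite mulr_suml; apply: eq_bigr => i _.
rewrite /u /v mulrACA -exprD subnKC // -ltnS //.
Qed.

Lemma analytic_cst (c : C R) s : analytic_at (fun=> c) s.
Proof.
apply: (@expands_analytic _ s (fun k => if k == 0%N then c else 0) 1) => // t _.
apply: cvg_near_cst; exists 1%N => // -[//|n _].
rewrite big_ord_recl expr0 mulr1 /= big1 ?addr0 // => i _.
by rewrite mul0r.
Qed.

Lemma analytic_add f g s : analytic_at f s -> analytic_at g s ->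
  analytic_at (fun t => f t + g t) s.
Proof.
move=> /analytic_expands[a [r1 [M1 h1]]] /analytic_expands[b [r2 [M2 h2]]].
case: h1 h2 => r10 _ _ h1 [r20 _ _ h2].
apply: (@expands_analytic _ s (fun k => a k + b k) (Num.min r1 r2)).
  by rewrite lt_min r10 r20.
move=> t; rewrite lt_min => /andP[/h1 {}h1 /h2 {}h2].
rewrite -[g t]mul1r; apply: cvg_ext (@cvg_lin_comb _ _ _ _ _ 1 h1 h2) => n.
by rewrite mul1r -big_split; apply: eq_bigr => k _; rewrite mulrDl.
Qed.

Lemma analytic_affine f s (c d : C R) : d != 0 -> analytic_at f (c + d * s) ->
  analytic_at (fun t => f (c + d * t)) s.
Proof.
move=> d0 /analytic_expands[a [r [M [r0 _ _ h]]]].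
have nd0 : 0 < nrm d by rewrite lt_neqAle nrm_ge0 andbT eq_sym nrm_eq0.
apply: (@expands_analytic _ s (fun k => a k * d ^+ k) (r / nrm d)).
  exact: divr_gt0.
have e t : c + d * t - (c + d * s) = d * (t - s).
  by rewrite opprD addrACA subrr add0r mulrBr.
move=> t tr; have /h : nrm (c + d * t - (c + d * s)) < r.
  by rewrite e nrmM mulrC -ltr_pdivlMr.
rewrite e => hh; apply: cvg_ext hh => n.
by apply: eq_bigr => k _; rewrite exprMn mulrA.
Qed.

Lemma analytic_exp (l m s : C R) : analytic_at (fun t => cexp (l * t + m)) s.
Proof.
pose a k : C R := cexp (l * s + m) * exp_term l k.
apply: (@expands_analytic (fun t => cexp (l * t + m)) s a 1).
  exact: ltr01.
move=> t _.
have -> : l * t + m = (l * s + m) + l * (t - s) by rewrite mulrBr; ring.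
rewrite cexpD.
apply: cvg_ext (@cvg_scale _ _ _ (cexp (l * s + m)) (@cvg_exp _ (l * (t - s)))) => n.
rewrite mulr_sumr.
by apply: eq_bigr => k _; rewrite exp_termX mulrA.
Qed.

(** Near s the first nonzero term of the expansion outweighs the sum of all later ones. *)
Lemma analytic_zero f s : analytic_at f s ->
  (\forall t \near s, f t = 0) \/ (\forall t \near s^', f t != 0).
Proof.
move=> /analytic_expands[a [r [M h]]].
have r0 : 0 < r by case: h.
have M0 : 0 <= M by case: h.
have [az|/existsNP[N0 aN0]] := pselect (forall k, a k = 0).
  left; apply/near_nrmP; exists r => // t tr.
  case: h => _ _ _ /(_ _ tr) /seq_cvg_unique; apply.
  by apply: cvg_near_cst; near=> n; rewrite big1 // => i _; rewrite az mul0r.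
right.
have exN : exists N, a N != 0 by exists N0; apply/eqP.
case: (ex_minnP exN) => N aN minN.
have naN : 0 < nrm (a N) by rewrite lt_neqAle nrm_ge0 andbT eq_sym nrm_eq0.
(* [M'] bounds the later terms once |w|^N is taken out; the summand 1 keeps it positive when M = 0.
   With x = |w| / r at most 1/2 the terms beyond N add up to at most |w|^N * 2 * M' * x, and the
   second bound in [e] makes this at most half of |a_N w^N|. *)
pose M' := M / r ^+ N + 1.
have M'0 : 0 < M' by rewrite ltr_wpDl // divr_ge0 // exprn_ge0 // ltW.
pose e := Num.min (2^-1) (nrm (a N) / (4 * M')).
have e0 : 0 < e by rewrite lt_min invr_gt0 ltr0n /= divr_gt0 // mulr_gt0.
apply/dnear_nrmP; exists (r * e); first exact: mulr_gt0.
move=> t ts tr; apply/negP => /eqP ft.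
have e2 : e <= 2^-1 by rewrite ge_min lexx.
have tr' : nrm (t - s) < r.
  by apply: (lt_le_trans tr); rewrite ger_pMr //; lra.
have [_ _ _ /(_ _ tr')] := h; rewrite ft => lim0.
set w := t - s in tr tr' lim0.
have w0 : 0 < nrm w by rewrite lt_neqAle nrm_ge0 andbT eq_sym nrm_eq0 subr_eq0.
pose x := nrm w / r.
have x0 : 0 <= x by rewrite divr_ge0 // ?nrm_ge0 // ltW.
have xe : x < e by rewrite ltr_pdivrMr // mulrC.
have xE : x = nrm w / r by [].
clearbody x.
(* A positive lower bound common to all long partial sums contradicts their convergence to f(t) =
   0. *)
have lower m : nrm w ^+ N * (nrm (a N) / 2) <=
    nrm (\sum_(k < N.+1 + m) a k * w ^+ k).
  rewrite big_split_ord /= big_ord_recr /= big1 ?add0r; last first.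
    move=> i _; have [->|/minN] := eqVneq (a i) 0; first by rewrite mul0r.
    by rewrite leqNgt ltn_ord.
  set T := \sum_(i < m) _.
  have hT : nrm T <= nrm w ^+ N * (nrm (a N) / 2).
    rewrite -rc_le -nrmE; apply: (le_trans (ler_norm_sum _ _ _)).
    apply: (@le_trans _ _ (rc (\sum_(i < m) nrm w ^+ N * M' * x * 2^-1 ^+ i))).
      rewrite rc_sum; apply: ler_sum => i _; rewrite nrmE rc_le.
      apply: (le_trans (expands_term _ _ h)); rewrite -/w -xE.
      rewrite exprD exprS mulrA [x * x ^+ N]mulrC mulrA -!mulrA.
      rewrite [M * _]mulrA {1}xE expr_div_n.
      rewrite [M * (_ / _)]mulrCA -mulrA.
      apply: ler_wpM2l; first by rewrite exprn_ge0 // nrm_ge0.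
      apply: ler_pM; rewrite ?divr_ge0 ?mulr_ge0 ?exprn_ge0 // ?(ltW r0) //.
        by rewrite /M' lerDl.
      apply: ler_wpM2l => //; rewrite lerXn2r // ?nnegrE ?invr_ge0 //.
      exact: ltW (lt_le_trans xe e2).
    rewrite rc_le -mulr_sumr -!mulrA ler_wpM2l ?exprn_ge0 ?nrm_ge0 //.
    apply: (@le_trans _ _ (M' * (x * 2))).
      by rewrite !ler_wpM2l ?sum_half // ltW.
    have : x <= nrm (a N) / (4 * M').
      by apply: (le_trans (ltW xe)); rewrite ge_min lexx orbT.
    rewrite ler_pdivlMr ?mulr_gt0 // => hx; rewrite ler_pdivlMr //; lra.
  have := nrmD (a N * w ^+ N + T) (- T).
  rewrite addrK nrmM nrmX.
  have -> : nrm (- T) = nrm T by rewrite /nrm normrN.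
  rewrite mulrC; set A := nrm w ^+ N in hT *; lra.
set c := nrm w ^+ N * (nrm (a N) / 2) in lower.
have c0 : 0 < c by rewrite mulr_gt0 ?exprn_gt0 // divr_gt0.
have rc0' : 0 < rc c by rewrite -rc0 rc_lt.
move/cvgrPdist_lt : lim0 => /(_ _ rc0') [n0 _ hn].
have /= := hn (N.+1 + n0)%N (leq_addl _ _).
by rewrite sub0r normrN nrmE rc_lt ltNge lower.
Unshelve. all: by end_near. Qed.

End Analytic.

(** * Meromorphic functions and the identity theorem *)

Section Meromorphic.
Variable R : realType.
Implicit Types (s t : C R) (f g h : C R -> C R).

Lemma mero_ae f g : ae (fun s => f s = g s) -> meromorphic g -> meromorphic f.
Proof.
move=> fg mg s; have [u [v [au av uv]]] := mg s.
exists u, v; split=> //; apply: filterS2 (fg s) uv => t ft [vt gt]; split=> //.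
by rewrite ft.
Qed.

Lemma mero_analytic f : (forall s, analytic_at f s) -> meromorphic f.
Proof.
move=> af s; exists f, (fun=> 1); split => //; first exact: analytic_cst.
by apply: nearW => t; rewrite oner_eq0 divr1.
Qed.

Lemma mero_cst (c : C R) : meromorphic (fun=> c).
Proof. by apply: mero_analytic => s; exact: analytic_cst. Qed.

Lemma mero_exp (l m : C R) : meromorphic (fun t => cexp (l * t + m)).
Proof. by apply: mero_analytic => s; exact: analytic_exp. Qed.

Lemma mero_add f g : meromorphic f -> meromorphic g ->
  meromorphic (fun s => f s + g s).
Proof.
move=> mf mg s.
have [a [b [aa ab hab]]] := mf s; have [c [d [ac ad hcd]]] := mg s.
exists (fun t => a t * d t + c t * b t), (fun t => b t * d t); split.
- by apply: analytic_add; exact: analytic_mul.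
- exact: analytic_mul.
- apply: filterS2 hab hcd => t [b0 ->] [d0 ->]; split; first by rewrite mulf_neq0.
  by rewrite addf_div.
Qed.

Lemma mero_mul f g : meromorphic f -> meromorphic g ->
  meromorphic (fun s => f s * g s).
Proof.
move=> mf mg s.
have [a [b [aa ab hab]]] := mf s; have [c [d [ac ad hcd]]] := mg s.
exists (fun t => a t * c t), (fun t => b t * d t); split.
- exact: analytic_mul.
- exact: analytic_mul.
- apply: filterS2 hab hcd => t [b0 ->] [d0 ->]; split; first by rewrite mulf_neq0.
  by rewrite mulf_div.
Qed.

Lemma mero_zero f s : meromorphic f ->
  (\forall t \near s^', f t = 0) \/ (\forall t \near s^', f t != 0).
Proof.
move=> mf; have [a [b [/analytic_zero aa _ hab]]] := mf s.
case: aa => [a0|a0]; [left|right].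
- have {}a0 : \forall t \near s^', a t = 0 by apply: cvg_within a0.
  by apply: filterS2 a0 hab => t -> [_ ->]; rewrite mul0r.
- by apply: filterS2 a0 hab => t at0 [b0 ->]; rewrite mulf_neq0 ?invr_eq0.
Qed.

Lemma mero_inv f : meromorphic f -> meromorphic (fun s => (f s)^-1).
Proof.
move=> mf s; have [f0|f0] := mero_zero s mf.
  (* Where f is 0 on a punctured neighbourhood, the convention 0^-1 = 0 makes its inverse 0 there
     too. *)
  exists (fun=> 0), (fun=> 1); split; [exact: analytic_cst|exact: analytic_cst|].
  by apply: filterS f0 => t ->; rewrite oner_eq0 invr0 mul0r.
have [a [b [aa ab hab]]] := mf s.
exists b, a; split => //; apply: filterS2 f0 hab => t ft0 [b0 fab].
rewrite fab invf_div; split => //; apply: contraNneq ft0.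
by rewrite fab => ->; rewrite mul0r.
Qed.

Lemma mero_opp f : meromorphic f -> meromorphic (fun s => - f s).
Proof.
move=> mf; have := mero_mul (mero_cst (-1)) mf.
by apply: mero_ae; apply: ae_true => s; rewrite mulN1r.
Qed.

Lemma mero_exprn f n : meromorphic f -> meromorphic (fun s => f s ^+ n).
Proof.
move=> mf; elim: n => [|n IH].
  by apply: mero_ae (mero_cst 1); apply: ae_true => s; rewrite expr0.
by apply: mero_ae (mero_mul mf IH); apply: ae_true => s; rewrite exprS.
Qed.

Lemma mero_sum I (r : seq I) (F : I -> C R -> C R) :
  (forall i, meromorphic (F i)) -> meromorphic (fun s => \sum_(i <- r) F i s).
Proof.
move=> mF; elim: r => [|i r IH].
  by apply: mero_ae (mero_cst 0); apply: ae_true => s; rewrite big_nil.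
by apply: mero_ae (mero_add (mF i) IH); apply: ae_true => s; rewrite big_cons.
Qed.

Lemma mero_affine f (c d : C R) : d != 0 -> meromorphic f ->
  meromorphic (fun s => f (c + d * s)).
Proof.
move=> d0 mf s; have [a [b [aa ab hab]]] := mf (c + d * s).
exists (fun t => a (c + d * t)), (fun t => b (c + d * t)).
split; [exact: analytic_affine|exact: analytic_affine|].
have /dnear_nrmP[r r0 rP] := hab.
have nd0 : 0 < nrm d by rewrite lt_neqAle nrm_ge0 andbT eq_sym nrm_eq0.
apply/dnear_nrmP; exists (r / nrm d); first exact: divr_gt0.
move=> t ts tr; apply: rP; first by rewrite (inj_eq (addrI _)) (inj_eq (mulfI d0)).
by rewrite opprD addrACA subrr add0r -mulrBr nrmM mulrC -ltr_pdivlMr.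
Qed.

Lemma connected_line (P : R -> Prop) :
  (forall x, P x -> \forall y \near x, P y) ->
  (forall x, ~ P x -> \forall y \near x, ~ P y) ->
  forall x y, x <= y -> P x -> P y.
Proof.
move=> oP oNP x y xy Px.
have oA : open [set z | P z] by rewrite openE => z; exact: oP.
have oN : open [set z | ~ P z] by rewrite openE => z; exact: oNP.
have e : [set` `[x, y]] `&` [set z | P z] = [set` `[x, y]].
  apply: (@segment_connected R x y).
  - by exists x; split => //=; rewrite in_itv /= lexx.
  - by exists [set z | P z].
  - exists [set z | P z] => //.
    by rewrite -[X in closed X]setCK; exact: open_closedC.
have yy : [set` `[x, y]] y by rewrite /= in_itv /= lexx andbT.
by have := yy; rewrite -{1}e => -[].
Qed.

(* The set of points near which f vanishes is clopen along horizontal lines,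
   by the isolation of zeros. *)
Lemma mero_vanish f (sigma : R) : meromorphic f ->
  (forall s, sigma < complex.Re s -> f s = 0) -> ae (fun s => f s = 0).
Proof.
move=> mf f0 s0.
pose P (x : R) := \forall t \near (s0 + rc x)^', f t = 0.
have sh (x y : R) : s0 + rc y - (s0 + rc x) = rc (y - x).
  by rewrite opprD addrACA subrr add0r rcB.
have transfer (U : C R -> Prop) (x : R) : (\forall t \near (s0 + rc x)^', U t) ->
    \forall y \near x, \forall t \near (s0 + rc y)^', U t.
  move=> /dnear_nrmP[r r0 rP].
  apply/nbhs_ballP; exists r => // y; rewrite -ball_normE /= distrC => xy.
  have [->|xny] := eqVneq y x; first by apply/dnear_nrmP; exists r.
  (* The new disc must stay inside the old one and avoid the old centre, where nothing is known. *)
  apply/dnear_nrmP; exists (Num.min (r - `|y - x|) `|y - x|).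
    by rewrite lt_min subr_gt0 xy normr_gt0 subr_eq0.
  move=> t ty; rewrite lt_min => /andP[t1 t2]; apply: rP.
    apply: contraTneq t2 => ->; rewrite -leNgt.
    by rewrite sh nrm_rc distrC.
  rewrite -(subrK (s0 + rc y) t) -addrA; apply: (le_lt_trans (nrmD _ _)).
  by rewrite sh nrm_rc -ltrBrDr.
have oP x : P x -> \forall y \near x, P y by exact: transfer.
have oNP x : ~ P x -> \forall y \near x, ~ P y.
  case: (mero_zero (s0 + rc x) mf) => // /transfer h _.
  apply: filterS h => y h1 h2.
  have [t [ ]] := @filter_ex _ _ (Proper_dnbhs_numFieldType (s0 + rc y)) _ (filterI h1 h2).
  by move=> /eqP.
(* With this T the unit disc around s0 + T lies in the half-plane where f is 0. *)
pose T := `|sigma - complex.Re s0| + 1.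
have T0 : 0 <= T by rewrite addr_ge0.
have PT : P T.
  apply: cvg_within; apply/near_nrmP; exists 1 => // t tT.
  apply: f0; have := nrm_Re (t - (s0 + rc T)).
  have -> : complex.Re (t - (s0 + rc T)) = complex.Re t - complex.Re s0 - T.
    by rewrite cReD cReN cReD /= opprD addrA.
  rewrite ler_norml => /andP[h _].
  have := ler_norm (sigma - complex.Re s0); rewrite -/T.
  have : T = `|sigma - complex.Re s0| + 1 by [].
  by move: T {T0} h tT => T; lra.
(* [connected_line] propagates to the right only, whereas the known point T lies to the right of 0;
   it is applied to the negation of P, which would pass from 0 to T. *)
have oNNP x : ~ ~ P x -> \forall y \near x, ~ ~ P y.
  by move=> /contrapT /oP; apply: filterS => y Py; exact.
have nP := connected_line oNP oNNP.
have P0 : P 0 by apply: contrapT => nP0; exact: nP T0 nP0 PT.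
by move: P0; rewrite /P rc0 addr0.
Qed.

Lemma mero_identity f g (sigma : R) : meromorphic f -> meromorphic g ->
  (forall s, sigma < complex.Re s -> f s = g s) -> ae (fun s => f s = g s).
Proof.
move=> mf mg fg.
have h s : sigma < complex.Re s -> f s - g s = 0 by move=> /fg ->; rewrite subrr.
apply: aeS (mero_vanish (mero_add mf (mero_opp mg)) h) => s /eqP.
by rewrite subr_eq0 => /eqP.
Qed.

End Meromorphic.

(** * Topology of p-adic fields *)

Section Valuation.
Variable F : padicFieldType.
Implicit Types (x y z : F) (m n : int).

Lemma vl1 : vl (1 : F) = 0.
Proof.
have := @vlM F 1 1 (oner_neq0 _) (oner_neq0 _); rewrite mulr1 => /eqP.
by rewrite -subr_eq subrr => /eqP.
Qed.

Lemma vlN x : vl (- x) = vl x.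
Proof.
have [->|x0] := eqVneq x 0; first by rewrite oppr0.
have n1 : -1 != 0 :> F by rewrite oppr_eq0 oner_neq0.
rewrite -mulN1r vlM //.
have := @vlM F (-1) (-1) n1 n1; rewrite mulrNN mulr1 vl1 => h; lia.
Qed.

Lemma vlV x : x != 0 -> vl x^-1 = - vl x.
Proof.
by move=> x0; have := vlM _ _ x0 (invr_neq0 x0); rewrite divff // vl1; lia.
Qed.

Lemma vlX x n : x != 0 -> vl (x ^ n) = n * vl x.
Proof.
move=> x0; have nat_case k : vl (x ^+ k) = k%:Z * vl x.
  elim: k => [|k IH]; first by rewrite expr0 vl1 mul0r.
  by rewrite exprS vlM ?expf_neq0 // IH; lia.
case: n => k; first exact: nat_case.
by rewrite NegzE -exprnN vlV ?expf_neq0 // nat_case; lia.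
Qed.

Lemma ideal0 m : idealP m (0 : F).
Proof. by rewrite /idealP /frac_ideal /= eqxx. Qed.

Lemma idealE m x : x != 0 -> idealP m x <-> m <= vl x.
Proof. by move=> x0; split=> [|h _] //; apply. Qed.

Lemma idealN m x : idealP m x -> idealP m (- x).
Proof. by move=> h; rewrite /idealP /frac_ideal /= oppr_eq0 vlN. Qed.

Lemma idealD m x y : idealP m x -> idealP m y -> idealP m (x + y).
Proof.
move=> hx hy xy0.
have [x0|x0] := eqVneq x 0; first by move: xy0; rewrite x0 add0r => /hy.
have [y0|y0] := eqVneq y 0; first by move: xy0; rewrite y0 addr0 => /hx.
by apply: le_trans (vlD _ _ x0 y0 xy0); rewrite le_min hx ?hy.
Qed.

Lemma idealB m x y : idealP m x -> idealP m y -> idealP m (x - y).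
Proof. by move=> hx /idealN; exact: idealD. Qed.

Lemma ideal_distr m x y : idealP m (x - y) -> idealP m (y - x).
Proof. by move=> /idealN; rewrite opprB. Qed.

Lemma ideal_trans m y x z : idealP m (x - y) -> idealP m (y - z) -> idealP m (x - z).
Proof. by move=> h k; have := idealD h k; rewrite addrA subrK. Qed.

Lemma ideal_le m n x : m <= n -> idealP n x -> idealP m x.
Proof. by move=> mn h /h; exact: le_trans. Qed.

Lemma idealM m n x y : idealP m x -> idealP n y -> idealP (m + n) (x * y).
Proof.
move=> hx hy; rewrite /idealP /frac_ideal /= mulf_eq0 negb_or => /andP[x0 y0].
by rewrite vlM // lerD ?hx ?hy.
Qed.

Lemma idealMz m n x y : x != 0 -> vl x = n -> idealP (m + n) (x * y) <-> idealP m y.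
Proof.
move=> x0 vx; split.
  have hV : idealP (- n) x^-1 by apply/idealE; rewrite ?invr_eq0 // vlV // vx.
  by move=> /(idealM hV); rewrite mulKf // addrCA addNr addr0.
by rewrite [m + n]addrC; apply: idealM; apply/idealE; rewrite // vx.
Qed.

Lemma ideal_natM m x n : idealP m x -> idealP m (n%:~R * x).
Proof.
have nat_case (k : nat) : idealP m x -> idealP m (k%:R * x).
  move=> h; elim: k => [|k IH]; first by rewrite mul0r; exact: ideal0.
  by rewrite -natr1 mulrDl mul1r; exact: idealD.
move=> h; case: n => k; first exact: nat_case.
by rewrite NegzE mulrNz mulNr; apply: idealN; exact: nat_case.
Qed.

Lemma ideal_shift m x h : idealP m h -> idealP m x <-> idealP m (x + h).
Proof.
by move=> hh; split=> [?|/idealB/(_ hh)]; [exact: idealD|rewrite addrK].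
Qed.

Definition shell (j : int) : set F := [set x | x != 0 /\ vl x = j].

Lemma shell_ideal j x : shell j x <-> idealP j x /\ ~ idealP (j + 1) x.
Proof.
split=> [[x0 vx]|[h1 h2]].
  by split; [apply/idealE; rewrite ?vx|move/idealE => /(_ x0); rewrite vx; lia].
have x0 : x != 0 by apply/eqP => x0; apply: h2; rewrite x0; exact: ideal0.
split=> //; apply/eqP; rewrite eq_le.
by move/idealE: h1 => /(_ x0) ->; rewrite andbT leNgt; apply/negP => h; apply: h2;
  apply/idealE => //; lia.
Qed.

Lemma shell_shift j x h : shell j x -> idealP (j + 1) h -> shell j (x + h).
Proof.
move=> /shell_ideal[h1 h2] hh; apply/shell_ideal; split.
  by apply: idealD => //; apply: ideal_le hh; lia.
by move=> h3; apply: h2; apply/(ideal_shift _ hh).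
Qed.

Lemma unit_near1 m x : 1 <= m -> idealP m (x - 1) -> shell 0 x.
Proof.
move=> m1 h; have -> : x = 1 + (x - 1) by rewrite addrC subrK.
apply: shell_shift; first by split; rewrite ?oner_neq0 // vl1.
by apply: ideal_le h.
Qed.

Lemma near_ideal x (A : F -> Prop) :
  (\forall y \near x, A y) <-> exists m : int, forall y, idealP m (y - x) -> A y.
Proof. exact: nbhs_vl. Qed.

Lemma open_of_near (U : set F) : (forall x, U x -> \forall y \near x, U y) -> open U.
Proof. by rewrite openE. Qed.

Lemma near_coset x m : \forall y \near x, idealP m (y - x).
Proof. by apply/near_ideal; exists m. Qed.

Definition coset x m : set F := [set y | idealP m (y - x)].

Lemma open_ideal m : open [set x : F | idealP m x].
Proof.
rewrite openE => x /= hx; apply/near_ideal; exists m => y h /=.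
by have := idealD h hx; rewrite subrK.
Qed.

Lemma open_coset x m : open (coset x m).
Proof.
rewrite openE => y /= hy; apply/near_ideal; exists m => z h /=.
exact: ideal_trans h hy.
Qed.

Lemma closed_ideal m : closed [set x : F | idealP m x].
Proof.
rewrite -openC openE => x /= hx; apply/near_ideal; exists m => y h /= hy.
by apply: hx; have := idealB hy h; rewrite opprB addrC subrK.
Qed.

Lemma near_nonzero x : x != 0 -> \forall y \near x, y != 0 /\ vl y = vl x.
Proof.
move=> x0; apply/near_ideal; exists (vl x + 1) => y h.
have [] := @shell_shift (vl x) x (y - x) _ h; first by [].
by rewrite addrC subrK.
Qed.

Lemma open_nonzero : open [set x : F | x != 0].
Proof.
by rewrite openE => x /near_nonzero; apply: filterS => y [].
Qed.

Lemma open_shell j : open (shell j).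
Proof.
by rewrite openE => x [x0 vx]; apply: filterS (near_nonzero x0) => y []; rewrite vx.
Qed.

(** A transversal turns the cardinality q of a set of cosets into a list of q representatives, along
    which cosets are subdivided and their measures summed. *)
Lemma residue_reps : exists rs : seq F, [/\ size rs = residue_card F,
  uniq rs, forall r, r \in rs -> idealP 0 r,
  forall x, idealP 0 x -> exists2 r, r \in rs & idealP 1 (x - r) &
  forall r r', r \in rs -> r' \in rs -> idealP 1 (r - r') -> r = r'].
Proof.
have fR := @residue_finite F.
pose rep (A : set F) : F := xget 0 A.
have repP A : residue_classes (@vl F) A -> A (rep A).
  by case=> x _ <-; apply: xgetPex; exists x; rewrite /= subrr; exact: ideal0.
have cls A r : residue_classes (@vl F) A -> A r ->
    A = [set y | frac_ideal (@vl F) 1 (y - r)].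
  case=> x _ <- /= rx; apply/seteqP; split=> y /= h.
    exact: ideal_trans h (ideal_distr rx).
  exact: ideal_trans h rx.
have inj A B : residue_classes (@vl F) A -> residue_classes (@vl F) B ->
    idealP 1 (rep A - rep B) -> A = B.
  move=> hA hB h; rewrite (cls A _ hA (repP _ hA)) (cls B _ hB (repP _ hB)).
  apply/seteqP; split=> y /= k; first exact: ideal_trans k h.
  exact: ideal_trans k (ideal_distr h).
have mem A : A \in fset_set (residue_classes (@vl F)) -> residue_classes (@vl F) A.
  by rewrite in_fset_set // inE.
exists [seq rep A | A <- fset_set (residue_classes (@vl F))]; split.
- by rewrite size_map.
- rewrite map_inj_in_uniq ?fset_uniq // => A B /mem hA /mem hB e.
  by apply: inj => //; rewrite e subrr; exact: ideal0.
- move=> r /mapP[A /mem hA ->]; have := repP _ hA; case: (hA) => x x0 <- /= h.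
  by have := idealD (@ideal_le 0 1 _ isT h) x0; rewrite subrK.
- move=> x x0; pose A := [set y | frac_ideal (@vl F) 1 (y - x)].
  have hA : residue_classes (@vl F) A by exists x.
  exists (rep A); first by apply: map_f; rewrite in_fset_set // inE.
  by apply: ideal_distr; exact: repP _ hA.
- move=> r r' /mapP[A /mem hA ->] /mapP[B /mem hB ->] h.
  by rewrite (inj A B).
Qed.

Variables (varpi : F) (hvarpi : uniformizer varpi).

Lemma varpi_neq0 : varpi != 0. Proof. by case: hvarpi. Qed.

Lemma varpiX_neq0 (j : int) : varpi ^ j != 0.
Proof. by rewrite expfz_neq0 // varpi_neq0. Qed.

Lemma vl_varpiX (j : int) : vl (varpi ^ j) = j.
Proof. by case: hvarpi => h1 h2; rewrite vlX // h2 mulr1. Qed.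

Lemma coset_split (rs : seq F) x m :
  (forall y, idealP 0 y -> exists2 r, r \in rs & idealP 1 (y - r)) ->
  forall y, coset x m y -> exists2 r, r \in rs & coset (x + varpi ^ m * r) (m + 1) y.
Proof.
move=> hrs y; rewrite /coset /= => h.
have [|r rrs hr] := hrs (varpi ^ (- m) * (y - x)).
  by have := @idealMz m (- m) _ (y - x) (varpiX_neq0 (- m)) (vl_varpiX _);
    rewrite subrr => -[_]; exact.
exists r => //.
have := @idealMz 1 m _ (varpi ^ (- m) * (y - x) - r) (varpiX_neq0 m) (vl_varpiX m).
case=> _ /(_ hr); rewrite addrC mulrBr mulrA -expfzDr ?varpi_neq0 // subrr.
by rewrite expr0z mul1r opprD addrA.
Qed.

End Valuation.

Lemma ultra_seq (T : choiceType) (U : set_system T) (I : eqType) (rs : seq I)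
    (A : I -> set T) (B : set T) : UltraFilter U -> U B ->
  (forall x, B x -> exists2 r, r \in rs & A r x) -> exists2 r, r \in rs & U (A r).
Proof.
move=> UU; elim: rs B => [|r rs IH] B UB hB.
  by have [x /hB[]] := filter_ex UB.
have [UA|UA] := in_ultra_setVsetC (A r) UU; first by exists r; rewrite ?mem_head.
have [|s srs Us] := IH _ (filterI UB UA).
  move=> x [/hB[s]]; rewrite inE => /orP[/eqP -> //|srs As _]; by exists s.
by exists s => //; rewrite inE srs orbT.
Qed.

Section Compactness.
Variable F : padicFieldType.
Implicit Types (x y : F).

(** By pigeonhole over the finite residue field, an ultrafilter containing P^m selects a coset of
    P^(m+k) for every k. Two selected cosets always meet, so their centres form a Cauchy sequence,
    and its limit is the limit of the ultrafilter. *)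
Lemma compact_ideal (m : int) : compact [set x : F | idealP m x].
Proof.
have [w w0 vw] := @vl_surj F; have hw : uniformizer w by [].
have [rs [_ _ _ hrs _]] := residue_reps F.
rewrite compact_ultra => U UU Um.
have step (k : nat) : exists x, U (coset x (m + k%:Z)).
  elim: k => [|k [x Ux]].
    by exists 0; apply: filterS Um => y /= h; rewrite /coset /= !subr0.
  have [r _ Ur] := ultra_seq UU Ux (coset_split hw hrs).
  by exists (x + w ^ (m + k%:Z) * r); rewrite -addn1 PoszD addrA.
have [u Uu] := choice step.
have close i j (n : int) : n <= m + i%:Z -> n <= m + j%:Z -> idealP n (u i - u j).
  move=> ni nj; have [y [yi yj]] := filter_ex (filterI (Uu i) (Uu j)).
  exact: ideal_trans (ideal_distr (ideal_le ni yi)) (ideal_le nj yj).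
have [n|l ul] := @vl_complete F u.
  exists `|n - m|%N => i j hi hj; apply: close; lia.
have Ul : U --> l.
  move=> A /near_ideal[n hn].
  have := ul [set y | idealP n (y - l)] (near_coset l n).
  case=> N _ hN; pose i := (N + `|n - m|)%N.
  have hi : idealP n (u i - l) by apply: hN; rewrite /= leq_addr.
  apply: filterS (Uu i) => y hy; apply: hn.
  apply: ideal_trans hi; apply: ideal_le hy; rewrite /i; lia.
exists l; split => //=.
have [y [/= ym yl]] := filter_ex (filterI Um (Ul _ (near_coset l m))).
by have := idealB ym yl; rewrite opprB addrC subrK.
Qed.

Lemma compact_shell (j : int) : compact (@shell F j).
Proof.
apply: (subclosed_compact _ (@compact_ideal j)); last first.
  by move=> x /shell_ideal[].
have -> : @shell F j = [set x | idealP j x] `&` ~` [set x | idealP (j + 1) x].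
  by apply/seteqP; split=> x; rewrite shell_ideal.
by apply: closedI; [exact: closed_ideal|apply: open_closedC; exact: open_ideal].
Qed.

(** Support in P^M and invariance under P^m; the Fourier transform exchanges the two kinds of
    bound. *)
Definition schwartz_bounds (R : realType) (f : F -> C R) (M m : int) : Prop :=
  (forall x, f x != 0 -> idealP M x) /\ (forall x h, idealP m h -> f (x + h) = f x).

Lemma schwartzP (R : realType) (f : F -> C R) :
  schwartz f <-> exists M m, schwartz_bounds f M m.
Proof.
split=> [[lf cf]|[M [m [hM hm]]]]; last first.
  split=> [x|].
    apply/near_ideal; exists m => y h.
    by have := hm x _ h; rewrite addrC subrK.
  apply: (subclosed_compact _ (@compact_ideal M)); first exact: closed_closure.
  have /closure_id -> := @closed_ideal F M.
  exact: closureS.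
have [N hN] : exists N : nat, forall x, f x != 0 -> idealP (- N%:Z) x.
  have := @compact_near_coveringP F (closure [set x | f x != 0]).
  case=> /(_ cf) /(_ nat \oo (fun N x => idealP (- N%:Z) x)) h _.
  have [x _|N _ hN] := h _.
    have [M hM] : exists M : nat, idealP (- M%:Z) x.
      exists `|vl x|%N => _; lia.
    exists ([set y | idealP (- M%:Z) y], [set N | (M <= N)%N]) => /=.
      by split; [exact: open_nbhs_nbhs (conj (@open_ideal F _) hM)|exists M].
    by move=> [y n] [/= hy Mn]; apply: ideal_le hy; lia.
  by exists N => x fx; apply: (hN N) => //=; exact: subset_closure.
have [k hk] : exists k : nat, forall x, idealP (- N%:Z) x ->
    forall h, idealP k%:Z h -> f (x + h) = f x.
  have := @compact_near_coveringP F [set x | idealP (- N%:Z) x].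
  case=> /(_ (@compact_ideal _)) /(_ nat \oo
    (fun k x => forall h, idealP k%:Z h -> f (x + h) = f x)) H _.
  have [x _|k _ hk] := H _.
    have /near_ideal[m hm] := lf x.
    exists ([set y | idealP m (y - x)], [set k | (`|m| <= k)%N]) => /=.
      by split; [exact: near_coset|exists `|m|%N].
    move=> [y n] [/= hy mn] h hh.
    rewrite (hm y) // hm // addrAC; apply: idealD => //.
    by apply: ideal_le hh; lia.
  by exists k => x hx; apply: (hk k) => //=.
(* The uniform k is obtained on the compact set P^-N only. Outside it f is 0, and translations by
   P^k stay outside since P^k lies in P^-N. *)
exists (- N%:Z), k%:Z; split => // x h hh.
have [hx|hx] := pselect (idealP (- N%:Z) x); first exact: hk.
have f0 y : ~ idealP (- N%:Z) y -> f y = 0.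
  by move=> hy; apply: contrapT => /eqP /hN.
rewrite !f0 // => hxh; apply: hx; apply/(@ideal_shift _ _ _ h) => //.
by apply: ideal_le hh; lia.
Qed.

End Compactness.

(** * Characters and conductors *)

Section Characters.
Variables (R : realType) (F : padicFieldType).
Implicit Types (x y u : F) (psi chi : F -> C R).

(* No small subgroups: if y is within 1/2 of 1, squaring multiplies the
   distance |y - 1| by |y + 1| >= 3/2. *)
Lemma small_powers_eq1 (z : C R) :
  (forall k, nrm (z ^+ (2 ^ k) - 1) <= 2^-1) -> z = 1.
Proof.
move=> h; apply/eqP; rewrite -subr_eq0 -nrm_eq0; apply/negPn/negP => z1.
pose d k := nrm (z ^+ (2 ^ k) - 1).
have d0 : 0 < d 0%N by rewrite lt_neqAle nrm_ge0 andbT eq_sym.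
have grow k : (1 + k%:R / 2) * d 0%N <= d k.
  elim: k => [|k IH]; first by rewrite mul0r addr0 mul1r.
  apply: (@le_trans _ _ (d k * (3 / 2))).
    apply: (@le_trans _ _ ((1 + k%:R / 2) * d 0%N * (3 / 2))); last first.
      by rewrite ler_wpM2r.
    rewrite mulrAC ler_wpM2r ?(ltW d0) // -natr1.
    have : 0 <= k%:R :> R by []; lra.
  rewrite /d expnSr exprM -/(d k); set y := z ^+ (2 ^ k).
  have -> : y ^+ 2 - 1 = (y - 1) * (y + 1) by ring.
  rewrite nrmM ler_wpM2l ?nrm_ge0 //.
  have := nrmD (y + 1) (- (y - 1)).
  have -> : y + 1 - (y - 1) = rc 2 by rewrite rcn; ring.
  have -> : nrm (- (y - 1)) = nrm (y - 1) by rewrite /nrm normrN.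
  by rewrite nrm_rc ger0_norm //; have := h k; rewrite -/y; lra.
have [k hk] : exists k : nat, (d 0%N)^-1 < k%:R.
  exists (Num.truncn (d 0%N)^-1).+1; exact: truncnS_gt.
have := le_trans (grow k) (h k).
move: hk; rewrite -(ltr_pM2r d0) mulVf ?gt_eqF //; lra.
Qed.

Lemma near_value (f : F -> C R) x : {for x, continuous f} ->
  exists m : int, forall y, idealP m (y - x) -> nrm (f y - f x) < 2^-1.
Proof.
move=> cf; apply/near_ideal.
have := cf [set z | nrm (z - f x) < 2^-1]; apply.
by apply/near_nrmP; exists 2^-1 => //; rewrite invr_gt0.
Qed.

Lemma add_character0 psi : add_character psi -> psi 0 = 1.
Proof.
move=> [hD h0 _]; have := hD 0 0; rewrite addr0 => e.
by apply: (mulfI (h0 0)); rewrite -e mulr1.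
Qed.

(** By continuity psi is within 1/2 of 1 on some P^m. As P^m is stable under multiplication by 2^k,
    all the powers psi(x)^(2^k) are as close to 1, and [small_powers_eq1] applies. *)
Lemma add_character_trivial psi : add_character psi ->
  exists m : int, trivial_on_ideal psi m.
Proof.
move=> hpsi; have p0 := add_character0 hpsi; case: hpsi => hD h0 hc.
have [m hm] := near_value (hc 0); exists m => x hx.
apply: small_powers_eq1 => k.
have -> : psi x ^+ (2 ^ k) = psi ((2 ^ k)%N%:R * x).
  elim: k => [|k IH]; first by rewrite expn0 expr1 mul1r.
  rewrite expnS mulnC exprM IH expr2 -hD; congr psi; rewrite natrM; ring.
by rewrite -p0; apply/ltW/hm; rewrite subr0; exact: (@ideal_natM _ _ _ (2 ^ k)%N%:Z).
Qed.

(** Replaces continuity by triviality on 1 + P^a, which consists of units as a >= 1. Any such a is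
    allowed, so that ramified and unramified characters are handled together. *)
Definition smooth_character chi (a : nat) : Prop :=
  [/\ forall x y, x != 0 -> y != 0 -> chi (x * y) = chi x * chi y,
      forall x, x != 0 -> chi x != 0, (1 <= a)%N & trivial_on_units chi a].

Lemma mul_character_smooth chi : mul_character chi ->
  exists a, smooth_character chi a.
Proof.
move=> [hM h0 hc]; have o0 := oner_neq0 F.
have c1 : chi 1 = 1.
  by apply: (mulfI (h0 _ o0)); rewrite -hM // !mulr1.
have [m hm] := near_value (hc 1 o0).
exists (`|m|.+1)%N; split => // x hx.
have close y : idealP (`|m|.+1)%N%:Z (y - 1) -> nrm (chi y - 1) <= 2^-1.
  by move=> hy; rewrite -c1; apply/ltW/hm; apply: ideal_le hy; lia.
(* Squaring preserves 1 + P^(|m|+1), because y^2 - 1 = 2 (y - 1) + (y - 1)^2. *)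
have pw k : idealP (`|m|.+1)%N%:Z (x ^+ (2 ^ k) - 1) /\ chi x ^+ (2 ^ k) = chi (x ^+ (2 ^ k)).
  elim: k => [|k [I1 I2]]; first by rewrite expn0 !expr1.
  rewrite expnS mulnC !exprM I2; set y := x ^+ (2 ^ k) in I1 *.
  have y0 : y != 0 by have [] := unit_near1 _ I1.
  rewrite !expr2 hM //; split => //.
  have -> : y * y - 1 = (y - 1) + (y - 1) + (y - 1) * (y - 1) by ring.
  apply: idealD; first exact: idealD.
  by apply: ideal_le (idealM I1 I1); lia.
by apply: small_powers_eq1 => k; case: (pw k) => h ->; exact: close.
Qed.

Lemma smooth1 chi a : smooth_character chi a -> chi 1 = 1.
Proof.
move=> [hM h0 _ _]; have o0 := oner_neq0 F.
by apply: (mulfI (h0 _ o0)); rewrite -hM // !mulr1.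
Qed.

Lemma smoothV chi a x : smooth_character chi a -> x != 0 -> chi x^-1 = (chi x)^-1.
Proof.
move=> sc x0; have c1 := smooth1 sc; case: sc => hM h0 _ _.
by apply: (mulfI (h0 _ x0)); rewrite -hM ?invr_eq0 // !divff ?h0.
Qed.

Lemma smoothX chi a x (n : int) : smooth_character chi a -> x != 0 ->
  chi (x ^ n) = chi x ^ n.
Proof.
move=> sc x0.
have nat_case (k : nat) : chi (x ^+ k) = chi x ^+ k.
  elim: k => [|k IH]; first by rewrite !expr0 (smooth1 sc).
  by case: (sc) => hM _ _ _; rewrite !exprS hM ?expf_neq0 // IH.
case: n => k; first exact: nat_case.
by rewrite NegzE -!exprnN (smoothV sc) ?expf_neq0 // nat_case.
Qed.

Lemma smooth_shift chi a x h : smooth_character chi a -> x != 0 ->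
  idealP (vl x + a%:Z) h -> chi (x + h) = chi x.
Proof.
move=> [hM h0 a1 ha] x0 hh.
have hx : idealP a%:Z (x^-1 * h).
  have := @idealMz _ (vl x + a%:Z) (- vl x) x^-1 h.
  by rewrite addrAC subrr add0r invr_eq0 vlV // => /(_ x0 erefl)[_]; exact.
have u1 : idealP a%:Z (1 + x^-1 * h - 1) by rewrite addrC addKr.
have u0 : 1 + x^-1 * h != 0 by have [] := unit_near1 _ u1.
have -> : x + h = x * (1 + x^-1 * h) by rewrite mulrDr mulr1 mulVKf.
by rewrite hM // (ha _ u1) mulr1.
Qed.

Lemma smooth_inv chi a : smooth_character chi a -> smooth_character (char_inv chi) a.
Proof.
move=> [hM h0 a1 ha]; split => // [x y x0 y0|x x0|x hx]; rewrite /char_inv.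
- by rewrite hM // invfM.
- by rewrite invr_eq0 h0.
- by rewrite ha // invr1.
Qed.

Lemma smoothN1 chi a : smooth_character chi a -> chi (- 1) * chi (- 1) = 1.
Proof.
move=> sc; case: (sc) => hM _ _ _.
by rewrite -hM ?oppr_eq0 ?oner_neq0 // mulrNN mulr1 (smooth1 sc).
Qed.

Lemma unramified_inv chi : unramified (char_inv chi) <-> unramified chi.
Proof.
split=> h x x0 vx; last by rewrite /char_inv h // invr1.
by apply/invr_inj; rewrite invr1; exact: h.
Qed.

(** A point where psi is not 1 bounds the admissible exponents from below, so a least one exists.
    The last clause is its minimality in usable form: psi trivial on all multiples of x by integers
    is psi trivial on P^(v(x)). *)
Lemma add_conductorP psi : add_character psi -> (exists x, psi x != 1) ->
  trivial_on_ideal psi (add_conductor psi) /\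
  forall x, ~ idealP (add_conductor psi) x -> exists2 u, idealP 0 u & psi (x * u) != 1.
Proof.
move=> hpsi [x0 px0]; have [m hm] := add_character_trivial hpsi.
have xn0 : x0 != 0 by apply: contraNneq px0 => ->; rewrite add_character0.
have bound k : trivial_on_ideal psi k -> vl x0 < k.
  move=> hk; rewrite ltNge; apply/negP => kx; move/eqP: px0; apply.
  by apply: hk; apply/idealE.
have ex : exists k : nat, `[< trivial_on_ideal psi (vl x0 + k%:Z) >].
  have bm := bound _ hm.
  exists `|m - vl x0|%N; apply/asboolP => x hx; apply: hm.
  by apply: ideal_le hx; lia.
case: (ex_minnP ex) => k /asboolP hk mink.
have hP : [set e | trivial_on_ideal psi e /\
    forall m', trivial_on_ideal psi m' -> e <= m'] (add_conductor psi).
  apply: xgetPex; exists (vl x0 + k%:Z); split => // e he.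
  have be := bound _ he.
  have := mink `|e - vl x0|%N.
  have -> : (vl x0 + `|e - vl x0|%N%:Z) = e by lia.
  by move=> /(_ (introT (asboolP _) he)); lia.
case: hP => h1 h2; split => // x hx.
have xn : x != 0 by apply/eqP => xe; apply: hx; rewrite xe; exact: ideal0.
apply: contrapT => hn; apply: hx; apply/idealE => //; apply: h2 => y hy.
have hu : idealP 0 (x^-1 * y).
  have := @idealMz _ (vl x) (- vl x) x^-1 y.
  by rewrite subrr invr_eq0 vlV // => /(_ xn erefl)[_]; exact.
apply: contrapT => /eqP pu; apply: hn; exists (x^-1 * y) => //.
by rewrite mulVKf.
Qed.

Lemma mul_conductor_unramified chi : unramified chi -> mul_conductor chi = 0%N.
Proof. by move=> h; rewrite /mul_conductor asboolT. Qed.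

Lemma mul_conductorP chi a : smooth_character chi a -> ~ unramified chi ->
  [/\ (1 <= mul_conductor chi)%N, trivial_on_units chi (mul_conductor chi) &
   forall m, (1 <= m)%N -> (m < mul_conductor chi)%N ->
     exists2 u, idealP m%:Z (u - 1) & chi u != 1].
Proof.
move=> [_ _ a1 ha] ram.
have ex : exists k : nat, `[< (1 <= k)%N /\ trivial_on_units chi k >].
  by exists a; apply/asboolP.
case: (ex_minnP ex) => k /asboolP[k1 hk] mink.
have [h1 h2 h3] : [set m | [/\ (1 <= m)%N, trivial_on_units chi m &
    forall m', (1 <= m')%N -> trivial_on_units chi m' -> (m <= m')%N]]
    (mul_conductor chi).
  rewrite /mul_conductor asboolF //; apply: xgetPex; exists k; split => // e e1 he.
  by apply: mink; apply/asboolP.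
split => // m m1 mlt; apply: contrapT => hn.
have := h3 m m1; rewrite leqNgt mlt => /(_ _)/negP; case=> // u hu.
by apply: contrapT => /eqP cu; apply: hn; exists u.
Qed.

End Characters.

(** * Haar measure and change of variables *)

Section BorelMeasure.
Variables (R : realType) (F : padicFieldType).
Implicit Types (x y : F) (m n j : int).

Lemma open_borelF (U : set F) : open U -> measurable (U : set (borelF F)).
Proof. by move=> oU; exact: sub_sigma_algebra. Qed.

Lemma measurable_coset x m : measurable (coset x m : set (borelF F)).
Proof. by apply: open_borelF; exact: open_coset. Qed.

Lemma coset_sum (mu : {measure set (borelF F) -> \bar R}) (rs : seq F) (varpi : F)
    (A : set (borelF F)) x j :
  uniformizer varpi -> measurable A -> uniq rs -> 
  (forall r, r \in rs -> idealP 0 r) ->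
  (forall y, idealP 0 y -> exists2 r, r \in rs & idealP 1 (y - r)) ->
  (forall r r', r \in rs -> r' \in rs -> idealP 1 (r - r') -> r = r') ->
  mu (A `&` coset x j) =
  (\sum_(r <- rs) mu (A `&` coset (x + varpi ^ j * r)%R (j + 1)%R))%E.
Proof.
move=> hv mA urs rs0 rs1 rs2; rewrite fsbig_seq //.
rewrite -measure_fin_bigcup //.
- rewrite -setI_bigcupr.
  have <- : coset x j = \bigcup_(r in [set` rs]) coset (x + varpi ^ j * r) (j + 1); last by [].
  apply/seteqP; split=> y.
    by move=> /(coset_split hv rs1)[r rrs hr]; exists r.
  move=> [r /= rrs hr].
  have h1 : idealP j (varpi ^ j * r).
    have [_] := @idealMz _ 0 j (varpi ^ j) r (varpiX_neq0 hv j) (vl_varpiX hv j).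
    by rewrite add0r; apply; exact: rs0.
  have h2 : idealP j (y - (x + varpi ^ j * r)) by apply: ideal_le hr; lia.
  by have := idealD h2 h1; rewrite opprD addrA subrK.
- apply/trivIsetP => r r' /= hr hr' /eqP rr'; apply/seteqP; split=> // y [[_ h1] [_ h2]].
  apply: rr'; apply: rs2 => //.
  have := ideal_trans (ideal_distr h1) h2.
  rewrite opprD addrACA subrr add0r -mulrBr addrC.
  by case: (@idealMz _ 1 j (varpi ^ j) (r - r') (varpiX_neq0 hv j) (vl_varpiX hv j)) => h _ /h.
- by move=> r _; apply: measurableI => //; exact: measurable_coset.
Qed.

(** Cosets determine bounded sets invariant under some P^k by finite subdivision, these determine
    open sets as increasing unions, and open sets are a pi-system generating the Borel sets. The
    lemma replaces a uniqueness theorem for Haar measure when dilations are studied. *)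
Lemma measure_eq_cosets (m1 m2 : {measure set (borelF F) -> \bar R}) :
  (forall x j, m1 (coset x j) = m2 (coset x j)) ->
  (forall j, (m1 (coset (0%R : F) j) < +oo)%E) ->
  forall A : set (borelF F), measurable A -> m1 A = m2 A.
Proof.
move=> m12 m1oo.
have [w w0 vw] := @vl_surj F; have hw : uniformizer w by [].
have [rs [_ urs rs0 rs1 rs2]] := residue_reps F.
have periodic (A : set (borelF F)) k : measurable A ->
    (forall x h, A x -> idealP k h -> A (x + h)) ->
    forall d x j, k <= j + d%:Z -> m1 (A `&` coset x j) = m2 (A `&` coset x j).
  move=> mA hA; elim=> [|d IH] x j kj.
    have [[y [Ay xy]]|ne] := pselect (exists y, (A `&` coset x j) y).
      have -> : A `&` coset x j = coset x j; last by [].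
      apply/seteqP; split=> z; first by case.
      move=> xz; split => //; have -> : z = y + (z - y) by rewrite addrC subrK.
      apply: hA => //; apply: ideal_le (ideal_trans xz (ideal_distr xy)); lia.
    have -> : A `&` coset x j = set0; last by rewrite !measure0.
    by apply/seteqP; split=> z // hz; apply: ne; exists z.
  rewrite !(@coset_sum _ rs w) //.
  by apply: eq_bigr => r _; apply: IH; lia.
have opens (U : set (borelF F)) : open (U : set F) -> m1 U = m2 U.
  move=> oU.
  pose V (k : nat) : set (borelF F) :=
    [set x | idealP (- k%:Z) x /\ coset x k%:Z `<=` U].
  have Vper k x h : V k x -> idealP k%:Z h -> V k (x + h).
    move=> [hx sx] hh; split.
      by apply: idealD => //; apply: ideal_le hh; lia.
    move=> y hy; apply: sx; have := idealD hy hh.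
    by rewrite opprD addrA subrK.
  have mV k : measurable (V k).
    apply: open_borelF; apply: open_of_near => x Vx.
    apply/near_ideal; exists k%:Z => y hy.
    by have := Vper k x (y - x) Vx hy; rewrite addrC subrK.
  have UV : U = \bigcup_k V k.
    apply/seteqP; split=> [x Ux|x [k _ [_]]]; last first.
      by apply; rewrite /coset /= subrr; exact: ideal0.
    have /near_ideal[m hm] : \forall y \near x, U y by exact: open_nbhs_nbhs.
    exists (`|m| + `|vl x|)%N => //; split.
      by move=> _; lia.
    by move=> y hy; apply: hm; apply: ideal_le hy; lia.
  have ndV : {homo V : n m / (n <= m)%N >-> (n <= m)%O}.
    move=> n m nm; apply/subsetPset => x [h1 h2]; split.
      by apply: ideal_le h1; lia.
    by move=> y hy; apply: h2; apply: ideal_le hy; lia.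
  have eV k : m1 (V k) = m2 (V k).
    have -> : V k = V k `&` coset 0 (- k%:Z).
      apply/seteqP; split=> x; last by case.
      by move=> Vx; split=> //; rewrite /coset /= subr0; case: Vx.
    by apply: (@periodic _ k%:Z _ _ (k + k)%N) => //; [move=> x h; exact: Vper|lia].
  have mU : measurable (\bigcup_k V k) by apply: bigcupT_measurable.
  have c1 := @nondecreasing_cvg_mu _ _ _ m1 _ mV mU ndV.
  have c2 := @nondecreasing_cvg_mu _ _ _ m2 _ mV mU ndV.
  rewrite UV.
  have e12 : m1 \o V = m2 \o V by apply/funext => k /=; exact: eV.
  rewrite e12 in c1.
  by apply: cvg_unique c1 c2; exact: ereal_hausdorff.
apply: (@g_sigma_algebra_measure_unique _ _ _ (@open F : set (set (borelF F))) _
   (fun k => coset (0%R : F) (- k%:Z))).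
- by move=> U; exact: open_borelF.
- by move=> k; exact: open_coset.
- apply/seteqP; split=> // x _; exists `|vl x|%N => //.
  by rewrite /coset /= subr0 => _; lia.
- by move=> A B oA oB; exact: openI.
- by move=> U oU; exact: opens.
- by move=> k; exact: m1oo.
Qed.

Variables (mu : {measure set (borelF F) -> \bar R}) (hmu : haar_measure mu).

Local Notation q := ((residue_card F)%:R : R).

Definition vol (m : int) : R := fine (mu (coset (0%R : F) m)).

Lemma coset_translate x m : coset x m = [set x + y | y in coset (0%R : F) m].
Proof.
apply/seteqP; split=> y; rewrite /coset /=.
  by move=> h; exists (y - x); rewrite ?subr0 // addrC subrK.
by move=> [z]; rewrite subr0 => hz <-; rewrite addrC addKr.
Qed.

Lemma coset0E m : coset (0%R : F) m = [set x | idealP m x].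
Proof. by apply/seteqP; split=> x; rewrite /coset /= subr0. Qed.

Lemma coset_fin m : (mu (coset (0%R : F) m) < +oo)%E.
Proof. by case: hmu => _ h _; apply: h; rewrite coset0E; exact: compact_ideal. Qed.

Lemma mu_coset x m : mu (coset x m) = (vol m)%:E.
Proof.
case: hmu => h1 _ _; rewrite coset_translate.
rewrite (h1 x (coset 0 m)); last exact: measurable_coset.
by rewrite /vol fineK // ge0_fin_numE //; exact: coset_fin.
Qed.

Lemma vol_gt0 m : 0 < vol m.
Proof.
rewrite -lte_fin -(mu_coset 0); case: hmu => _ _; apply; first exact: open_coset.
by exists 0; rewrite /coset /= subrr; exact: ideal0.
Qed.

Lemma volS m : vol m = q * vol (m + 1).
Proof.
have [w w0 vw] := @vl_surj F; have hw : uniformizer w by [].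
have [rs [srs urs rs0 rs1 rs2]] := residue_reps F.
have := @coset_sum mu rs w setT 0 m hw measurableT urs rs0 rs1 rs2.
rewrite setTI mu_coset.
under eq_bigr do rewrite setTI mu_coset.
by rewrite sumEFin => -[->]; rewrite -srs big_const_seq count_predT iter_addr_0 mulr_natl.
Qed.

Lemma q_gt1 : 1 < q.
Proof.
have [rs [srs urs rs0 rs1 rs2]] := residue_reps F.
rewrite -srs ltr1n.
have [a ars ha] := rs1 0 (ideal0 _).
have [b brs hb] : exists2 r, r \in rs & idealP 1 (1 - r).
  by apply: rs1; apply/idealE; rewrite ?oner_neq0 // vl1.
have ab : a != b.
  apply/eqP => ab; rewrite -ab in hb.
  have := idealB hb ha; rewrite sub0r opprK subrK.
  by move/idealE => /(_ (oner_neq0 _)); rewrite vl1.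
case: rs {srs rs0 rs1 rs2} urs ars brs => [|c [|d rs]] //= _.
by rewrite !inE => /eqP ea /eqP eb; rewrite ea eb eqxx in ab.
Qed.

Lemma q_gt0 : 0 < q. Proof. exact: lt_trans ltr01 q_gt1. Qed.

Lemma q_neq0 : q != 0. Proof. by rewrite gt_eqF // q_gt0. Qed.

Lemma volD m n : vol m = q ^ n * vol (m + n).
Proof.
have nat_case k m' : vol m' = q ^+ k * vol (m' + k%:Z).
  elim: k => [|k IH]; first by rewrite mul1r addr0.
  by rewrite IH volS mulrA -exprSr; congr (_ * vol _); lia.
case: n => k; first exact: nat_case.
rewrite NegzE [in RHS](nat_case k.+1) subrK -exprnN mulrA mulVf ?mul1r //.
by rewrite expf_neq0 // q_neq0.
Qed.

Section Affine.
Variables (a b : F) (a0 : a != 0).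

Definition affine (x : borelF F) : borelF F := (a * (x : F) + b : F).

Lemma affine_coset x m : affine @^-1` coset x m = coset (a^-1 * (x - b)) (m - vl a).
Proof.
apply/seteqP; split=> y; rewrite /coset /affine /=.
  have -> : a * y + b - x = a * (y - a^-1 * (x - b)).
    by rewrite mulrBr mulVKf // opprB addrA.
  by move=> h; apply/(@idealMz _ (m - vl a) (vl a) a) => //; rewrite subrK.
move=> h; have -> : a * y + b - x = a * (y - a^-1 * (x - b)).
  by rewrite mulrBr mulVKf // opprB addrA.
by have := (@idealMz _ (m - vl a) (vl a) a (y - a^-1 * (x - b)) a0 erefl).2 h; rewrite subrK.
Qed.

Lemma affine_measurable : measurable_fun setT affine.
Proof.
apply: (@measurability _ _ _ _ _ _ (@open F : set (set (borelF F)))) => //.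
move=> _ [U oU <-]; rewrite setTI; apply: open_borelF; apply: open_of_near => x Ux.
have /near_ideal[m hm] : \forall y \near (affine x : F), U y by exact: open_nbhs_nbhs.
apply/near_ideal; exists (m - vl a) => y hy; apply: hm.
have -> : affine y - affine x = a * (y - x).
  by rewrite /affine opprD addrACA subrr addr0 mulrBr.
by have := (@idealMz _ (m - vl a) (vl a) a (y - x) a0 erefl).2 hy; rewrite subrK.
Qed.

Lemma affine_preimage (D : set (borelF F)) :
  measurable D -> measurable (affine @^-1` D).
Proof. by move=> mD; rewrite -[X in measurable X]setTI; exact: affine_measurable. Qed.

Lemma qX_ge0 (n : int) : 0 <= q ^ n.
Proof. by rewrite exprz_ge0 // ltW // q_gt0. Qed.

(** The factor is 1/|a|: the preimage of a coset of P^j is a coset of P^(j - v(a)), so the two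
    measures agree on cosets. *)
Lemma pushforward_affine (A : set (borelF F)) : measurable A ->
  pushforward mu affine A = mscale (NngNum (qX_ge0 (vl a))) mu A.
Proof.
move=> mA; pose f' := isMeasurableFun.Build _ _ _ _ _ affine_measurable.
pose f : {mfun borelF F >-> borelF F} := HB.pack affine f'.
apply: (@measure_eq_cosets (pushforward mu f) (mscale (NngNum (qX_ge0 (vl a))) mu)) => //.
  move=> x j; transitivity (mu (coset (a^-1 * (x - b)) (j - vl a))).
    by rewrite -affine_coset.
  transitivity ((q ^ vl a)%:E * mu (coset x j))%E; last by [].
  by rewrite !mu_coset [vol (_ - _)](volD _ (vl a)) subrK EFinM.
move=> j; apply: (@le_lt_trans _ _ (mu (coset (a^-1 * (0 - b)) (j - vl a)))).
  by rewrite -affine_coset.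
by rewrite mu_coset ltry.
Qed.

Lemma ge0_integral_affine (D : set (borelF F)) (f : borelF F -> \bar R) :
  measurable D -> measurable_fun D f -> (forall x, D x -> (0 <= f x)%E) ->
  (\int[mu]_(x in affine @^-1` D) f (affine x) =
   (q ^ vl a)%:E * \int[mu]_(x in D) f x)%E.
Proof.
move=> mD mf f0.
rewrite -(ge0_integral_pushforward affine_measurable) //; last first.
  by move=> x; rewrite inE; exact: f0.
transitivity (\int[mscale (NngNum (qX_ge0 (vl a))) mu]_(x in D) f x)%E.
  apply: eq_measure_integral; first exact: affine_measurable.
  by move=> Hm A mA _; exact: pushforward_affine.
by rewrite ge0_integral_mscale.
Qed.

End Affine.
End BorelMeasure.

(** * Integration of complex-valued functions and affine change of variables *)

Section ComplexIntegrals.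
Variables (R : realType) (F : padicFieldType).
Variables (mu : {measure set (borelF F) -> \bar R}) (hmu : haar_measure mu).
Implicit Types (D A B : set (borelF F)) (f g : F -> C R) (h : borelF F -> R).
Local Notation q := ((residue_card F)%:R : R).

(** Plays the part of continuity: it passes through arbitrary operations on the values and gives
    Borel measurability on open sets. *)
Definition loc_const (T : Type) (D : set F) (f : F -> T) : Prop :=
  forall x, D x -> \forall y \near x, f y = f x.

Lemma loc_const_comp (T U : Type) (D : set F) (f : F -> T) (g : T -> U) :
  loc_const D f -> loc_const D (fun x => g (f x)).
Proof. by move=> lf x /lf; apply: filterS => y ->. Qed.

Lemma loc_const_comp2 (T U V : Type) (D : set F) (f : F -> T) (g : F -> U) (k : T -> U -> V) :
  loc_const D f -> loc_const D g -> loc_const D (fun x => k (f x) (g x)).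
Proof. by move=> lf lg x Dx; apply: filterS2 (lf x Dx) (lg x Dx) => y -> ->. Qed.

Lemma loc_constS (T : Type) (D E : set F) (f : F -> T) :
  D `<=` E -> loc_const E f -> loc_const D f.
Proof. by move=> DE h x /DE; exact: h. Qed.

Lemma loc_const_measurable (D : set F) h : open D -> loc_const D h ->
  measurable_fun (D : set (borelF F)) h.
Proof.
move=> oD lh _ Y _; apply: open_borelF; apply: open_of_near => x [Dx hx].
have nD : \forall y \near x, D y by exact: open_nbhs_nbhs.
by apply: filterS2 nD (lh x Dx) => y Dy e; split => //; rewrite /= e.
Qed.

Lemma loc_const_bounded (D : set F) h : compact D -> loc_const D h ->
  exists N : nat, forall x, D x -> `|h x| <= N%:R.
Proof.
move=> cD lh; have := @compact_near_coveringP F D.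
case=> /(_ cD) /(_ nat \oo (fun N x => `|h x| <= N%:R)) H _.
have [x Dx|N _ hN] := H _.
  pose M := (Num.truncn `|h x|).+1.
  exists ([set y | h y = h x], [set N | (M <= N)%N]) => /=.
    by split; [exact: lh|exists M].
  move=> [y n] [/= -> Mn]; apply: (@le_trans _ _ M%:R); last by rewrite ler_nat.
  exact/ltW/truncnS_gt.
by exists N => x Dx; apply: (hN N) => //=.
Qed.

Lemma compact_mu_fin (D : set F) : compact D -> (mu D < +oo)%E.
Proof. by case: hmu => _ h _; exact: h. Qed.

Lemma loc_const_integrable (D : set F) h : open D -> compact D -> loc_const D h ->
  mu.-integrable (D : set (borelF F)) (EFin \o h).
Proof.
move=> oD cD lh; have [N hN] := loc_const_bounded cD lh.
apply: measurable_bounded_integrable => //.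
- exact: open_borelF.
- exact: compact_mu_fin.
- exact: loc_const_measurable.
- exists N%:R; split; first by rewrite num_real.
  by move=> M NM x Dx; apply: le_trans (hN x Dx) (ltW NM).
Qed.

Lemma cintegrable_compact (D : set F) f : open D -> compact D -> loc_const D f ->
  cintegrable mu D f.
Proof.
by move=> oD cD lf; split; apply: loc_const_integrable => //; exact: loc_const_comp lf.
Qed.

Lemma eq_cintegrable D f g : measurable D -> (forall x, D x -> f x = g x) ->
  cintegrable mu D f -> cintegrable mu D g.
Proof.
move=> mD fg [h1 h2]; split; [apply: eq_integrable h1|apply: eq_integrable h2] => //;
  by move=> x; rewrite inE => /fg ->.
Qed.

Lemma eq_cintegral D f g : (forall x, D x -> f x = g x) ->
  cintegral mu D f = cintegral mu D g.
Proof.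
by move=> fg; rewrite /cintegral; congr (Complex _ _);
  apply: eq_Rintegral => x; rewrite inE => /fg ->.
Qed.

Lemma cintegral_cst D (c : C R) : measurable D -> (mu D < +oo)%E ->
  cintegral mu D (fun=> c) = rc (fine (mu D)) * c.
Proof.
move=> mD _; rewrite /cintegral !Rintegral_cst //.
by case: c => a b /=; rewrite /rc; simpc; rewrite mulrC [b * _]mulrC.
Qed.

Lemma cintegrable0 D : measurable D -> cintegrable mu D (fun=> 0 : C R).
Proof. by move=> mD; split; exact: integrable0. Qed.

Lemma cintegral0 D : measurable D -> cintegral mu D (fun=> 0 : C R) = 0.
Proof. by move=> mD; rewrite /cintegral !Rintegral_cst //= !mul0r. Qed.

Lemma integrable_lin D h (k : borelF F -> R) (a b : R) : measurable D ->
  mu.-integrable D (EFin \o h) -> mu.-integrable D (EFin \o k) ->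
  mu.-integrable D (EFin \o (fun x => a * h x + b * k x)) /\
  Rintegral mu D (fun x => a * h x + b * k x) = a * Rintegral mu D h + b * Rintegral mu D k.
Proof.
move=> mD ih ik.
have ia : mu.-integrable D (EFin \o (fun x => a * h x)).
  by apply: eq_integrable (integrableZl mD a ih) => // x _ /=; rewrite EFinM.
have ib : mu.-integrable D (EFin \o (fun x => b * k x)).
  by apply: eq_integrable (integrableZl mD b ik) => // x _ /=; rewrite EFinM.
split; last by rewrite RintegralD // !RintegralZl.
by apply: eq_integrable (integrableD mD ia ib) => // x _ /=; rewrite EFinD.
Qed.

Lemma cintegralZ D f (c : C R) : measurable D -> cintegrable mu D f ->
  cintegrable mu D (fun x => c * f x) /\
  cintegral mu D (fun x => c * f x) = c * cintegral mu D f.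
Proof.
move=> mD [h1 h2].
have [i1 e1] := integrable_lin (complex.Re c) (- complex.Im c) mD h1 h2.
have [i2 e2] := integrable_lin (complex.Re c) (complex.Im c) mD h2 h1.
have r1 x : complex.Re (c * f x) =
    complex.Re c * complex.Re (f x) + - complex.Im c * complex.Im (f x).
  by case: c (f x) {i1 e1 i2 e2} => [a b] [u v] /=; rewrite mulNr.
have r2 x : complex.Im (c * f x) =
    complex.Re c * complex.Im (f x) + complex.Im c * complex.Re (f x).
  by case: c (f x) {i1 e1 i2 e2 r1} => [a b] [u v] /=.
split.
  by split; [apply: eq_integrable i1|apply: eq_integrable i2] => // x _ /=; rewrite ?r1 ?r2.
rewrite /cintegral (eq_Rintegral mu (fun x _ => r1 x)) (eq_Rintegral mu (fun x _ => r2 x)).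
rewrite e1 e2; case: (c) => a b; simpc => /=.
by congr (Complex _ _); rewrite mulNr.
Qed.

Lemma cintegrable_setU A B f : measurable A -> measurable B -> A `&` B = set0 ->
  cintegrable mu A f -> cintegrable mu B f -> cintegrable mu (A `|` B) f.
Proof.
have U (k : borelF F -> R) : measurable A -> measurable B -> A `&` B = set0 ->
    mu.-integrable A (EFin \o k) -> mu.-integrable B (EFin \o k) ->
    mu.-integrable (A `|` B) (EFin \o k).
  move=> mA mB AB /integrableP[mkA iA] /integrableP[mkB iB].
  apply/integrableP; split; first by apply/measurable_funU.
  have dAB : [disjoint A & B] by apply/eqP.
  rewrite ge0_integral_setU //; first exact: lte_add_pinfty.
  by apply: measurableT_comp => //; apply/measurable_funU.
by move=> mA mB dAB [h1 h2] [k1 k2]; split; exact: U.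
Qed.

Lemma cintegral_setU A B f : measurable A -> measurable B -> A `&` B = set0 ->
  cintegrable mu (A `|` B) f ->
  cintegral mu (A `|` B) f = cintegral mu A f + cintegral mu B f.
Proof.
move=> mA mB AB [h1 h2]; have dAB : [disjoint A & B] by apply/eqP.
by rewrite /cintegral !Rintegral_setU //; simpc.
Qed.

Lemma cintegrableS A B f : measurable A -> measurable B -> A `<=` B ->
  cintegrable mu B f -> cintegrable mu A f.
Proof. by move=> mA mB AB [h1 h2]; split; exact: integrableS mB mA AB _. Qed.

Lemma cintegral_support A D f : measurable A -> measurable D -> A `<=` D ->
  (forall x, D x -> ~ A x -> f x = 0) -> cintegrable mu A f ->
  cintegrable mu D f /\ cintegral mu D f = cintegral mu A f.
Proof.
move=> mA mD AD f0 iA.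
have mDA : measurable (D `\` A) by exact: measurableD.
have z x : (D `\` A) x -> (fun=> 0 : C R) x = f x by move=> [Dx nAx]; rewrite f0.
have iB : cintegrable mu (D `\` A) f.
  exact: eq_cintegrable mDA z (cintegrable0 mDA).
have e : D = A `|` (D `\` A) by rewrite setDUK.
have dis : A `&` (D `\` A) = set0 by apply/seteqP; split=> x // [Ax [_ /(_ Ax)]].
have iD : cintegrable mu D f by rewrite e; exact: cintegrable_setU.
split => //; rewrite {1}e cintegral_setU -?e //.
by rewrite -(eq_cintegral z) cintegral0 // addr0.
Qed.

Section Affine.
Variables (a b : F) (a0 : a != 0).
Local Notation phi := (affine a b).

Lemma Rintegral_affine D h : measurable D -> mu.-integrable D (EFin \o h) ->
  mu.-integrable (phi @^-1` D) (EFin \o (h \o phi)) /\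
  Rintegral mu (phi @^-1` D) (h \o phi) = q ^ vl a * Rintegral mu D h.
Proof.
move=> mD ih; have mpD := affine_preimage b a0 mD.
have [mh fh] := integrableP _ _ _ ih.
have mphi : measurable_fun (phi @^-1` D) phi.
  exact: measurable_funS measurableT (@subsetT _ _) (affine_measurable b a0).
have mhp : measurable_fun (phi @^-1` D) (EFin \o (h \o phi)).
  by apply: (measurable_comp mD _ mh mphi) => y [x Dx <-].
split.
  apply/integrableP; split=> //.
  rewrite (ge0_integral_affine hmu b a0 (f := fun x => `|(h x)%:E|%E)) //; last first.
    exact: measurableT_comp.
  by apply: lte_mul_pinfty; rewrite ?lee_fin ?qX_ge0.
have ip := integrable_fin_num mD (integrable_funepos mD ih).
have im := integrable_fin_num mD (integrable_funeneg mD ih).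
have ep : (\int[mu]_(x in phi @^-1` D) (EFin \o (h \o phi))^\+ x =
    (q ^ vl a)%:E * \int[mu]_(x in D) (EFin \o h)^\+ x)%E.
  rewrite -(ge0_integral_affine hmu b a0) //; last exact: measurable_funepos.
  apply: eq_integral => x _.
  exact: (congr1 (fun k => k x) (funepos_comp (EFin \o h) phi)).
have en : (\int[mu]_(x in phi @^-1` D) (EFin \o (h \o phi))^\- x =
    (q ^ vl a)%:E * \int[mu]_(x in D) (EFin \o h)^\- x)%E.
  rewrite -(ge0_integral_affine hmu b a0) //; last exact: measurable_funeneg.
  apply: eq_integral => x _.
  exact: (congr1 (fun k => k x) (funeneg_comp (EFin \o h) phi)).
have := integralE mu (phi @^-1` D) (EFin \o (h \o phi)).
rewrite ep en -muleBr //; last by rewrite fin_num_adde_defl // fin_numN.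
rewrite -integralE /Rintegral => /= ->.
by rewrite fineM // integrable_fin_num.
Qed.

Lemma cintegral_affine D f : measurable D -> cintegrable mu D f ->
  cintegrable mu (phi @^-1` D) (f \o phi) /\
  cintegral mu (phi @^-1` D) (f \o phi) = rc (q ^ vl a) * cintegral mu D f.
Proof.
move=> mD [h1 h2].
have [i1 e1] := Rintegral_affine mD h1; have [i2 e2] := Rintegral_affine mD h2.
split; first by split.
by rewrite /cintegral; have /= -> := e1; have /= -> := e2; rewrite /rc; simpc.
Qed.

End Affine.

Lemma cintegrable_nrm (D : set F) f : open D -> loc_const D f ->
  (\int[mu]_(x in (D : set (borelF F))) (nrm (f x))%:E < +oo)%E -> cintegrable mu D f.
Proof.
move=> oD lf fin; have mD := open_borelF oD.
have inrm : mu.-integrable (D : set (borelF F)) (EFin \o (fun x => nrm (f x))).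
  apply/integrableP; split.
    by apply/measurable_EFinP; apply: loc_const_measurable => //; exact: loc_const_comp lf.
  by under eq_integral do rewrite /= ger0_norm ?nrm_ge0 //.
split; apply: le_integrable inrm => //.
- by apply/measurable_EFinP; apply: loc_const_measurable => //; exact: loc_const_comp lf.
- by move=> x _ /=; rewrite lee_fin [leRHS]ger0_norm ?nrm_ge0 ?nrm_Re.
- by apply/measurable_EFinP; apply: loc_const_measurable => //; exact: loc_const_comp lf.
- by move=> x _ /=; rewrite lee_fin [leRHS]ger0_norm ?nrm_ge0 ?nrm_Im.
Qed.

End ComplexIntegrals.

(** * Zeta integrals *)

Section ZetaIntegrals.
Variables (R : realType) (F : padicFieldType).
Variables (mu : {measure set (borelF F) -> \bar R}) (hmu : haar_measure mu).
Variables (varpi : F) (hv : uniformizer varpi).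
Variables (chi : F -> C R) (a : nat) (sc : smooth_character chi a).
Implicit Types (f g : F -> C R) (x y : F) (s : C R) (j k : int).
Local Notation q := ((residue_card F)%:R : R).
Local Notation alpha := (chi varpi).

Definition qpowN s : C R := cpow q (- s).

Local Notation qs := qpowN.

Lemma qs_neq0 s : qs s != 0. Proof. exact: cexp_neq0. Qed.

Definition nonzero : set F := [set x | x != 0].

Definition weight0 x : C R := chi x * rc (normF R x)^-1.

Definition weight s x : C R := cpow (normF R x) s * chi x * rc (normF R x)^-1.

Lemma zeta_integrandE f s x : zeta_integrand chi f s x = f x * weight s x.
Proof. by rewrite /zeta_integrand /weight !mulrA. Qed.

Lemma normF_shell j x : shell j x -> normF R x = q ^ (- j).
Proof. by move=> [x0 vx]; rewrite /normF (negbTE x0) vx. Qed.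

Lemma qn_gt0 k : 0 < q ^ k. Proof. by rewrite exprz_gt0 // q_gt0. Qed.

Lemma qn_neq0 k : rc (q ^ k) != 0 :> C R.
Proof. by rewrite rc_eq0 gt_eqF // qn_gt0. Qed.

Lemma ln_qX k : ln (q ^ k) = k%:~R * ln q.
Proof.
have q0 := q_gt0 R F.
case: k => k; first by rewrite -exprnP lnXn // mulr_natl.
rewrite NegzE -exprnN lnV ?posrE ?exprn_gt0 // lnXn // mulrNz mulNr.
by rewrite mulr_natl.
Qed.

Lemma cpow_qX j s : cpow (q ^ (- j)) s = qs s ^ j.
Proof.
rewrite /cpow ln_qX /qpowN /cpow -cexp_intM; congr cexp.
rewrite -/(rc _) -/(rc (ln q)) rcM.
have -> : rc (- j)%:~R = - j%:~R :> C R by rewrite mulrNz rcN; congr (- _); exact: (rmorph_int (real_complex R)).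
ring.
Qed.

Lemma weight_shell j x s : shell j x -> weight s x = qs s ^ j * weight0 x.
Proof.
by move=> sx; rewrite /weight /weight0 (normF_shell sx) cpow_qX mulrA.
Qed.

Lemma shellM j x y : y != 0 -> shell j x -> shell (j + vl y) (y * x).
Proof. by move=> y0 [x0 vx]; split; rewrite ?mulf_neq0 // vlM // vx addrC. Qed.

Lemma weight0M x y : y != 0 -> x != 0 ->
  weight0 (y * x) = chi y * rc (q ^ vl y) * weight0 x.
Proof.
move=> y0 x0; have sx : shell (vl x) x by [].
rewrite /weight0 (normF_shell sx) (normF_shell (shellM y0 sx)).
case: sc => hM _ _ _; rewrite hM // -!invr_expz !invrK expfzDr ?q_neq0 // rcM; ring.
Qed.

Lemma weightM s x y : y != 0 -> x != 0 ->
  weight s (y * x) = qs s ^ vl y * chi y * rc (q ^ vl y) * weight s x.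
Proof.
move=> y0 x0; have sx : shell (vl x) x by [].
rewrite (weight_shell s sx) (weight_shell s (shellM y0 sx)) weight0M //.
rewrite expfzDr ?qs_neq0 //; ring.
Qed.

Lemma chi_lc : loc_const nonzero chi.
Proof.
move=> x x0; apply/near_ideal; exists (vl x + a%:Z) => y hy.
by rewrite -(subrK x y) addrC (smooth_shift sc).
Qed.

Lemma normF_lc : loc_const nonzero (normF R (F := F)).
Proof.
move=> x x0; apply: filterS (near_nonzero x0) => y [y0 vy].
by rewrite /normF (negbTE x0) (negbTE y0) vy.
Qed.

Lemma weight0_lc : loc_const nonzero weight0.
Proof.
exact: (loc_const_comp2 (fun u v => u * rc v^-1) chi_lc normF_lc).
Qed.

Lemma weight_lc s : loc_const nonzero (weight s).
Proof.
have h := loc_const_comp2 (fun u v => (u, v)) chi_lc normF_lc.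
exact: (loc_const_comp (fun p => cpow p.2 s * p.1 * rc p.2^-1) h).
Qed.

Lemma shell_nonzero j : shell j `<=` nonzero.
Proof. by move=> x []. Qed.

Lemma shell_borel j : measurable (shell j : set (borelF F)).
Proof. by apply: open_borelF; exact: open_shell. Qed.

Lemma shell_integrable j f : loc_const nonzero f -> cintegrable mu (shell j) f.
Proof.
move=> lf; apply: cintegrable_compact => //; [exact: open_shell|exact: compact_shell|].
exact: loc_constS (@shell_nonzero j) lf.
Qed.

(** The coefficient of X^j in the zeta integral of f, since |x|^s is the constant X^j on this
    shell. *)
Definition coef f j : C R := cintegral mu (shell j) (fun x => f x * weight0 x).

Lemma mul_weight0_lc f : loc_const nonzero f -> loc_const nonzero (fun x => f x * weight0 x).
Proof. by move=> lf; apply: loc_const_comp2 weight0_lc. Qed.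

Lemma affine0E (y x : F) : affine y 0 x = y * x.
Proof. by rewrite /affine addr0. Qed.

Lemma preimage_shell j y : y != 0 -> affine y 0 @^-1` shell (j + vl y) = shell j.
Proof.
move=> y0; apply/seteqP; split=> x /=.
  rewrite affine0E => -[yx0 vyx]; have x0 : x != 0.
    by apply: contraNneq yx0 => ->; rewrite mulr0.
  by split => //; move: vyx; rewrite vlM //; lia.
by rewrite affine0E; exact: shellM.
Qed.

(** Dilation invariance of dx/|x|: the factor q^(v(y)) of the change of variables cancels the one of
    [weight0M]. *)
Lemma coef_scale f j y : y != 0 -> loc_const nonzero f ->
  coef f (j + vl y) = chi y * coef (fun x => f (y * x)) j.
Proof.
move=> y0 lf.
have [_ e] := cintegral_affine hmu 0 y0 (shell_borel (j + vl y))
  (shell_integrable (j + vl y) (mul_weight0_lc lf)).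
apply: (mulfI (qn_neq0 (vl y))); rewrite /coef -e preimage_shell //.
rewrite mulrA [rc _ * _]mulrC.
have lfy : loc_const nonzero (fun x => f (y * x)).
  move=> x x0; have yx0 : nonzero (y * x) by rewrite /nonzero /= mulf_neq0.
  have /near_ideal[m hm] := lf _ yx0.
  apply/near_ideal; exists (m - vl y) => z hz; apply: hm.
  rewrite -mulrBr; have [_ /(_ hz)] := @idealMz _ (m - vl y) (vl y) y (z - x) y0 erefl.
  by rewrite subrK.
have [_ <-] := cintegralZ (chi y * rc (q ^ vl y)) (shell_borel j)
  (shell_integrable j (mul_weight0_lc lfy)).
apply: eq_cintegral => x [x0 vx] /=; rewrite affine0E weight0M //; ring.
Qed.

(** The integral of chi over the units. It governs all shells on which f is constant, and it is 0
    for ramified chi, so a single formula with a geometric tail covers both cases. *)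
Definition kappa : C R := coef (fun=> 1) 0.

Lemma loc_const_cst (T : Type) (c : T) (D : set F) : loc_const D (fun=> c).
Proof. by move=> x _; exact: nearW. Qed.

Lemma coef_one j : coef (fun=> 1) j = alpha ^ j * kappa.
Proof.
have := @coef_scale (fun=> 1) 0 (varpi ^ j) (varpiX_neq0 hv j) (@loc_const_cst _ 1 nonzero).
by rewrite add0r (vl_varpiX hv) (smoothX _ sc) // (varpi_neq0 hv).
Qed.

(** Substituting x -> ux, with u a unit such that chi(u) != 1, multiplies the integral by chi(u). *)
Lemma kappa_ramified : ~ unramified chi -> kappa = 0.
Proof.
move=> ram; have [u u0 [vu cu]] : exists2 u, u != 0 & vl u = 0 /\ chi u != 1.
  apply: contrapT => hn; apply: ram => x x0 vx; apply: contrapT => /eqP cx.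
  by apply: hn; exists x.
have := @coef_scale (fun=> 1) 0 u u0 (@loc_const_cst _ 1 nonzero); rewrite vu addr0 -/kappa.
move=> /eqP; rewrite eq_sym -subr_eq0 -{2}[kappa]mul1r -mulrBl mulf_eq0 subr_eq0.
by rewrite (negbTE cu) => /eqP.
Qed.

(** Valuations j, j + n, j + 2n, and so on; for n = 1 this is P^j without 0. *)
Definition tail (n : nat) j : set F :=
  [set x | [/\ x != 0, j <= vl x & (n%:Z %| vl x - j)%Z]].

Lemma open_vl (P : int -> Prop) : open [set x : F | x != 0 /\ P (vl x)].
Proof.
apply: open_of_near => x [x0 Px].
by apply: filterS (near_nonzero x0) => y [y0 ey]; split => /=; rewrite ?ey.
Qed.

Lemma open_tail n j : open (tail n j).
Proof.
have -> : tail n j = [set x | x != 0 /\ (j <= vl x /\ (n%:Z %| vl x - j)%Z)].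
  by apply/seteqP; split=> x [] => [? ? ?|? []].
exact: (open_vl (fun v => j <= v /\ (n%:Z %| v - j)%Z)).
Qed.

Lemma tail_borel n j : measurable (tail n j : set (borelF F)).
Proof. by apply: open_borelF; exact: open_tail. Qed.

Lemma tail_nonzero n j : tail n j `<=` nonzero.
Proof. by move=> x []. Qed.

Lemma geometric_bound (r : R) n : 0 <= r < 1 -> \sum_(k < n) r ^+ k <= (1 - r)^-1.
Proof.
move=> /andP[r0 r1]; rewrite -[leRHS]mul1r ler_pdivlMr ?subr_gt0 //.
have := subrX1 r n; have : 0 <= r ^+ n by exact: exprn_ge0.
set S := \sum_(i < n) _; move=> h e; rewrite mulrBr mulr1.
have -> : S - S * r = 1 - r ^+ n by rewrite -[1 - _]opprB e; ring.
by rewrite lerBlDr lerDl.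
Qed.

(** Dilation by varpi multiplies the integral of |weight| over a shell by rho = |chi(varpi) q^-s|;
    over all shells these integrals form a geometric series of ratio rho < 1. *)
Lemma tail_integrable s j : nrm (alpha * qs s) < 1 ->
  cintegrable mu (tail 1 j) (weight s).
Proof.
move=> rho1; pose rho := nrm (alpha * qs s).
have rho0 : 0 <= rho by exact: nrm_ge0.
apply: cintegrable_nrm => //.
- exact: open_tail.
- exact: loc_constS (@tail_nonzero 1 j) (weight_lc s).
pose h : borelF F -> R := fun x => nrm (weight s x).
have hlc : loc_const nonzero h by exact: loc_const_comp (weight_lc s).
have hint i : mu.-integrable (shell i : set (borelF F)) (EFin \o h).
  apply: loc_const_integrable => //; [exact: open_shell|exact: compact_shell|].
  exact: loc_constS (@shell_nonzero i) hlc.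
pose b i := Rintegral mu (shell i) h.
have b0 i : 0 <= b i by apply: Rintegral_ge0 => x _; exact: nrm_ge0.
have bS i : b (i + 1) = rho * b i.
  have w0 := varpi_neq0 hv; have vw : vl varpi = 1 by case: hv.
  have [_] := Rintegral_affine hmu 0 w0 (shell_borel (i + vl varpi)) (hint (i + vl varpi)).
  rewrite preimage_shell // vw -/(b (i + 1)) => e.
  apply: (mulfI (lt0r_neq0 (qn_gt0 1))); rewrite -e mulrA.
  rewrite /b -RintegralZl //; last exact: shell_borel.
  apply: eq_Rintegral => x; rewrite inE => -[x0 vx] /=.
  rewrite /h affine0E weightM // vw !expr1z !nrmM nrm_rc ger0_norm ?(ltW (q_gt0 R F)) //.
  rewrite /rho nrmM; ring.
have bk (k : nat) : b (j + k%:Z) = rho ^+ k * b j.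
  elim: k => [|k IH]; first by rewrite addr0 expr0 mul1r.
  have -> : j + k.+1%:Z = j + k%:Z + 1 by lia.
  by rewrite bS IH exprS mulrA.
have tU : tail 1 j = \bigcup_k shell (j + k%:Z).
  apply/seteqP; split=> x.
    move=> [x0 jx _]; exists `|vl x - j|%N => //; split => //; lia.
  by move=> [k _ [x0 vx]]; split => //; rewrite vx; lia.
have mh : measurable_fun (tail 1 j : set (borelF F)) h.
  apply: loc_const_measurable; first exact: open_tail.
  exact: loc_constS (@tail_nonzero 1 j) hlc.
rewrite tU ge0_integral_bigcup -?tU //; last first.
- apply/trivIsetP => i k _ _ /eqP ik; apply/seteqP; split=> x // [[_ v1] [_ v2]].
  by apply: ik; lia.
- by move=> x _; rewrite lee_fin nrm_ge0.
- exact/measurable_EFinP.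
- by move=> k; exact: shell_borel.
apply: (@le_lt_trans _ _ (b j * (1 - rho)^-1)%:E); last exact: ltry.
apply: lime_le.
  by apply: is_cvg_nneseries => n _ _; apply: integral_ge0 => x _; rewrite lee_fin nrm_ge0.
apply: nearW => n; rewrite big_mkord.
rewrite (eq_bigr (fun k : 'I_n => (rho ^+ k * b j)%:E)); last first.
  move=> k _; rewrite -bk /b /Rintegral fineK //.
  by apply: integrable_fin_num => //; exact: shell_borel.
rewrite sumEFin lee_fin -mulr_suml mulrC ler_wpM2l //.
by apply: geometric_bound; rewrite rho0 rho1.
Qed.

Lemma tail_sub n j : tail n j `<=` tail 1 j.
Proof. by move=> x [x0 jx _]; split => //; exact: dvd1z. Qed.

Lemma tailn_integrable n s j : nrm (alpha * qs s) < 1 ->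
  cintegrable mu (tail n j) (weight s).
Proof.
move=> h; apply: (cintegrableS (tail_borel n j) (tail_borel 1 j)) (tail_integrable j h).
exact: tail_sub.
Qed.

Lemma nrm_lt1_neq1 (z : C R) n : (0 < n)%N -> nrm z < 1 -> 1 - z ^+ n != 0.
Proof.
move=> n0 z1; rewrite subr_eq0 eq_sym; apply/eqP => zn.
have := congr1 (@nrm R) zn; rewrite nrmX -rc1 nrm_rc normr1.
by apply/eqP; rewrite lt_eqF // expr_lt1 // nrm_ge0.
Qed.

(* Self-similarity: tail n j is the disjoint union of a shell and of its own
   image under multiplication by varpi^n. *)
Lemma tail_integral n s j : (0 < n)%N -> nrm (alpha * qs s) < 1 ->
  cintegral mu (tail n j) (weight s) =
  kappa * (alpha * qs s) ^ j / (1 - (alpha * qs s) ^+ n).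
Proof.
move=> n0 h; have iT := tailn_integrable n j h.
have iE := tailn_integrable n (j + n%:Z) h.
have TE : tail n j = shell j `|` tail n (j + n%:Z).
  apply/seteqP; split=> x.
    move=> [x0 jx]; have [vj|vj] := eqVneq (vl x) j; first by left.
    move=> d; right; split => //.
      have := d; rewrite dvdzE /= => /dvdn_leq; move/eqP: vj; lia.
    by rewrite opprD addrA; apply: rpredB => //; exact: dvdzz.
  move=> [[x0 vx]|[x0 jx d]]; split => //; first by rewrite vx.
  - by rewrite vx subrr; exact: dvdz0.
  - by apply: le_trans jx; lia.
  - have -> : vl x - j = vl x - (j + n%:Z) + n%:Z by lia.
    by apply: rpredD => //; exact: dvdzz.
have dis : shell j `&` tail n (j + n%:Z) = set0.
  by apply/seteqP; split=> x // [[_ vx] [_ jx _]]; lia.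
have e1 : cintegral mu (tail n j) (weight s) =
    cintegral mu (shell j) (weight s) + cintegral mu (tail n (j + n%:Z)) (weight s).
  rewrite {1}TE cintegral_setU -?TE //; [exact: shell_borel|exact: tail_borel].
have e2 : cintegral mu (shell j) (weight s) = kappa * (alpha * qs s) ^ j.
  have [_ e] := cintegralZ (qs s ^ j) (shell_borel j)
     (shell_integrable j (mul_weight0_lc (@loc_const_cst _ 1 nonzero))).
  rewrite expfzMl.
  rewrite mulrA [kappa * _]mulrC -coef_one mulrC -e.
  by apply: eq_cintegral => x sx; rewrite mul1r; exact: weight_shell.
have e3 : cintegral mu (tail n (j + n%:Z)) (weight s) =
    (alpha * qs s) ^+ n * cintegral mu (tail n j) (weight s).
  have wn0 := varpiX_neq0 hv n%:Z; have vw := vl_varpiX hv n%:Z.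
  have [_ eA] := cintegral_affine hmu 0 wn0 (tail_borel n (j + n%:Z)) iE.
  have pre : affine (varpi ^ n%:Z) 0 @^-1` tail n (j + n%:Z) = tail n j.
    apply/seteqP; split=> x /=; rewrite /tail /= affine0E.
      rewrite mulf_eq0 negb_or => -[/andP[_ x0]]; rewrite vlM // vw => h1 h2.
      split => //; first lia.
      by have -> : vl x - j = n%:Z + vl x - (j + n%:Z) by lia.
    move=> [x0 h1 h2]; rewrite mulf_neq0 // vlM // vw; split => //; first lia.
    have -> : n%:Z + vl x - (j + n%:Z) = vl x - j by lia.
    by [].
  rewrite pre vw in eA.
  apply: (mulfI (qn_neq0 n%:Z)); rewrite -eA mulrA [rc _ * _]mulrC.
  have [_ <-] := cintegralZ ((alpha * qs s) ^+ n * rc (q ^ n%:Z)) (tail_borel n j) iT.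
  apply: eq_cintegral => x [x0 _ _] /=; rewrite affine0E weightM // vw (smoothX _ sc) ?(varpi_neq0 hv) //.
  by rewrite -!exprnP exprMn; ring.
have d0 := nrm_lt1_neq1 n0 h.
apply: (canRL (mulfK d0)).
by rewrite mulrBr mulr1 -e2 {1}e1 e3 [_ * _ ^+ n]mulrC addrK.
Qed.

End ZetaIntegrals.

(** * The zeta function as a rational function of q^-s *)

Section ZetaFormula.
Variables (R : realType) (F : padicFieldType).
Variables (mu : {measure set (borelF F) -> \bar R}) (hmu : haar_measure mu).
Variables (varpi : F) (hv : uniformizer varpi).
Implicit Types (f g chi : F -> C R) (x y : F) (s : C R) (j k : int).
Local Notation q := ((residue_card F)%:R : R).
Local Notation qs := (@qpowN R F).

(* The zeta integral of f on the valuations congruent to l modulo n, in terms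
   of Y = q^-s: c j is the integral over the shell of valuation j, and the last
   term sums the geometric series over the valuations at least M + d, where f
   is constant. *)
Definition zform (M : int) (d n l : nat) (c : int -> C R) (b al Y : C R) : C R :=
  \sum_(i < d) (if (n%:Z %| M + i%:Z - l%:Z)%Z then c (M + i%:Z) * Y ^ (M + i%:Z) else 0)
  + b * (al * Y) ^ (M + d%:Z + l%:Z) / (1 - (al * Y) ^+ n).

Lemma mero_expz (f : C R -> C R) k : meromorphic f -> meromorphic (fun s => f s ^ k).
Proof.
move=> mf; case: k => k; first exact: mero_exprn.
exact: (mero_inv (mero_exprn k.+1 mf)).
Qed.

Lemma qsE s : qs s = cexp (- rc (ln q) * s + 0).
Proof. by rewrite /qpowN /cpow addr0 -/(rc _) mulrC mulrN mulNr. Qed.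

Lemma mero_qs : meromorphic qs.
Proof. by apply: mero_ae (mero_exp (- rc (ln q)) 0); apply: ae_true => s; exact: qsE. Qed.

Lemma qsD s t : qs (s + t) = qs s * qs t.
Proof. by rewrite !qsE !addr0 -cexpD mulrDr. Qed.

Lemma qsN s : qs (- s) = (qs s)^-1.
Proof. by rewrite !qsE !addr0 -cexpN mulrN. Qed.

Lemma qs1 : qs 1 = rc q^-1.
Proof.
rewrite qsE addr0 mulr1 -rcN /cexp /= cos0 sin0 mulr0 mulr1 expRN lnK //.
by rewrite posrE q_gt0.
Qed.

Lemma lnq_gt0 : 0 < ln q.
Proof. by rewrite ln_gt0 // q_gt1. Qed.

Lemma cRe_rcM (x : R) (z : C R) : complex.Re (rc x * z) = x * complex.Re z.
Proof. by case: z => u v /=; rewrite mul0r subr0. Qed.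

Lemma nrm_qs s : nrm (qs s) = expR (- (complex.Re s * ln q)).
Proof.
by rewrite qsE nrm_cexp addr0 -rcN cRe_rcM mulNr mulrC.
Qed.

(** Characters need not be unitary, so the half-plane of convergence depends on |chi(varpi)|. The
    choice of sigma rests on exp(x) >= 1 + x > x. *)
Lemma qs_small (al : C R) : exists sigma : R, forall s, sigma < complex.Re s ->
  nrm (al * qs s) < 1.
Proof.
exists (nrm al / ln q) => s; rewrite ltr_pdivrMr ?lnq_gt0 // => h.
rewrite nrmM nrm_qs expRN (ltr_pdivrMr _ _ (expR_gt0 _)) mul1r.
apply: (lt_trans h).
by have := expR_ge1Dx (complex.Re s * ln q); apply: lt_le_trans; rewrite ltrDr.
Qed.

Lemma mero_zform M d n l c b al : meromorphic (fun s => zform M d n l c b al (qs s)).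
Proof.
have mq := mero_qs.
apply: mero_add.
  apply: mero_sum => i; case: (_ %| M + _ - _)%Z; last exact: mero_cst.
  by apply: mero_mul; [exact: mero_cst|exact: mero_expz].
have mal : meromorphic (fun s => al * qs s) by apply: mero_mul => //; exact: mero_cst.
apply: mero_mul.
  by apply: mero_mul; [exact: mero_cst|exact: mero_expz].
apply: mero_inv; apply: mero_add; first exact: mero_cst.
by apply: mero_opp; exact: mero_exprn.
Qed.

(** If the function vanished around s0, then |al q^-s| would be 1 both at s0 + r/2 and at s0 + r/4,
    although it is strictly monotone in the real part when al != 0. *)
Lemma ae_denominator n (al : C R) : (0 < n)%N -> ae (fun s => 1 - (al * qs s) ^+ n != 0).
Proof.
move=> n0 s0.
have mf : meromorphic (fun s => 1 - (al * qs s) ^+ n).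
  apply: mero_add; first exact: mero_cst.
  apply: mero_opp; apply: mero_exprn; apply: mero_mul mero_qs; exact: mero_cst.
have [/dnear_nrmP[r r0 h]|//] := mero_zero s0 mf.
have step (e : R) : 0 < e < r -> nrm al * expR (- ((complex.Re s0 + e) * ln q)) = 1.
  move=> /andP[e0 er].
  have := h (s0 + rc e).
  rewrite -subr_eq0 addrC addKr rc_eq0 gt_eqF // nrm_rc ger0_norm ?ltW // er.
  move=> /(_ isT isT) /eqP; rewrite subr_eq0 => /eqP.
  move/(congr1 (@nrm R)); rewrite -rc1 nrm_rc normr1 nrmX nrmM nrm_qs cReD /=.
  move=> /esym /eqP; rewrite pexpr_eq1 ?mulr_ge0 ?nrm_ge0 ?expR_ge0 // => /eqP h1; exact: h1.
have e1 := step (r / 2); have e2 := step (r / 4).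
have {}e1 : nrm al * expR (- ((complex.Re s0 + r / 2) * ln q)) = 1 by apply: e1; apply/andP; split; lra.
have {}e2 : nrm al * expR (- ((complex.Re s0 + r / 4) * ln q)) = 1 by apply: e2; apply/andP; split; lra.
have al0 : nrm al != 0 by apply/eqP => al0; move/eqP: e1; rewrite al0 mul0r eq_sym oner_eq0.
have /(mulfI al0)/expR_inj/oppr_inj h1 := etrans e1 (esym e2).
by have := mulIf (lt0r_neq0 lnq_gt0) h1; lra.
Qed.

Section Formula.
Variables (chi : F -> C R) (a : nat) (sc : smooth_character chi a).
Variables (f g : F -> C R) (M m : int) (hf : schwartz_bounds f M m).
Variables (d n l : nat) (n0 : (0 < n)%N) (ln : (l < n)%N).
Hypothesis (mN : m <= M + d%:Z) (dvdN : (n%:Z %| M + d%:Z)%Z).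
Hypothesis (gE : forall x, x != 0 -> g x = f x * beta R n l%:Z x).
Local Notation weight := (weight chi).
Local Notation tail := (@tail F).
Local Notation kappa := (kappa mu chi).
Local Notation coef := (coef mu chi).

Lemma schwartz_lc : loc_const (@nonzero F) f.
Proof.
by case: hf => _ h x _; apply/near_ideal; exists m => y hy; rewrite -(subrK x y) addrC h.
Qed.

Lemma betaE x : x != 0 -> beta R n l%:Z x = if (n%:Z %| vl x - l%:Z)%Z then 1 else 0.
Proof. by move=> x0; rewrite /beta x0 /= eqz_mod_dvd. Qed.

(** The induction peels off shells up to M + d, from where on v(x) >= m gives f(x) = f(0). Since n
    divides M + d and l < n, the first valuation of class l from there on is M + d + l, the starting
    point of the geometric tail. *)
Lemma zform_integral_tail s d' M' : M' + d'%:Z = M + d%:Z ->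
  nrm (chi varpi * qs s) < 1 ->
  let k x := f x * beta R n l%:Z x * weight s x in
  cintegrable mu (tail 1 M') k /\
  cintegral mu (tail 1 M') k =
    zform M' d' n l (coef f) (f 0 * kappa) (chi varpi) (qs s).
Proof.
move=> + small k; elim: d' M' => [|d' IH] M' MN.
  have M'N : M' = M + d%:Z by rewrite -MN addr0.
  have mA : measurable (tail n (M' + l%:Z) : set (borelF F)) by exact: tail_borel.
  have mD : measurable (tail 1 M' : set (borelF F)) by exact: tail_borel.
  have AD : tail n (M' + l%:Z) `<=` tail 1 M'.
    by move=> x [x0 h1 _]; split => //; lia.
  have kA x : tail n (M' + l%:Z) x -> f 0 * weight s x = k x.
    move=> [x0 h1 h2]; rewrite /k betaE //.
    have -> : (n%:Z %| vl x - l%:Z)%Z.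
      have -> : vl x - l%:Z = vl x - (M' + l%:Z) + M' by lia.
      by apply: rpredD => //; rewrite M'N.
    rewrite mulr1; congr (_ * _); case: hf => _ h; rewrite -[in RHS](add0r x) h //.
    by move=> _; lia.
  have k0 x : tail 1 M' x -> ~ tail n (M' + l%:Z) x -> k x = 0.
    move=> [x0 h1 _] nA; rewrite /k betaE //; case: ifP => [dv|]; last by rewrite mulr0 mul0r.
    exfalso; apply: nA.
    have dv' : (n%:Z %| vl x - (M' + l%:Z))%Z.
      have -> : vl x - (M' + l%:Z) = vl x - l%:Z - M' by lia.
      by apply: rpredB => //; rewrite M'N.
    split => //; rewrite leNgt; apply/negP => lt.
    by move: dv'; rewrite dvdzE /= => /dvdn_leq; lia.
  have iw := tailn_integrable hmu hv sc n (M' + l%:Z) small.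
  have [iA eA] := cintegralZ (f 0) mA iw.
  have [iD eD] := cintegral_support mA mD AD k0 (eq_cintegrable mA kA iA).
  split => //; rewrite eD -(eq_cintegral mu kA) eA (tail_integral hmu hv sc _ n0 small).
  by rewrite /zform big_ord0 add0r addr0 !mulrA.
have [|iT eT] := IH (M' + 1); first by rewrite -MN; lia.
have mS : measurable (shell M' : set (borelF F)) by exact: shell_borel.
have mT : measurable (tail 1 (M' + 1) : set (borelF F)) by exact: tail_borel.
have TE : tail 1 M' = shell M' `|` tail 1 (M' + 1).
  apply/seteqP; split=> x.
    move=> [x0 jx _]; have [vj|vj] := eqVneq (vl x) M'; first by left.
    by right; split => //; lia.
  move=> [[x0 vx]|[x0 jx dd]]; split => //; lia.
have dis : shell M' `&` tail 1 (M' + 1) = set0.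
  by apply/seteqP; split=> x // [[_ vx] [_ jx _]]; lia.
pose cM := if (n%:Z %| M' - l%:Z)%Z then qs s ^ M' else 0.
have kS x : shell M' x -> cM * (f x * weight0 chi x) = k x.
  move=> sx; have [x0 vx] := sx; rewrite /k (weight_shell chi s sx) betaE // vx /cM.
  case: ifP => _; rewrite ?(mul0r, mulr0, mulr1) //; ring.
have [iS eS] := cintegralZ cM mS (shell_integrable hmu M' (mul_weight0_lc sc schwartz_lc)).
have {}iS := eq_cintegrable mS kS iS.
have iU : cintegrable mu (tail 1 M') k by rewrite TE; exact: cintegrable_setU.
split => //.
rewrite TE cintegral_setU -?TE // eT -(eq_cintegral mu kS) eS -/(coef f M').
rewrite /zform big_ord_recl addr0 -[RHS]addrA; congr (_ + _).
  by rewrite /cM; case: ifP; rewrite ?mul0r // mulrC.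
have -> : M' + 1 + d'%:Z = M' + d'.+1%:Z by lia.
congr (_ + _); apply: eq_bigr => i _.
by have -> : M' + (lift ord0 i)%:Z = M' + 1 + i%:Z by rewrite /= /bump /=; lia.
Qed.

Lemma zform_integral s : nrm (chi varpi * qs s) < 1 ->
  cintegrable mu [set x : F | x != 0] (zeta_integrand chi g s) /\
  cintegral mu [set x : F | x != 0] (zeta_integrand chi g s) =
    zform M d n l (coef f) (f 0 * kappa) (chi varpi) (qs s).
Proof.
move=> small; have [iT eT] := zform_integral_tail (erefl _) small.
have mA : measurable (tail 1 M : set (borelF F)) by exact: tail_borel.
have mD : measurable ([set x : F | x != 0] : set (borelF F)).
  by apply: open_borelF; exact: open_nonzero.
have AD : tail 1 M `<=` [set x : F | x != 0] by move=> x [].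
pose k x := f x * beta R n l%:Z x * weight s x.
have k0 x : [set x : F | x != 0] x -> ~ tail 1 M x -> k x = 0.
  move=> /= x0 nT; rewrite /k; have [->|fx] := eqVneq (f x) 0; first by rewrite !mul0r.
  exfalso; apply: nT; split => //.
  by case: hf => h _; exact: h.
have kE x : [set x : F | x != 0] x -> k x = zeta_integrand chi g s x.
  by move=> x0; rewrite zeta_integrandE gE.
have [iD eD] := cintegral_support mA mD AD k0 iT.
split; first exact: eq_cintegrable mD kE iD.
by rewrite -(eq_cintegral mu kE) eD eT.
Qed.

(** [zform] witnesses that [zeta_continuation] is inhabited, so [zeta] is one of its elements; both
    equal the integral on a common half-plane. *)
Lemma zeta_formula : meromorphic (zeta mu chi g) /\
  ae (fun s => zeta mu chi g s = zform M d n l (coef f) (f 0 * kappa) (chi varpi) (qs s)).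
Proof.
pose Z s := zform M d n l (coef f) (f 0 * kappa) (chi varpi) (qs s).
have [sigma hs] := qs_small (chi varpi).
have mZ : meromorphic Z by exact: mero_zform.
have ZP : zeta_continuation mu chi g Z.
  by split => //; exists sigma => s /hs /zform_integral[].
have [mz [tau ht]] : zeta_continuation mu chi g (zeta mu chi g).
  by apply: xgetPex; exists Z.
split => //; apply: (@mero_identity _ _ _ (Num.max sigma tau)) => // s.
rewrite gt_max => /andP[/hs/zform_integral[_ <-] /ht[_ ->]]; exact: erefl.
Qed.

End Formula.
End ZetaFormula.

(** * Fourier transform and the gamma factor *)

Section Fourier.
Variables (R : realType) (F : padicFieldType).
Variables (mu : {measure set (borelF F) -> \bar R}) (hmu : haar_measure mu).
Variables (psi : F -> C R) (hpsi : add_character psi) (hnt : exists x : F, psi x != 1).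
Implicit Types (f g chi : F -> C R) (x y : F) (M m : int).
Local Notation q := ((residue_card F)%:R : R).
Local Notation e := (add_conductor psi).

Lemma psiD x y : psi (x + y) = psi x * psi y.
Proof. by case: hpsi. Qed.

Lemma psi_trivial x : idealP e x -> psi x = 1.
Proof. by case: (add_conductorP hpsi hnt) => h _; exact: h. Qed.

Lemma psi_nontrivial m x : ~ idealP (e - m) x -> exists2 u, idealP m u & psi (x * u) != 1.
Proof.
move=> hx; have [w w0 vw] := @vl_surj F; have hw : uniformizer w by [].
have [_ h] := add_conductorP hpsi hnt.
have wm := vl_varpiX hw m; have wm0 := varpiX_neq0 hw m.
have [|u u0 pu] := h (w ^ m * x).
  by move=> h1; apply: hx; apply/(@idealMz _ (e - m) m (w ^ m)); rewrite ?subrK.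
exists (w ^ m * u); last by rewrite mulrA [x * _]mulrC.
by have := (@idealMz _ 0 m (w ^ m) u wm0 wm).2 u0; rewrite add0r.
Qed.

Lemma bounds_lc f M m : schwartz_bounds f M m -> loc_const setT f.
Proof.
by case=> _ h x _; apply/near_ideal; exists m => y hy; rewrite -(subrK x y) addrC h.
Qed.

Lemma psi_mul_lc x : loc_const setT (fun y => psi (x * y)).
Proof.
move=> y _; apply/near_ideal; have [->|x0] := eqVneq x 0.
  by exists 0 => z _; rewrite !mul0r.
exists (e - vl x) => z hz.
rewrite -(subrK y z) mulrDr psiD psi_trivial ?mul1r //.
by have := (@idealMz _ (e - vl x) (vl x) x (z - y) x0 erefl).2 hz; rewrite subrK.
Qed.

Lemma compact_coset0 m : compact (coset (0 : F) m).
Proof. by rewrite coset0E; exact: compact_ideal. Qed.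

Lemma fourier_integrable f M m x : schwartz_bounds f M m ->
  cintegrable mu setT (fun y => f y * psi (x * y)).
Proof.
move=> hf; have lf := bounds_lc hf; case: hf => hM _.
have lc := loc_const_comp2 (fun u v => u * v) lf (psi_mul_lc x).
have iA : cintegrable mu (coset (0 : F) M) (fun y => f y * psi (x * y)).
  apply: cintegrable_compact => //; [exact: open_coset|exact: compact_coset0|].
  exact: loc_constS (@subsetT _ _) lc.
have k0 y : setT y -> ~ coset (0 : F) M y -> f y * psi (x * y) = 0.
  move=> _ ny; have [->|fy] := eqVneq (f y) 0; first by rewrite mul0r.
  by exfalso; apply: ny; rewrite /coset /= subr0; exact: hM.
by have [] := cintegral_support (measurable_coset 0 M) measurableT (@subsetT _ _) k0 iA.
Qed.

Lemma fourier_translate f M m x u : schwartz_bounds f M m -> idealP m u ->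
  psi (x * u) * fourier mu psi f x = fourier mu psi f x.
Proof.
move=> hf hu; have fi := fourier_integrable x hf.
have o0 := oner_neq0 F.
have [_] := cintegral_affine hmu u o0 measurableT fi.
rewrite preimage_setT vl1 expr0z rc1 mul1r => eA.
rewrite {2}/fourier -eA.
have [_ <-] := cintegralZ (psi (x * u)) measurableT fi.
apply: eq_cintegral => y _ /=; case: hf => _ h.
by rewrite /affine mul1r h // mulrDr psiD; ring.
Qed.

(** Support: by [fourier_translate] multiplication by psi(xu), for u in P^m, does not change the
    transform at x, which is therefore 0 as soon as some psi(xu) != 1. Period: psi(hy) = 1 for h in
    P^(e - M) and y in the support of f. *)
Lemma fourier_bounds f M m : schwartz_bounds f M m ->
  schwartz_bounds (fourier mu psi f) (e - m) (e - M).
Proof.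
move=> hf; split=> [x|x h hh].
  apply: contraNP => /psi_nontrivial[u um pu]; apply/eqP.
  have /eqP := fourier_translate x hf um.
  rewrite -subr_eq0 -{2}[fourier _ _ _ _]mul1r -mulrBl mulf_eq0 subr_eq0.
  by rewrite (negbTE pu) => /eqP.
apply: eq_cintegral => y _; have [->|fy] := eqVneq (f y) 0; first by rewrite !mul0r.
congr (_ * _); rewrite mulrDl psiD [psi (h * y)]psi_trivial ?mulr1 //.
by case: hf => hM _; have := idealM hh (hM y fy); rewrite subrK.
Qed.

Definition ind (c : F) m : F -> C R := fun x => if `[< coset c m x >] then 1 else 0.

Lemma ind_in c m x : coset c m x -> ind c m x = 1.
Proof. by move=> h; rewrite /ind asboolT. Qed.

Lemma ind_out c m x : ~ coset c m x -> ind c m x = 0.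
Proof. by move=> h; rewrite /ind asboolF. Qed.

Lemma ind_bounds c M m : idealP M c -> M <= m -> schwartz_bounds (ind c m) M m.
Proof.
move=> hc Mm; split=> [x|x h hh].
  rewrite /ind; case: asboolP => [hx _|_]; last by rewrite eqxx.
  by have := idealD (ideal_le Mm hx) hc; rewrite subrK.
congr (if _ then _ else _); apply: asbool_equiv_eq; rewrite /coset /=.
have -> : x + h - c = (x - c) + h by rewrite addrAC.
exact: iff_sym (ideal_shift (x - c) hh).
Qed.

(** For x in P^(e - m) the integrand is constant on c + P^m; for other x the transform is 0 by
    [fourier_bounds]. *)
Lemma fourier_ind c M m x : idealP M c -> M <= m ->
  idealP (e - m) x -> fourier mu psi (ind c m) x = rc (vol mu m) * psi (x * c).
Proof.
move=> hc Mm hx.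
have mu_fin : (mu (coset c m) < +oo)%E by rewrite mu_coset // ltry.
pose k (y : F) := ind c m y * psi (x * y).
have kA y : coset c m y -> (fun=> psi (x * c)) y = k y.
  move=> hy; rewrite /k ind_in // mul1r -[in RHS](subrK c y) mulrDr psiD.
  by rewrite [psi (x * (y - c))]psi_trivial ?mul1r //; have := idealM hx hy; rewrite subrK.
have k0 y : setT y -> ~ coset c m y -> k y = 0.
  by move=> _ hy; rewrite /k ind_out // mul0r.
have iT := fourier_integrable x (ind_bounds hc Mm).
have iA : cintegrable mu (coset c m) k.
  exact: (cintegrableS (measurable_coset c m) measurableT (@subsetT _ _) iT).
have [_] := cintegral_support (measurable_coset c m) measurableT (@subsetT _ _) k0 iA.
rewrite /fourier => ->; rewrite -(eq_cintegral mu kA) cintegral_cst //; last exact: measurable_coset.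
by rewrite mu_coset.
Qed.

End Fourier.

(** * Effect of x -> -x on zeta functions *)

Section Reflection.
Variables (R : realType) (F : padicFieldType).
Variables (mu : {measure set (borelF F) -> \bar R}) (hmu : haar_measure mu).
Variables (chi : F -> C R) (a : nat) (sc : smooth_character chi a).
Implicit Types (f : F -> C R).

Lemma bounds_neg f M m : schwartz_bounds f M m -> schwartz_bounds (fun x => f (- x)) M m.
Proof.
move=> [h1 h2]; split=> [x /h1 /idealN|x h hh]; first by rewrite opprK.
by rewrite opprD h2 //; exact: idealN.
Qed.

Lemma N1_neq0 : -1 != 0 :> F. Proof. by rewrite oppr_eq0 oner_neq0. Qed.

Lemma coef_neg f M m j : schwartz_bounds f M m ->
  coef mu chi (fun x => f (- x)) j = chi (-1) * coef mu chi f j.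
Proof.
move=> hf; have lf : loc_const (@nonzero F) f by exact: loc_constS (@subsetT _ _) (bounds_lc hf).
have := coef_scale hmu sc j N1_neq0 lf.
rewrite vlN vl1 addr0 => ->; rewrite mulrA (smoothN1 sc) mul1r.
by apply: eq_cintegral => x _; rewrite mulN1r.
Qed.

(** When chi(-1) != 1 this forces [kappa] to be 0. It lets the tail of [zform] absorb the factor
    chi(-1), although f(0) is unchanged by the reflection. *)
Lemma kappa_neg : kappa mu chi = chi (-1) * kappa mu chi.
Proof.
have := coef_scale hmu sc 0 N1_neq0 (@loc_const_cst _ _ (1 : C R) (@nonzero F)).
by rewrite vlN vl1 addr0.
Qed.

Lemma zform_neg f M m (M' : int) d n l (al Y : C R) : schwartz_bounds f M m ->
  zform M' d n l (coef mu chi (fun x => f (- x))) (f (- 0) * kappa mu chi) al Y =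
  chi (-1) * zform M' d n l (coef mu chi f) (f 0 * kappa mu chi) al Y.
Proof.
move=> hf; rewrite /zform mulrDr mulr_sumr; congr (_ + _).
  apply: eq_bigr => i _; case: ifP => _; last by rewrite mulr0.
  by rewrite (coef_neg _ hf) mulrA.
by rewrite oppr0 !mulrA [chi (-1) * f 0]mulrC -[f 0 * chi _ * _]mulrA -kappa_neg.
Qed.

End Reflection.

(** * Functional equation and explicit gamma factor *)

Section Gamma.
Variables (R : realType) (F : padicFieldType).
Variables (mu : {measure set (borelF F) -> \bar R}).
Variables (psi : F -> C R) (hpsi : add_character psi) (hnt : exists x : F, psi x != 1).
Variables (hsd : self_dual_measure mu psi).
Variables (varpi : F) (hv : uniformizer varpi).
Implicit Types (f g chi : F -> C R) (x y : F) (M m : int) (s : C R).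
Local Notation q := ((residue_card F)%:R : R).
Local Notation e := (add_conductor psi).
Local Notation qs := (@qpowN R F).

Let hmu : haar_measure mu. Proof. by case: hsd. Qed.

Definition ztotal chi f M d (Y : C R) :=
  zform M d 1 0 (coef mu chi f) (f 0 * kappa mu chi) (chi varpi) Y.

Lemma zeta_total chi a f M m d : smooth_character chi a -> schwartz_bounds f M m ->
  m <= M + d%:Z -> meromorphic (zeta mu chi f) /\
  ae (fun s => zeta mu chi f s = ztotal chi f M d (qs s)).
Proof.
move=> sc hf md.
have gE x : x != 0 -> f x = f x * beta R 1 0%N x.
  by move=> x0; rewrite betaE // dvd1z mulr1.
exact: (zeta_formula hmu hv sc hf (isT : (0 < 1)%N) (isT : (0 < 1)%N) md (dvd1z _) gE).
Qed.

Lemma depth M m : exists d : nat, m <= M + d%:Z.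
Proof. by exists `|m - M|%N; lia. Qed.

Lemma zeta_reflect chi a f : smooth_character chi a -> schwartz f ->
  ae (fun s => zeta mu chi (fun x => f (- x)) s = chi (-1) * zeta mu chi f s).
Proof.
move=> sc /schwartzP[M [m hf]]; have [d hd] := depth M m.
have [_ h1] := zeta_total sc hf hd; have [_ h2] := zeta_total sc (bounds_neg hf) hd.
by apply: aeS2 h1 h2 => s -> ->; rewrite /ztotal (zform_neg hmu sc _ _ _ _ _ _ hf).
Qed.

Lemma ae_reflect (P : C R -> Prop) : ae P -> ae (fun s => P (1 - s)).
Proof.
have n1 : -1 != 0 :> C R by rewrite oppr_eq0 oner_neq0.
by move/(@ae_affine _ _ 1 _ n1); apply: aeS => s; rewrite mulN1r.
Qed.

Lemma schwartz_fourier f : schwartz f -> schwartz (fourier mu psi f).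
Proof.
move=> /schwartzP[M [m hf]]; apply/schwartzP; exists (e - m), (e - M).
exact: fourier_bounds.
Qed.

Section FixCharacter.
Variables (chi : F -> C R) (a : nat) (sc : smooth_character chi a).
Variables (gamma : C R -> C R) (hgamma : tate_gamma mu psi chi gamma).
Let sci := smooth_inv sc.

Lemma char_invN1 : char_inv chi (-1) = chi (-1).
Proof.
have h := smoothN1 sc; have c0 : chi (-1) != 0.
  by case: (sc) => _ h0 _ _; apply: h0; exact: N1_neq0.
by apply: (mulfI c0); rewrite h /char_inv divff.
Qed.

(** The property of [gamma] is used for the transform of f, whose own transform is f(-x) by
    self-duality; undoing the reflection costs chi(-1). *)
Lemma functional_equation f : schwartz f ->
  ae (fun s => gamma s * zeta mu chi (fourier mu psi f) s =
    chi (-1) * zeta mu (char_inv chi) f (1 - s)).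
Proof.
move=> sf; case: hgamma => _ /(_ _ (schwartz_fourier sf)) [_ _ h].
have ff : fourier mu psi (fourier mu psi f) = (fun x => f (- x)).
  by apply/funext => x; case: hsd => _ /(_ _ sf).
rewrite ff in h.
apply: aeS2 h (ae_reflect (zeta_reflect sci sf)) => s <- ->.
by rewrite char_invN1.
Qed.

Lemma kappa_unramified (chi' : F -> C R) : unramified chi' ->
  kappa mu chi' = rc (fine (mu (@shell F 0))) /\ fine (mu (@shell F 0)) != 0.
Proof.
move=> un; have fin : (mu (@shell F 0) < +oo)%E.
  by case: hmu => _ h _; apply: h; exact: compact_shell.
have pos : (0%R < mu (@shell F 0))%E.
  case: hmu => _ _; apply; first exact: open_shell.
  by exists 1; split; rewrite ?oner_neq0 // vl1.
split; last first.
  by apply: lt0r_neq0; apply: fine_gt0; rewrite pos fin.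
rewrite /kappa /coef -[RHS]mulr1 -cintegral_cst //; last exact: shell_borel.
apply: eq_cintegral => x sx; rewrite mul1r /weight0 (normF_shell R sx).
by case: sx => x0 vx; rewrite un // oppr0 expr0z invr1 mul1r.
Qed.

(** The transform of the indicator of the integers is a multiple of the indicator of P^e. Both zeta
    functions are bare geometric tails (d = 0), and [gamma] is their quotient. *)
Lemma gamma_unramified : unramified chi ->
  ae (fun s => gamma s = rc (vol mu 0) * ((chi varpi)^-1 * qs (1 - s)) ^ e *
    (1 - chi varpi * qs s) / (1 - (chi varpi)^-1 * qs (1 - s))).
Proof.
move=> un; have uni : unramified (char_inv chi) by apply/unramified_inv.
have b0 : schwartz_bounds (ind R (0 : F) 0) 0 0 by apply: ind_bounds => //; exact: ideal0.
have s0 : schwartz (ind R (0 : F) 0) by apply/schwartzP; exists 0, 0.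
have b1 := fourier_bounds hmu hpsi hnt b0; rewrite subr0 in b1.
have [k1 k10] := kappa_unramified un; have [k2 k20] := kappa_unramified uni.
set K := rc (fine _) in k1 k2; have K0 : K != 0 by rewrite rc_eq0.
have [_ h1] := zeta_total sc b0 (isT : 0 <= 0 + 0%:Z :> int).
have ee : e <= e + 0%:Z by rewrite addr0.
have [_ h2] := zeta_total sci b1 ee.
have z1 Y : ztotal chi (ind R (0 : F) 0) 0 0 Y = K / (1 - chi varpi * Y).
  rewrite /ztotal /zform big_ord0 add0r k1 ind_in ?mul1r ?expr0z ?mulr1 ?expr1 //.
  by rewrite /coset /= subrr; exact: ideal0.
have z2 Y : ztotal (char_inv chi) (fourier mu psi (ind R (0 : F) 0)) e 0 Y =
    rc (vol mu 0) * K * ((chi varpi)^-1 * Y) ^ e / (1 - (chi varpi)^-1 * Y).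
  rewrite /ztotal /zform big_ord0 add0r k2 !addr0 expr1.
  rewrite (fourier_ind hmu hpsi hnt (M := 0)) //; [|exact: ideal0|exact: ideal0].
  by rewrite mul0r add_character0 // mulr1.
case: hgamma => _ /(_ _ s0) [_ _ h].
have d1 := ae_denominator F (chi varpi) (isT : (0 < 1)%N).
have d2 := ae_reflect (ae_denominator F (chi varpi)^-1 (isT : (0 < 1)%N)).
have key := ae_and (ae_and h1 (ae_reflect h2)) (ae_and d1 d2).
apply: aeS2 key h => s [[-> ->] []]; rewrite !expr1 z1 z2 => n1 n2 E.
apply: (mulIf (mulf_neq0 K0 (invr_neq0 n1))); rewrite -E.
move: n2; set ai := (chi varpi)^-1 * _; set A := ai ^ e => n2.
by field; rewrite n1 n2.
Qed.

Section Ramified.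
Hypothesis ram : ~ unramified chi.
Local Notation c := (mul_conductor chi).

Let c1 : (1 <= c)%N. Proof. by case: (mul_conductorP sc ram). Qed.
Let triv : trivial_on_units chi c. Proof. by case: (mul_conductorP sc ram). Qed.

Lemma idealP1 : idealP 0 (1 : F).
Proof. by apply/idealE; rewrite ?oner_neq0 // vl1. Qed.

Let b0 : schwartz_bounds (ind R (1 : F) c%:Z) 0 c%:Z.
Proof. by apply: ind_bounds => //; exact: idealP1. Qed.

Lemma coset1_shell x : coset 1 c%:Z x -> shell 0 x.
Proof. by move=> h; apply: (@unit_near1 _ c%:Z) => //; lia. Qed.

Lemma ztotal_head (chi' : F -> C R) f M d (Y : C R) : kappa mu chi' = 0 ->
  (forall i, (0 < i)%N -> (i < d.+1)%N -> coef mu chi' f (M + i%:Z) = 0) ->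
  ztotal chi' f M d.+1 Y = coef mu chi' f M * Y ^ M.
Proof.
move=> k0 h; rewrite /ztotal /zform k0 mulr0 !mul0r addr0 big_ord_recl /= dvd1z !addr0.
rewrite big1 ?addr0 // => i _; rewrite dvd1z h ?mul0r //.
by rewrite /= /bump /= add1n ltnS.
Qed.

Lemma ztotal_ind1 (chi' : F -> C R) a' Y : smooth_character chi' a' -> kappa mu chi' = 0 ->
  trivial_on_units chi' c ->
  ztotal chi' (ind R (1 : F) c%:Z) 0 c Y = rc (vol mu c%:Z).
Proof.
move=> sc' k0 tr; rewrite -(prednK c1) ztotal_head ?prednK //; last first.
  move=> i i0 _; rewrite add0r /coef -(cintegral0 mu (@shell_borel F i%:Z)).
  apply: eq_cintegral => x [x0 vx]; rewrite ind_out ?mul0r // => /coset1_shell[_].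
  by rewrite vx; lia.
rewrite expr0z mulr1 /coef.
have sub : coset (1 : F) c%:Z `<=` shell 0 by exact: coset1_shell.
pose k x := ind R (1 : F) c%:Z x * weight0 chi' x.
have kA x : coset (1 : F) c%:Z x -> (fun=> 1 : C R) x = k x.
  move=> hx; rewrite /k ind_in // mul1r /weight0 (normF_shell R (sub _ hx)).
  by rewrite tr // oppr0 expr0z invr1 mul1r.
have fin : (mu (coset (1%R : F) c%:Z) < +oo)%E by rewrite (mu_coset hmu) ltry.
have lc : loc_const (@nonzero F) (ind R (1 : F) c%:Z).
  exact: loc_constS (@subsetT _ _) (bounds_lc b0).
have iS := shell_integrable hmu 0 (mul_weight0_lc sc' lc).
have iA := cintegrableS (measurable_coset 1 c%:Z) (@shell_borel F 0) sub iS.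
have k0' x : shell 0 x -> ~ coset (1 : F) c%:Z x -> k x = 0.
  by move=> _ nx; rewrite /k ind_out // mul0r.
have [_ ->] := cintegral_support (measurable_coset 1 c%:Z) (@shell_borel F 0) sub k0' iA.
rewrite -(eq_cintegral mu kA) cintegral_cst ?mulr1 //; last exact: measurable_coset.
by rewrite (mu_coset hmu).
Qed.

(* Only one shell contributes to the Gauss sum: on any other shell meeting the
   support, some unit u fixes psi but not chi. *)
Lemma coef_fourier_ind i : (0 < i)%N -> (i < c)%N ->
  coef mu (char_inv chi) (fourier mu psi (ind R (1 : F) c%:Z)) (e - c%:Z + i%:Z) = 0.
Proof.
move=> i0 ic; have [_ _ hmin] := mul_conductorP sc ram.
(* Minimality of the conductor gives u in 1 + P^(c-i) with chi(u) != 1. For x of valuation e - c + i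
   the product (u - 1) x lies in P^e, hence psi(ux) = psi(x). *)
have [||u hu cu] := hmin (c - i)%N; [by rewrite subn_gt0|by rewrite ltn_subrL i0|].
have u_unit : shell 0 u by apply: unit_near1 hu; rewrite lez_nat subn_gt0.
have [u0 vu] := u_unit; set j := e - c%:Z + i%:Z.
set ft := fourier mu psi _.
have lf : loc_const (@nonzero F) ft.
  exact: loc_constS (@subsetT _ _) (bounds_lc (fourier_bounds hmu hpsi hnt b0)).
have := coef_scale hmu sci j u0 lf; rewrite vu addr0.
have -> : coef mu (char_inv chi) (fun x => ft (u * x)) j = coef mu (char_inv chi) ft j.
  apply: eq_cintegral => x sx; congr (_ * _).
  have jx : idealP j x by case: sx => x0 vx; apply/idealE; rewrite ?vx.
  have hx : idealP (e - c%:Z) x by apply: ideal_le jx; rewrite /j; lia.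
  have hux : idealP (e - c%:Z) (u * x).
    by apply: ideal_le ((@idealMz _ j 0 u x u0 vu).2 jx); rewrite /j; lia.
  have f1 y : idealP (e - c%:Z) y -> ft y = rc (vol mu c%:Z) * psi (y * 1).
    by move=> hy; rewrite /ft (fourier_ind hmu hpsi hnt (M := 0)) //; exact: idealP1.
  rewrite !f1 // !mulr1; congr (_ * _).
  have -> : u * x = x + (u - 1) * x by rewrite mulrBl mul1r addrC subrK.
  rewrite (psiD hpsi) [psi (_ * x)](psi_trivial hpsi hnt) ?mulr1 //.
  by apply: ideal_le (idealM hu jx); rewrite /j; lia.
move=> /eqP; rewrite eq_sym -subr_eq0 -{2}[coef _ _ _ _]mul1r -mulrBl mulf_eq0.
rewrite subr_eq0 /char_inv invr_eq1 (negbTE cu) => /eqP; exact.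
Qed.

(** For the indicator of 1 + P^c the zeta function is a constant V, and that of its transform is a
    single monomial with a Gauss sum W as coefficient. *)
Lemma gamma_ramified : exists2 G : C R, G != 0 &
  ae (fun s => gamma s = G * qs (1 - s) ^ (e - c%:Z)).
Proof.
have rami : ~ unramified (char_inv chi) by move/unramified_inv.
have k1 := kappa_ramified hmu sc ram; have k2 := kappa_ramified hmu sci rami.
have b1 := fourier_bounds hmu hpsi hnt b0; rewrite subr0 in b1.
pose phi := ind R (1 : F) c%:Z; have sphi : schwartz phi.
  by apply/schwartzP; exists 0, c%:Z.
have trivi : trivial_on_units (char_inv chi) c.
  by move=> x /triv; rewrite /char_inv => ->; rewrite invr1.
have cc : c%:Z <= 0 + c%:Z by rewrite add0r.
have ec : e <= e - c%:Z + c%:Z by rewrite subrK.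
have [_ h1] := zeta_total sc b0 cc.
have [_ h2] := zeta_total sci b1 ec.
have [_ h3] := zeta_total sci b0 cc.
pose V := rc (vol mu c%:Z) : C R.
have V0 : V != 0 by rewrite rc_eq0 gt_eqF // (vol_gt0 hmu).
pose W := coef mu (char_inv chi) (fourier mu psi phi) (e - c%:Z).
have z1 Y : ztotal chi phi 0 c Y = V by exact: ztotal_ind1 sc k1 triv.
have z3 Y : ztotal (char_inv chi) phi 0 c Y = V by exact: ztotal_ind1 sci k2 trivi.
have z2 Y : ztotal (char_inv chi) (fourier mu psi phi) (e - c%:Z) c Y = W * Y ^ (e - c%:Z).
  rewrite -[in LHS](prednK c1) ztotal_head ?prednK // => i i0 ic.
  exact: coef_fourier_ind.
case: hgamma => _ /(_ _ sphi) [_ _ h].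
have g : ae (fun s => gamma s = W / V * qs (1 - s) ^ (e - c%:Z)).
  apply: aeS2 h (ae_and h1 (ae_reflect h2)) => s E [e1 e2].
  have E' : W * qs (1 - s) ^ (e - c%:Z) = gamma s * V by rewrite -z2 -e2 E e1 z1.
  by apply: (mulIf V0); rewrite -E' [RHS]mulrAC divfK.
(* If W were 0, [gamma] would vanish, and the functional equation of the same test function would
   read 0 = chi(-1) V at some point near 0. *)
exists (W / V) => //; rewrite mulf_neq0 ?invr_neq0 //; apply/eqP => W0.
have all := ae_and g (ae_and (functional_equation sphi) (ae_reflect h3)).
have [s [gs [fs e3]]] := @filter_ex _ _ (Proper_dnbhs_numFieldType (0 : C R)) _ (all 0).
move: fs; rewrite e3 gs W0 !mul0r z3 => /esym/eqP.
rewrite mulf_eq0 (negbTE V0) orbF.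
by case: (sc) => _ h0 _ _; apply/negP/h0; exact: N1_neq0.
Qed.

End Ramified.
End FixCharacter.
End Gamma.

(** * Splitting the functional equation *)

Section FiniteFourier.
Variables (K : numFieldType) (n : nat) (w : K).
Hypotheses (n0 : (0 < n)%N) (wn : w ^+ n = 1).
Hypothesis (wprim : forall t : int, ~~ (n%:Z %| t)%Z -> w ^ t != 1).

Lemma root_neq0 : w != 0.
Proof. by apply: contraTneq n0 => w0; move/eqP: wn; rewrite w0 expr0n; case: n => //= ?; rewrite eq_sym oner_eq0. Qed.

Lemma root_dvd (u : K) (t : int) : u ^+ n = 1 -> (n%:Z %| t)%Z -> u ^ t = 1.
Proof. by move=> un /dvdzP[k ->]; rewrite mulrC -exprz_exp -exprnP un exp1rz. Qed.

Lemma sum_root (t : int) :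
  \sum_(j < n) (w ^ t) ^+ j = if (n%:Z %| t)%Z then n%:R else 0.
Proof.
case: ifP => [nt|/negbT nt].
  rewrite (root_dvd wn nt); under eq_bigr do rewrite expr1n.
  by rewrite sumr_const card_ord.
have := subrX1 (w ^ t) n.
have -> : (w ^ t) ^+ n = 1.
  by rewrite exprnP exprz_exp mulrC -exprz_exp -exprnP wn exp1rz.
rewrite subrr => /esym/eqP; rewrite mulf_eq0 subr_eq0 (negbTE (wprim nt)) /=.
by move/eqP.
Qed.

Lemma sum_residue (f : nat -> K) (t : int) :
  \sum_(l < n) (if (n%:Z %| t - l%:Z)%Z then f l else 0) = f `|(t %% n%:Z)%Z|%N.
Proof.
have nz : n%:Z != 0 by rewrite eqz_nat -lt0n.
have hr := modz_ge0 t nz; have hl := ltz_pmod t (n0 : 0 < n%:Z).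
set r := (t %% n%:Z)%Z in hr hl *.
have rn : (`|r| < n)%N by lia.
have dvdE (l : nat) : (l < n)%N -> (n%:Z %| t - l%:Z)%Z = (l == `|r|%N).
  move=> ln; rewrite -eqz_mod_dvd -/r [(l%:Z %% _)%Z]modz_small; last by lia.
  by apply/eqP/eqP; lia.
rewrite (bigD1 (Ordinal rn)) //= dvdE // eqxx big1 ?addr0 // => l hne.
rewrite dvdE //; case: eqP => // e; case/eqP: hne; exact: val_inj.
Qed.

(* Extracting the Fourier coefficient of index k along the powers of w. *)
Lemma dft_convolution (Rl Sl th : nat -> K) (E : int) (k : nat) : (k < n)%N ->
  (forall j : 'I_n, \sum_(l < n) (w ^ l%:Z) ^+ j * Rl l =
     (\sum_(m < n) (w ^ (m%:Z + E)) ^+ j * th m) *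
     (\sum_(l < n) (w ^ (- l%:Z)) ^+ j * Sl l)) ->
  Rl k = \sum_(m < n) th m * Sl `|((m%:Z + E - k%:Z) %% n%:Z)%Z|%N.
Proof.
move=> kn H; have nK : n%:R != 0 :> K by rewrite pnatr_eq0 -lt0n.
have w0 := root_neq0.
apply: (mulfI nK).
have L : n%:R * Rl k = \sum_(j < n) (w ^ (- k%:Z)) ^+ j * \sum_(l < n) (w ^ l%:Z) ^+ j * Rl l.
  under eq_bigr do rewrite mulr_sumr.
  rewrite exchange_big /=.
  transitivity (\sum_(l < n) (if (n%:Z %| k%:Z - l%:Z)%Z then n%:R * Rl l else 0)).
    by rewrite (sum_residue (fun l => n%:R * Rl l)) modz_small ?absz_nat //; lia.
  apply: eq_bigr => l _.
  have -> : k%:Z - l%:Z = - (- k%:Z + l%:Z) by lia.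
  rewrite rpredN.
  transitivity ((\sum_(j < n) (w ^ (- k%:Z + l%:Z)) ^+ j) * Rl l).
    by rewrite sum_root; case: ifP; rewrite ?mul0r.
  rewrite mulr_suml; apply: eq_bigr => j _.
  by rewrite expfzDr // exprMn mulrA.
rewrite L mulr_sumr; under eq_bigr do rewrite H mulr_suml mulr_sumr.
rewrite exchange_big /=; apply: eq_bigr => m _.
under eq_bigr do rewrite mulr_sumr mulr_sumr.
rewrite exchange_big /=.
rewrite mulrCA -(sum_residue (fun l => n%:R * Sl l)) mulr_sumr; apply: eq_bigr => l _.
transitivity ((\sum_(j < n) (w ^ (m%:Z + E - k%:Z - l%:Z)) ^+ j) * (th m * Sl l)).
  rewrite mulr_suml; apply: eq_bigr => j _.
  by rewrite !(expfzDr _ _ w0) !exprMn; ring.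
rewrite sum_root; case: ifP => _; rewrite ?mul0r ?mulr0 //; ring.
Qed.

End FiniteFourier.

(** With n = n' + 1, expand (1 - Q/z)(1 + z + ... + z^(n-1)): degrees 0 to n - 2 have coefficient 1
    - Q, and the term -Q/z of degree -1 belongs to the class of n - 1 modulo n, where it joins
    z^(n-1) to give z^(n-1) (1 - Q/z^n). This is why [theta] singles out m = n - 1. *)
Lemma theta_sum_identity (K : fieldType) (z Q : K) n' : z != 0 -> 1 - z != 0 ->
  1 - z ^+ n'.+1 != 0 ->
  (1 - Q / z) / (1 - z) = (1 - z ^+ n'.+1)^-1 *
    \sum_(m < n'.+1) z ^+ m * (if m == n' :> nat then 1 - Q / z ^+ n'.+1 else 1 - Q).
Proof.
move=> z0 z1 zn; rewrite big_ord_recr /= eqxx.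
have -> : \sum_(i < n') z ^+ i * (if i == n' :> nat then 1 - Q / z ^+ n'.+1 else 1 - Q) =
    (\sum_(i < n') z ^+ i) * (1 - Q).
  by rewrite mulr_suml; apply: eq_bigr => i _; rewrite (ltn_eqF (ltn_ord i)).
have h : (\sum_(i < n') z ^+ i) = (1 - z ^+ n') / (1 - z).
  by rewrite -[1 - z ^+ n']opprB subrX1 -mulNr opprB mulrC mulKf.
have zn0 : z ^+ n' != 0 by rewrite expf_neq0.
rewrite h; move: zn; rewrite exprS; set t := z ^+ n' in zn0 *; move=> zn.
by field; rewrite z0 z1 zn zn0.
Qed.

(** * Decomposition of zeta functions by valuation modulo n *)

Section Split.
Variables (R : realType).
Implicit Types (c : int -> C R) (b al Y u : C R) (M : int).

(** A monomial of degree t in the head belongs to one class l, and u^t = u^l. In the tail 1/(1 - uz)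
    is the sum of the (uz)^l, l < n, divided by 1 - z^n, and u^(M+d) = 1 because n divides M + d. *)
Lemma zform_split M d n c b al Y u : (0 < n)%N -> (n%:Z %| M + d%:Z)%Z ->
  al != 0 -> Y != 0 -> u ^+ n = 1 -> 1 - (al * Y) ^+ n != 0 ->
  zform M d 1 0 c b al (u * Y) = \sum_(l < n) u ^+ l * zform M d n l c b al Y.
Proof.
move=> n0 dvd al0 Y0 un den.
have u0 : u != 0 by exact: root_neq0 n0 un.
rewrite /zform; under [RHS]eq_bigr do rewrite mulrDr mulr_sumr.
rewrite big_split /=; congr (_ + _).
  rewrite exchange_big /=; apply: eq_bigr => i _; rewrite dvd1z.
  set t := M + i%:Z.
  transitivity (\sum_(l < n) (if (n%:Z %| t - l%:Z)%Z then c t * Y ^ t * u ^+ l else 0)).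
    rewrite (sum_residue n0 (fun l => c t * Y ^ t * u ^+ l)).
    have -> : u ^+ `|(t %% n%:Z)%Z| = u ^ t.
      have nz : n%:Z != 0 by rewrite eqz_nat -lt0n.
      have hr := modz_ge0 t nz.
      transitivity (u ^ ((t %/ n%:Z)%Z * n%:Z + (t %% n%:Z)%Z)); last by rewrite -divz_eq.
      rewrite expfzDr // (root_dvd un (dvdz_mull _ (dvdzz _))) mul1r exprnP.
      by congr (_ ^ _); lia.
    by rewrite expfzMl; ring.
  by apply: eq_bigr => l _; case: ifP => _; rewrite ?mulr0 // mulrC.
set z := al * Y in den *; have z0 : z != 0 by rewrite mulf_neq0.
have -> : al * (u * Y) = u * z by rewrite mulrCA.
clearbody z.
have unz : (u * z) ^+ n = z ^+ n by rewrite exprMn un mul1r.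
have den1 : 1 - u * z != 0.
  rewrite subr_eq0; apply: contraNneq den => h.
  by rewrite -unz -h expr1n subrr.
have S : \sum_(l < n) (u * z) ^+ l = (1 - z ^+ n) / (1 - u * z).
  by rewrite -unz -[1 - _ ^+ n]opprB subrX1 -mulNr opprB mulrAC divff ?mul1r.
transitivity (b * z ^ (M + d%:Z) / (1 - z ^+ n) * \sum_(l < n) (u * z) ^+ l).
  rewrite S expr1 addr0 expfzMl (root_dvd un dvd) mul1r.
  by field; rewrite den den1.
rewrite mulr_sumr; apply: eq_bigr => l _.
by rewrite [z ^ (_ + l%:Z)]expfzDr // exprMn -[z ^ l%:Z]exprnP; ring.
Qed.

End Split.

Lemma exprz_expn_comm (K : fieldType) (w : K) (t : int) (j : nat) :
  (w ^ t) ^+ j = (w ^+ j) ^ t.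
Proof. by rewrite !exprnP !exprz_exp mulrC. Qed.

(** * Translations of s that multiply q^-s by a root of unity *)

Section RootShift.
Variables (R : realType) (F : padicFieldType).
Local Notation q := ((residue_card F)%:R : R).
Local Notation qs := (@qpowN R F).

Lemma cos_lt1 (x : R) : 0 < x < 2 * pi -> cos x != 1.
Proof.
move=> /andP[x0 x2]; have s0 : 0 < sin (x / 2).
  by apply: sin_gt0_pi; apply/andP; split; lra.
have -> : x = x / 2 *+ 2 by lra.
rewrite cos_mulr2n cos2sin2; apply/eqP => h.
have : 0 < sin (x / 2) ^+ 2 by rewrite exprn_gt0.
by lra.
Qed.

(* c = 2 i pi / (n ln q) *)
Lemma root_shift n : (0 < n)%N -> exists c : C R,
  qs c ^+ n = 1 /\ forall t : int, ~~ (n%:Z %| t)%Z -> qs c ^ t != 1.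
Proof.
move=> n0; have nR : n%:R != 0 :> R by rewrite pnatr_eq0 -lt0n.
have lq := lt0r_neq0 (lnq_gt0 R F).
pose w (x : R) : C R := cexp (ic R * rc x).
have wE x : w x = (Complex (cos x) (sin x) : C R).
  by rewrite /w /cexp /ic /rc /=; simpc => /=; rewrite expR0 !mul1r.
(* The sign cancels that of the exponent in q^-s, so that [qs c] is exp(2 i pi / n). *)
pose c := - (ic R * rc (2 * pi / n%:R / ln q)).
have qc : qs c = w (2 * pi / n%:R).
  rewrite qsE addr0 /c mulrNN mulrCA -rcM; congr (cexp (_ * rc _)).
  by field; rewrite lq nR.
have wX (k : nat) x : w x ^+ k = w (k%:R * x).
  by rewrite /w -cexp_natM rcM rcn; congr cexp; ring.
have qn : qs c ^+ n = 1.
  by rewrite qc wX mulrCA divff // mulr1 wE mulr_natl cos2pi sin2pi.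
exists c; split => // t nt.
have nz : n%:Z != 0 by rewrite eqz_nat -lt0n.
have hr := modz_ge0 t nz; have hl := ltz_pmod t (n0 : 0 < n%:Z).
have r0 : (t %% n%:Z)%Z != 0 by apply: contraNneq nt => h; apply/dvdz_mod0P.
have q0 : qs c != 0 by exact: qs_neq0.
have -> : qs c ^ t = qs c ^+ `|(t %% n%:Z)%Z|%N.
  transitivity (qs c ^ ((t %/ n%:Z)%Z * n%:Z + (t %% n%:Z)%Z)); first by rewrite -divz_eq.
  rewrite expfzDr // (root_dvd qn (dvdz_mull _ (dvdzz _))) mul1r exprnP.
  by congr (_ ^ _); lia.
set r := `|_|%N; have [rp rn] : (0 < r)%N /\ (r < n)%N by rewrite /r; lia.
rewrite qc wX wE; apply/eqP => -[cr _].
have := @cos_lt1 (r%:R * (2 * pi / n%:R)); rewrite cr eqxx.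
have p0 := pi_gt0 R.
have nR0 : 0 < n%:R :> R by rewrite ltr0n.
have rR0 : 0 < r%:R :> R by rewrite ltr0n.
have -> : r%:R * (2 * pi / n%:R) = (r%:R / n%:R) * (2 * pi) :> R by field.
rewrite mulr_gt0 ?divr_gt0 ?mulr_gt0 //= gtr_pMl ?mulr_gt0 //.
by rewrite ltr_pdivrMr // mul1r ltr_nat rn => /(_ isT).
Qed.

Lemma qs_natM (n : nat) (s : C R) : qs (n%:R * s) = qs s ^+ n.
Proof. by rewrite !qsE !addr0 -cexp_natM; congr cexp; ring. Qed.

Lemma qs_shift (j : nat) (c s : C R) : qs (j%:R * c + 1 * s) = qs c ^+ j * qs s.
Proof. by rewrite mul1r qsD qs_natM. Qed.

Lemma qs_reflect (s : C R) : qs (1 - s) = rc q^-1 / qs s.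
Proof. by rewrite qsD qsN qs1. Qed.

End RootShift.

(** * The coefficients theta as graded parts of chi(-1) / gamma *)

Section Theta.
Variables (R : realType) (F : padicFieldType).
Variables (mu : {measure set (borelF F) -> \bar R}).
Variables (psi : F -> C R) (hpsi : add_character psi) (hnt : exists x : F, psi x != 1).
Variables (hsd : self_dual_measure mu psi).
Variables (varpi : F) (hv : uniformizer varpi).
Variables (chi : F -> C R) (a : nat) (sc : smooth_character chi a).
Variables (gamma : C R -> C R) (hgamma : tate_gamma mu psi chi gamma).
Variables (n : nat) (n0 : (0 < n)%N).
Local Notation q := ((residue_card F)%:R : R).
Local Notation qs := (@qpowN R F).
Local Notation eps := (tate_epsilon varpi chi gamma).
Local Notation E := (cond psi chi).

Lemma alpha_neq0 : chi varpi != 0.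
Proof. by case: (sc) => _ h _ _; apply: h; exact: varpi_neq0 hv. Qed.

Lemma unramified_exp : unramified chi -> unramified (char_exp chi n).
Proof. by move=> h x x0 vx; rewrite /char_exp h // expr1n. Qed.

Lemma LfactorE (chi' : F -> C R) s : unramified chi' ->
  Lfactor varpi chi' s = (1 - chi' varpi * qs s)^-1.
Proof. by move=> h; rewrite /Lfactor asboolT. Qed.

Lemma ae_shift (P : C R -> Prop) (c : C R) : ae P ->
  ae (fun s => forall j : 'I_n, P (j%:R * c + 1 * s)).
Proof. by move=> h; apply: ae_all_ord => j; apply: ae_affine h; exact: oner_neq0. Qed.

(** Translation by jc only multiplies q^-s by a root of unity, so one and the same family theta_m(s)
    serves for all j, theta_m carrying the class m + E. *)
Lemma theta_sum (c : C R) : qs c ^+ n = 1 ->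
  ae (fun s => forall j : 'I_n, gamma (j%:R * c + 1 * s) != 0 /\
    chi (-1) / gamma (j%:R * c + 1 * s) =
    \sum_(m < n) (qs c ^ (m%:Z + E)) ^+ j * theta n varpi chi eps m s).
Proof.
move=> cn; have c0 : qs c != 0 by exact: qs_neq0.
have hmu : haar_measure mu by case: hsd.
have [un|ram] := pselect (unramified chi); last first.
  (* Here [gamma] is a monomial of degree -E in q^-s: its inverse has the single class E, that is m
     = 0. *)
  have [G G0 hG] := gamma_ramified hpsi hnt hsd hv sc hgamma ram.
  apply: aeS2 hG (ae_shift c hG) => s gs gsj j; rewrite gsj.
  have g0 t : G * qs (1 - t) ^ (add_conductor psi - (mul_conductor chi)%:Z) != 0.
    by rewrite mulf_neq0 // expfz_neq0 // qs_neq0.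
  split; first exact: g0.
  have un : (qs c ^+ j) ^ E != 0 by rewrite expfz_neq0 // expf_neq0.
  rewrite (bigD1 (Ordinal n0)) //= big1 ?addr0; last first.
    move=> m; rewrite /theta asboolF // -val_eqE /= => /negbTE ->.
    by rewrite mulr0.
  rewrite /theta asboolF //= /tate_epsilon /Lfactor !asboolF //; last by move/unramified_inv.
  rewrite mulr1 divr1 gs add0r exprz_expn_comm.
  have -> : qs (1 - (j%:R * c + 1 * s)) = qs (1 - s) * (qs c ^+ j)^-1.
    by rewrite !qs_reflect qs_shift invfM; ring.
  have := g0 s; rewrite expfzMl -/E exprz_inv -invr_expz mulf_eq0 negb_or => /andP[_ ].
  by move: un; set U := _ ^ E; set P := _ ^ E => U0 P0; field; rewrite U0 P0 G0.
have uni : unramified (char_inv chi) by apply/unramified_inv.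
have hG := gamma_unramified hpsi hnt hsd hv sc hgamma un.
have aA := ae_denominator F (chi varpi) n0.
have aA1 := ae_denominator F (chi varpi) (isT : (0 < 1)%N).
have aB := ae_reflect (ae_denominator F (chi varpi)^-1 n0).
have aB1 := ae_reflect (ae_denominator F (chi varpi)^-1 (isT : (0 < 1)%N)).
have al0 := alpha_neq0.
have E_e : E = add_conductor psi by rewrite /cond mul_conductor_unramified // subr0.
have cN1 : chi (-1) = 1 by rewrite un ?N1_neq0 // vlN vl1.
apply: aeS2 (ae_and hG (ae_shift c hG)) (ae_and (ae_and aA aA1) (ae_and aB aB1)).
move=> s [gs gsj] [[dA]]; rewrite !expr1 => dA1 [dB dB1] j.
set V := rc (vol mu 0) in gs gsj.
have V0 : V != 0 by rewrite rc_eq0 gt_eqF // (vol_gt0 hmu).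
pose Q : C R := rc q^-1.
have Q0 : Q != 0 by rewrite rc_eq0 invr_eq0 q_neq0.
set A := chi varpi * qs s in dA dA1 gs.
have A0 : A != 0 by rewrite mulf_neq0 // qs_neq0.
have BE : (chi varpi)^-1 * qs (1 - s) = Q / A by rewrite qs_reflect /A invfM mulrCA.
rewrite BE in dB dB1 gs.
pose u := qs c ^+ j.
have un1 : u ^+ n = 1 by rewrite /u exprAC cn expr1n.
have u0 : u != 0 by exact: expf_neq0.
have zE : chi varpi * qs (j%:R * c + 1 * s) = u * A by rewrite qs_shift mulrCA.
have BjE : (chi varpi)^-1 * qs (1 - (j%:R * c + 1 * s)) = Q / (u * A).
  by rewrite qs_reflect -zE invfM mulrCA.
set z := u * A in zE BjE.
have z0 : z != 0 by exact: mulf_neq0.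
have zn : z ^+ n = A ^+ n by rewrite exprMn un1 mul1r.
have dz : 1 - z != 0.
  by rewrite subr_eq0; apply: contraNneq dA => h; rewrite -zn -h expr1n subrr.
have dQz : 1 - Q / z != 0.
  rewrite subr_eq0; apply: contraNneq dB => h.
  by rewrite expr_div_n -zn -expr_div_n -h expr1n subrr.
have gj : gamma (j%:R * c + 1 * s) = V * (Q / z) ^ E * (1 - z) / (1 - Q / z).
  by rewrite gsj BjE zE E_e.
(* The two L-factors cancel the two factors 1 - A and 1 - Q/A of [gamma], which leaves a
   monomial. *)
have eps_s : eps s = V * (Q / A) ^ E.
  rewrite /tate_epsilon !LfactorE // [char_inv chi varpi]/char_inv BE -/A gs E_e.
  by set P := _ ^ _; move: dB1; set t := Q / A => dB1; field; rewrite dA1 dB1.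
have P0 : (Q / A) ^ E != 0 by rewrite expfz_neq0 // mulf_neq0 // invr_eq0.
have U0 : u ^ E != 0 by exact: expfz_neq0.
have QzE : (Q / z) ^ E = (Q / A) ^ E / u ^ E.
  by rewrite /z invfM mulrCA expfzMl exprz_inv -invr_expz mulrC.
split.
  have Pz0 : (Q / z) ^ E != 0 by rewrite expfz_neq0 // mulf_neq0 // invr_eq0.
  rewrite gj; apply: mulf_neq0; last by rewrite invr_eq0.
  by apply: mulf_neq0 => //; exact: mulf_neq0.
have thE (m : 'I_n) : (qs c ^ (m%:Z + E)) ^+ j * theta n varpi chi eps m s =
    u ^ E / (V * (Q / A) ^ E) * ((1 - z ^+ n)^-1 *
     (z ^+ m * (if m == n.-1 :> nat then 1 - Q / z ^+ n else 1 - Q))).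
  rewrite exprz_expn_comm -/u expfzDr // -exprnP /theta asboolT //.
  rewrite eps_s LfactorE; last exact: unramified_exp.
  have -> : char_exp chi n varpi * qs (n%:R * s) = A ^+ n.
    by rewrite qs_natM /char_exp -exprMn.
  rewrite LfactorE; last by apply/unramified_inv; exact: unramified_exp.
  have -> : char_inv (char_exp chi n) varpi * qs (1 - n%:R * s) = Q / A ^+ n.
    by rewrite qs_reflect qs_natM /char_inv /char_exp /A exprMn invfM mulrCA.
  rewrite invrK zn [z ^+ m]exprMn -/(qs s) -/A -/Q.
  by case: ifP => _; ring.
rewrite (eq_bigr _ (fun m _ => thE m)) -!mulr_sumr.
have := @theta_sum_identity _ z Q n.-1 z0 dz; rewrite prednK // zn => /(_ dA) <-.
rewrite gj cN1 QzE.
move: dQz; set P := _ ^ E in P0 *; set U := u ^ E in U0 *; set t := Q / z => dQz.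
by field; rewrite V0 P0 U0 dz dQz.
Qed.

End Theta.

(** * Meromorphy of the factors, and the conclusion at a generic point *)

Section MainTheorem.
Variables (R : realType) (F : padicFieldType).
Implicit Types (chi f : F -> C R).
Local Notation qs := (@qpowN R F).

Lemma mero_Lfactor (varpi : F) chi : meromorphic (Lfactor varpi chi).
Proof.
rewrite /Lfactor; case: asboolP => _; last exact: mero_cst.
apply: mero_inv; apply: mero_add; first exact: mero_cst.
by apply: mero_opp; exact: (mero_mul (mero_cst (chi varpi)) (@mero_qs R F)).
Qed.

Lemma mero_reflect (f : C R -> C R) : meromorphic f -> meromorphic (fun s => f (1 - s)).
Proof.
have n1 : -1 != 0 :> C R by rewrite oppr_eq0 oner_neq0.
move=> mf; apply: mero_ae (mero_affine 1 n1 mf).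
by apply: ae_true => s; rewrite mulN1r.
Qed.

Lemma mero_scale (f : C R -> C R) n : (0 < n)%N -> meromorphic f ->
  meromorphic (fun s => f (n%:R * s)).
Proof.
move=> n0 mf; have nn : n%:R != 0 :> C R by rewrite pnatr_eq0 -lt0n.
by apply: mero_ae (mero_affine 0 nn mf); apply: ae_true => s; rewrite add0r.
Qed.

Lemma mero_theta (n : nat) (varpi : F) chi (eps : C R -> C R) m : (0 < n)%N ->
  meromorphic eps -> meromorphic (theta n varpi chi eps m).
Proof.
move=> n0 me; have mi := mero_inv me.
rewrite /theta; case: asboolP => _; last first.
  case: (m == 0%N); last exact: mero_cst.
  exact: mero_mul (mero_cst (chi (-1))) mi.
have mL := mero_scale n0 (mero_Lfactor varpi (char_exp chi n)).
have mLi := mero_scale n0 (mero_reflect (mero_Lfactor varpi (char_inv (char_exp chi n)))).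
apply: mero_mul; last by case: (m == n.-1); [exact: mero_inv|exact: mero_cst].
apply: mero_mul; first exact: mero_mul.
by apply: mero_exprn; exact: (mero_mul (mero_cst (chi varpi)) (@mero_qs R F)).
Qed.

Lemma mero_tate_epsilon (varpi : F) chi (gamma : C R -> C R) :
  meromorphic gamma -> meromorphic (tate_epsilon varpi chi gamma).
Proof.
move=> mg; apply: mero_mul; first by apply: mero_mul => //; exact: mero_Lfactor.
by apply: mero_inv; apply: mero_reflect; exact: mero_Lfactor.
Qed.

Lemma depth_dvd n (M m : int) : (0 < n)%N ->
  exists2 d : nat, m <= M + d%:Z & (n%:Z %| M + d%:Z)%Z.
Proof.
move=> n0; pose t := (`|m| + `|M|)%N.
have nt : (t <= n * t)%N by rewrite leq_pmull.
exists `|(n * t)%N%:Z - M|%N; first by rewrite /t in nt *; lia.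
have -> : M + `|(n * t)%N%:Z - M|%N%:Z = n%:Z * t%:Z by rewrite /t in nt *; lia.
exact: dvdz_mulr.
Qed.

Lemma beta_mod n (k : int) (x : F) : (0 < n)%N ->
  beta R n k x = beta R n `|(k %% n%:Z)%Z|%N%:Z x.
Proof.
move=> n0; have nz : n%:Z != 0 by rewrite eqz_nat -lt0n.
by rewrite /beta (gez0_abs (modz_ge0 k nz)) modz_mod.
Qed.

End MainTheorem.

Theorem theorem3p1 (R : realType) (F : padicFieldType) (p n : nat)
    (hp : residue_char F p) (hn : (1 <= n)%N) (hpn : coprime p n)
    (hroots : exists z : F, n.-primitive_root z)
    (varpi : F) (hvarpi : uniformizer varpi)
    (chi : F -> C R) (hchi : mul_character chi)
    (psi : F -> C R) (hpsi : add_character psi)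
    (hpsi_nontriv : exists x : F, psi x != 1)
    (mu : {measure set (borelF F) -> \bar R}) (hmu : self_dual_measure mu psi)
    (gamma : C R -> C R) (hgamma : tate_gamma mu psi chi gamma)
    (phi : F -> C R) (hphi : schwartz phi)
    (k : int) (hk : 0 <= k < n%:Z) :
  mero_eq
    (fun s => zeta_n mu n k chi (fourier mu psi phi) s)
    (fun s => \sum_(m < n)
       theta n varpi chi (tate_epsilon varpi chi gamma) m s *
       zeta_n mu n (m%:Z + cond psi chi - k) (char_inv chi) phi (1 - s)).
Proof.
case: k hk => // k; rewrite ltz_nat => /= kn.
have [a sc] := mul_character_smooth hchi; have sci := smooth_inv sc.
have hh : haar_measure mu by case: hmu.
have [M [m hf]] : exists M m, schwartz_bounds phi M m by apply/schwartzP.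
have hft := fourier_bounds hh hpsi hpsi_nontriv hf.
set ft := fourier mu psi phi in hft *.
set M' := add_conductor psi - m in hft; set m' := add_conductor psi - M in hft.
have [d hd nd] := depth_dvd M m hn; have [d' hd' nd'] := depth_dvd M' m' hn.
set E := cond psi chi.
pose Rl l := zform M' d' n l (coef mu chi ft) (ft 0 * kappa mu chi) (chi varpi).
pose Sl l := zform M d n l (coef mu (char_inv chi) phi)
  (phi 0 * kappa mu (char_inv chi)) (char_inv chi varpi).
(* The index m + E - k may be any integer; its class is represented in [0, n), as the tail of
   [zform] requires. *)
pose ix (i : 'I_n) := `|((i%:Z + E - k%:Z) %% n%:Z)%Z|%N.
have ixn i : (ix i < n)%N.
  have nz : n%:Z != 0 by rewrite eqz_nat -lt0n.
  have := modz_ge0 (i%:Z + E - k%:Z) nz; have := ltz_pmod (i%:Z + E - k%:Z) (hn : 0 < n%:Z).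
  by rewrite /ix; lia.
have [mL hL] : meromorphic (zeta_n mu n k%:Z chi ft) /\
    ae (fun s => zeta_n mu n k%:Z chi ft s = Rl k (@qpowN R F s)).
  by apply: (zeta_formula hh hvarpi sc hft hn kn hd' nd') => x _.
have hS (i : 'I_n) : meromorphic (zeta_n mu n (i%:Z + E - k%:Z) (char_inv chi) phi) /\
    ae (fun s => zeta_n mu n (i%:Z + E - k%:Z) (char_inv chi) phi s = Sl (ix i) (@qpowN R F s)).
  apply: (zeta_formula hh hvarpi sci hf hn (ixn i) hd nd) => x _.
  by rewrite (beta_mod _ _ _ hn).
have mg : meromorphic gamma by case: hgamma.
split => //.
  apply: mero_sum => i; apply: mero_mul; last by apply: mero_reflect; case: (hS i).
  by apply: mero_theta => //; exact: mero_tate_epsilon.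
have [c [cn cprim]] := @root_shift R F n hn.
have hth := theta_sum hpsi hpsi_nontriv hmu hvarpi sc hgamma hn cn.
have [_ tR] := zeta_total hmu hvarpi sc hft hd'.
have [_ tS] := zeta_total hmu hvarpi sci hf hd.
have fe := ae_and (functional_equation hpsi hpsi_nontriv hmu hvarpi sc hgamma hphi)
  (ae_and tR (ae_reflect tS)).
have aS : ae (fun s => forall i : 'I_n,
    zeta_n mu n (i%:Z + E - k%:Z) (char_inv chi) phi (1 - s) = Sl (ix i) (@qpowN R F (1 - s))).
  by apply: ae_all_ord => i; case: (hS i) => _ /ae_reflect.
have al0 := alpha_neq0 hvarpi sc.
have dA := @ae_denominator R F _ (chi varpi) hn.
have dB := ae_reflect (@ae_denominator R F _ (char_inv chi varpi) hn).
apply: aeS2 (ae_and (ae_and hL aS) (ae_and dA dB)) (ae_and hth (ae_shift n c fe)).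
move=> s [[-> eS] [nA nB]] [th feq].
under eq_bigr do rewrite eS.
(* At s + jc the variable q^-s is multiplied by w^j and q^-(1-s) by w^-j, with w = [qs c]: hence the
   opposite signs of l on the two sides. *)
apply: (@dft_convolution _ _ _ hn cn cprim (fun l => Rl l (@qpowN R F s))
  (fun l => Sl l (@qpowN R F (1 - s)))
  (fun i => theta n varpi chi (tate_epsilon varpi chi gamma) i s) E k kn) => j.
have [gj tj] := th j; have [f1 [f2 f3]] := feq j.
have c0 := qs_neq0 F c.
have un : (@qpowN R F c ^+ j) ^+ n = 1 by rewrite exprAC cn expr1n.
have uV : (@qpowN R F c ^+ j)^-1 ^+ n = 1 by rewrite exprVn un invr1.
rewrite -tj.
have eR : ztotal mu varpi chi ft M' d' (@qpowN R F (j%:R * c + 1 * s)) =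
    \sum_(l < n) (@qpowN R F c ^ l%:Z) ^+ j * Rl l (@qpowN R F s).
  rewrite qs_shift /ztotal (zform_split _ _ hn nd' al0 (qs_neq0 F s) un nA).
  by apply: eq_bigr => l _; rewrite exprz_expn_comm -exprnP.
have eS' : ztotal mu varpi (char_inv chi) phi M d (@qpowN R F (1 - (j%:R * c + 1 * s))) =
    \sum_(l < n) (@qpowN R F c ^ (- l%:Z)) ^+ j * Sl l (@qpowN R F (1 - s)).
  have -> : @qpowN R F (1 - (j%:R * c + 1 * s)) = (@qpowN R F c ^+ j)^-1 * @qpowN R F (1 - s).
    by rewrite !qs_reflect qs_shift invfM mulrCA.
  have ai0 : char_inv chi varpi != 0 by rewrite invr_eq0.
  rewrite /ztotal (zform_split _ _ hn nd ai0 (qs_neq0 F (1 - s)) uV nB).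
  by apply: eq_bigr => l _; rewrite exprz_expn_comm -invr_expz -exprnP exprVn.
rewrite -eR -eS' -f2 -f3; apply: (mulfI gj); rewrite f1; field.
exact: gj.
Qed.
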